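(* Let $M=\mathbb{T}^2$ be the flat torus with coordinates $(x,y)$. Suppose $u=\omega\,\frac{\partial}{\partial y}$, for some constant $\omega$, regarded as a steady solution of the Euler equations $\nabla_uu=-\frac1\rho\operatorname{grad}p(\rho)$, $\operatorname{div}(\rho u)=0$ with constant uniform density $\rho\equiv1$. Let $c$ be the speed of sound, defined by $c^2=p'(1)$ (with $c>0$), for an arbitrary function $p(\rho)$. Let $\gamma=(\eta,F)$ be the corresponding barotropic geodesic, and let $J=(j\circ\eta,G)$ be a Jacobi field along $\gamma$ arising from a variation through barotropic geodesics, with initial conditions $j(0,\cdot)=0$ and $j_t(0,\cdot)=v_0$ for some velocity field $v_0$ on $\mathbb{T}^2$. Then $j$ is bounded in time if and only if $v_0$ is a gradient; otherwise $j$ grows linearly in time at every point.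
   Context: $N=M=\mathbb{T}^2$, with volume form $\mu=\nu=dx\,dy$. All objects are $C^\infty$. For an (orientation-preserving) diffeomorphism $\eta$ of $M$, its density $\rho:M\to\mathbb{R}^+$ is defined by $(\rho\circ\eta)\,\eta^*\mu=\nu$; the velocity $u$ of a curve $\eta(t)$ is defined by $\eta_t=u\circ\eta$. Let $\lambda:\mathbb{R}^+\to\mathbb{R}^+$ be smooth, $\varphi(\rho)=\frac12(\lambda(\rho)-\rho\lambda'(\rho))$ and $p(\rho)=\rho^2\varphi(\rho)/\lambda(\rho)^2$. The space $C^\infty(M,M\times\mathbb{R})$ carries the (weak) Riemannian metric $\langle\langle(u\circ\eta,f\circ\eta),(v\circ\eta,g\circ\eta)\rangle\rangle_{(\eta,F)}=\int_M[\lambda(\rho)fg+\rho\langle u,v\rangle]\,d\mu$ at points where $\eta$ is a diffeomorphism. A barotropic geodesic is a geodesic $(\eta(t),F(t))$ whose velocity is $(u\circ\eta,f\circ\eta)$ with $f=\rho/\lambda(\rho)$; then $(u,\rho)$ solves $u_t+\nabla_uu=-\frac1\rho\operatorname{grad}p(\rho)$, $\rho_t+\operatorname{div}(\rho u)=0$. The Jacobi field is $J(t)=\partial_s|_{s=0}\zeta(s,t)$ for a smooth family $\zeta(s,\cdot)=(\overline\eta,\overline F)$ of barotropic geodesics with $\zeta(0,t)=\gamma(t)$ and $\zeta(s,0)=(\mathrm{id},0)$ for all $s$. With $v=\partial_s|_{s=0}\overline u$, $\sigma=\partial_s|_{s=0}\overline\rho$ the derivatives of velocity and density, the field $j$ is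 governed in this case by $$(\partial_t+\omega\partial_y)j=v,\quad(\partial_t+\omega\partial_y)\sigma+\operatorname{div}v=0,\quad(\partial_t+\omega\partial_y)v+c^2\operatorname{grad}\sigma=0,$$ together with $\sigma=-\operatorname{div}j$, and $j(0,\cdot)=0$, $\sigma(0,\cdot)=0$, $v(0,\cdot)=v_0$.
   Formalization: ''Grows linearly at every point'' fails where the divergence-free part w of v_0 vanishes (ω=0, v_0=(sin 2πy,0), y=0). Proved instead: j=t·w+O(1) uniformly along the flow, w not identically 0, and linear growth along the flow of each point where w is nonzero. *)

(* Defs.v *)
From Stdlib Require Import Reals ZArith.
From Coquelicot Require Import Coquelicot.
Open Scope R_scope.

(** * Smooth functions

    [Ck n U f]: on the open set [U], [f] is continuous and all its iterated
    directional derivatives of order at most [n] exist and are continuous.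
    On a finite-dimensional space this is the usual notion of class C^n. *)

Fixpoint Ck {V : NormedModule R_AbsRing} (n : nat) (U : V -> Prop)
    (f : V -> R) : Prop :=
  (forall x, U x -> continuous f x) /\
  match n with
  | O => True
  | S m => forall v : V,
      (forall x, U x -> ex_derive (fun h : R => f (plus x (scal h v))) 0) /\
      Ck m U (fun x => Derive (fun h : R => f (plus x (scal h v))) 0)
  end.

Definition smooth_on {V : NormedModule R_AbsRing} (U : V -> Prop)
    (f : V -> R) : Prop := forall n, Ck n U f.

Definition smooth_map_on {V : NormedModule R_AbsRing} (U : V -> Prop)
    (X : V -> R * R) : Prop :=
  smooth_on U (fun z => fst (X z)) /\ smooth_on U (fun z => snd (X z)).

(** * The flat torus

    T^2 = R^2/Z^2.  Functions and vector fields on T^2 are Z^2-periodic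
    functions on R^2.  A map of T^2 homotopic to the identity is represented by
    a lift to R^2, which commutes with Z^2; every curve of maps of T^2 issued
    from the identity has a unique continuous lift of this form. *)

Definition pt := (R * R)%type.

Definition whole {V : Type} : V -> Prop := fun _ => True.

Definition translate (m n : Z) (p : pt) : pt :=
  (fst p + IZR m, snd p + IZR n).

Definition periodic {A : Type} (f : pt -> A) : Prop :=
  forall (m n : Z) (p : pt), f (translate m n p) = f p.

Definition torus_map (e : pt -> pt) : Prop :=
  forall (m n : Z) (p : pt), e (translate m n p) = translate m n (e p).

Definition d_x (f : pt -> R) (p : pt) : R :=
  Derive (fun x => f (x, snd p)) (fst p).

Definition d_y (f : pt -> R) (p : pt) : R :=
  Derive (fun y => f (fst p, y)) (snd p).

Definition grad (f : pt -> R) (p : pt) : pt := (d_x f p, d_y f p).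

Definition div (X : pt -> pt) (p : pt) : R :=
  d_x (fun q => fst (X q)) p + d_y (fun q => snd (X q)) p.

Definition dot (a b : pt) : R := fst a * fst b + snd a * snd b.

Definition torus_function (f : pt -> R) : Prop :=
  smooth_on whole f /\ periodic f.

Definition vector_field (X : pt -> pt) : Prop :=
  smooth_map_on whole X /\ periodic X.

Definition is_gradient (X : pt -> pt) : Prop :=
  exists f, torus_function f /\ forall p, X p = grad f p.

Definition torus_integral (f : pt -> R) : R :=
  RInt (fun x => RInt (fun y => f (x, y)) 0 1) 0 1.

(** * Diffeomorphisms and densities *)

Definition jac (e : pt -> pt) (p : pt) : R :=
  d_x (fun q => fst (e q)) p * d_y (fun q => snd (e q)) p
  - d_y (fun q => fst (e q)) p * d_x (fun q => snd (e q)) p.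

Definition diffeo (e : pt -> pt) : Prop :=
  torus_map e /\ smooth_map_on whole e /\ (forall p, 0 < jac e p) /\
  exists e' : pt -> pt,
    torus_map e' /\ smooth_map_on whole e' /\
    (forall p, e' (e p) = p) /\ (forall p, e (e' p) = p).

(** The value [rho (e p)] of the density, given by
    [(rho o e) e^* (dx dy) = dx dy], i.e. [rho (e p) * jac e p = 1]. *)
Definition density_at (e : pt -> pt) (p : pt) : R := / jac e p.

(** * The metric on C^oo(T^2, T^2 x R)

    [lam] is a function of the density, used on (0, oo) only. *)

Definition phi (lam : R -> R) (r : R) : R := (lam r - r * Derive lam r) / 2.

Definition pressure (lam : R -> R) (r : R) : R :=
  r ^ 2 * phi lam r / lam r ^ 2.

(** The inner product of the tangent vectors [(X, a) = (u o e, f o e)] and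
    [(Y, b) = (v o e, g o e)] at [(e, _)].  The integral over the target of
    [(lam rho * f * g + rho * <u, v>) dx dy] is written as the integral over
    the source of the pull-back of this 2-form by [e]. *)
Definition metric (lam : R -> R) (e : pt -> pt)
    (X : pt -> pt) (a : pt -> R) (Y : pt -> pt) (b : pt -> R) : R :=
  torus_integral (fun p =>
    (lam (density_at e p) * (a p * b p) + density_at e p * dot (X p) (Y p))
    * jac e p).

(** * Geodesics *)

Definition velocity (eta : R -> pt -> pt) (t : R) (p : pt) : pt :=
  (Derive (fun r => fst (eta r p)) t, Derive (fun r => snd (eta r p)) t).

Definition velocityF (F : R -> pt -> R) (t : R) (p : pt) : R :=
  Derive (fun r => F r p) t.

Definition energy (lam : R -> R) (eta : R -> pt -> pt) (F : R -> pt -> R)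
    (t0 t1 : R) : R :=
  / 2 * RInt (fun t =>
    metric lam (eta t) (velocity eta t) (velocityF F t)
                       (velocity eta t) (velocityF F t)) t0 t1.

Definition smooth_curve (I : R -> Prop) (eta : R -> pt -> pt)
    (F : R -> pt -> R) : Prop :=
  (forall t, I t -> torus_map (eta t) /\ periodic (F t)) /\
  smooth_map_on (fun z : R * pt => I (fst z)) (fun z => eta (fst z) (snd z)) /\
  smooth_on (fun z : R * pt => I (fst z)) (fun z => F (fst z) (snd z)).

(** Two-parameter families, over the open set [D] of parameters. *)
Definition smooth_family (D : R -> R -> Prop) (eta : R -> R -> pt -> pt)
    (F : R -> R -> pt -> R) : Prop :=
  (forall s t, D s t -> torus_map (eta s t) /\ periodic (F s t)) /\
  smooth_map_on (fun z : (R * R) * pt => D (fst (fst z)) (snd (fst z)))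
    (fun z => eta (fst (fst z)) (snd (fst z)) (snd z)) /\
  smooth_on (fun z : (R * R) * pt => D (fst (fst z)) (snd (fst z)))
    (fun z => F (fst (fst z)) (snd (fst z)) (snd z)).

(** Geodesics are the critical points of the energy, on every compact interval,
    under variations with fixed end points.  When [eta t] is a diffeomorphism
    for all [t], so are the maps [H eps t], [t0 <= t <= t1], for small [eps],
    so that no such condition needs to be imposed on the variation. *)
Definition geodesic (lam : R -> R) (I : R -> Prop) (eta : R -> pt -> pt)
    (F : R -> pt -> R) : Prop :=
  smooth_curve I eta F /\
  (forall t, I t -> diffeo (eta t)) /\
  forall t0 t1, t0 < t1 -> (forall t, t0 <= t <= t1 -> I t) ->
  forall (delta : R) (H : R -> R -> pt -> pt) (K : R -> R -> pt -> R),
    0 < delta ->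
    smooth_family (fun eps t => - delta < eps < delta /\ I t) H K ->
    (forall t p, I t -> H 0 t p = eta t p /\ K 0 t p = F t p) ->
    (forall eps t p, - delta < eps < delta -> t = t0 \/ t = t1 ->
       H eps t p = eta t p /\ K eps t p = F t p) ->
    is_derive (fun eps => energy lam (H eps) (K eps) t0 t1) 0 0.

(** [F_t = f o eta] with [f = rho / lam rho]. *)
Definition barotropic_geodesic (lam : R -> R) (I : R -> Prop)
    (eta : R -> pt -> pt) (F : R -> pt -> R) : Prop :=
  geodesic lam I eta F /\
  forall t p, I t ->
    is_derive (fun r => F r p) t
      (density_at (eta t) p / lam (density_at (eta t) p)).

(** * Variations and Jacobi fields

    Barotropic geodesics need not exist for all time (shocks), even those close
    to a global one.  The parameters [(s, t)] thus range over an open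
    neighbourhood [D] of [{0} x [0, oo)], which determines the Jacobi field at
    all times [t >= 0]. *)

Definition barotropic_variation (lam : R -> R) (D : R -> R -> Prop)
    (eta : R -> R -> pt -> pt) (F : R -> R -> pt -> R) : Prop :=
  open (fun z : R * R => D (fst z) (snd z)) /\
  (forall t, 0 <= t -> D 0 t) /\
  smooth_family D eta F /\
  (forall s, barotropic_geodesic lam (D s) (eta s) (F s)) /\
  (forall s p, D s 0 -> eta s 0 p = p /\ F s 0 p = 0).

(** [J = (j o eta, G)] is the derivative at [s = 0] of the family. *)
Definition jacobi_field (D : R -> R -> Prop) (eta : R -> R -> pt -> pt)
    (F : R -> R -> pt -> R) (j : R -> pt -> pt) (G : R -> pt -> R) : Prop :=
  forall t p, D 0 t ->
    is_derive (fun s => eta s t p) 0 (j t (eta 0 t p)) /\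
    is_derive (fun s => F s t p) 0 (G t p).

(** * Behaviour in time *)

Definition bounded_in_time (j : R -> pt -> pt) : Prop :=
  exists C, forall t p, 0 <= t -> norm (j t p) <= C.

Definition grows_linearly (g : R -> R) : Prop :=
  exists a b T, 0 < a /\ forall t, T <= t -> a * t <= g t <= b * t.

(** The field [j] along the flow [eta] is [t w + O(1)], uniformly on T^2. *)
Definition linear_growth_rate (eta : R -> pt -> pt) (j : R -> pt -> pt)
    (w : pt -> pt) : Prop :=
  exists C, forall t p, 0 <= t ->
    norm (minus (j t (eta t p)) (scal t (w p))) <= C.

(** [w] is the divergence-free part of [X] in its Helmholtz decomposition. *)
Definition divergence_free_part (X w : pt -> pt) : Prop :=
  vector_field w /\ (forall p, div w p = 0) /\
  is_gradient (fun p => minus (X p) (w p)).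

(* Main.v *)
(** Let [Y t p] be the derivative in [s] of the family of maps [eta s t p] at [s = 0], so that
    [Y] is the field [j] in the Lagrangian coordinates of the base flow, which is a
    translation.  The action of [eta s] perturbed by [eps * bump t * q p] is smooth in
    [(s, eps)] near [0] and critical at [eps = 0] for every [s]; its mixed second derivative at
    [(0, 0)] is therefore zero.  Since the determinant is a null Lagrangian, this says that
    [Y_tt - c^2 grad div Y] is orthogonal to every [q], hence [Y_tt = c^2 grad div Y].

    Then [int |Y_t|^2 + c^2 (div Y)^2] is constant, so [div Y] is bounded in [L^2], and so are
    its space derivatives, because these solve the same equation.  On the other hand the curl
    and the mean of [Y] are linear in [t], so they vanish for
    [e = (S Y(T) - T Y(S)) / (S + T)].  For a curl-free field [int |grad e|^2 = int (div e)^2],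
    whence by a Sobolev inequality [e] is bounded uniformly in [S] and [T], that is
    [|Y(T)/T - Y(S)/S| <= C (1/T + 1/S)].  Together with the same bounds for the space
    derivatives, this shows that [Y(T)/T] tends to a smooth field [w] with
    [|Y(t) - t w| <= C].  The field [w] is divergence free and has the curl and the mean of
    [v0], so that [v0 - w] is a gradient: the Helmholtz decomposition of [v0] is obtained from
    the evolution itself. *)
Require Import Defs.
From Stdlib Require Import Reals ZArith.
From Coquelicot Require Import Coquelicot.
From Stdlib Require Import Lra ssreflect Classical ClassicalEpsilon FunctionalExtensionality.
Open Scope R_scope.

(** * Directional derivatives and the classes C^n *)

(** The members of the family are given only as critical points of the energy that satisfy the
    barotropic condition: the wave equation for [Y] has to be extracted from criticality. They need
    not share a time interval for all small [s], so each argument about the family uses one compact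
    interval [[t0, t1]]; the neighbourhood of [s = 0] on which it is valid comes from compactness
    and may shrink as [t1] grows. This is harmless, because only derivatives at [s = 0] are taken.
    The Sobolev bound is not homogeneous: its right-hand side is 1 plus an integral of squares.
    Applied to [Y(T)/T - Y(S)/S] it would give no decay. It is applied to [e], which is merely
    bounded, and the decay is the explicit factor in the identity [Y(T)/T - Y(S)/S = (1/T + 1/S) e].
    The energy controls [Y_t] and [div Y] in [L^2] only. Since space derivatives of solutions are
    solutions, each estimate is proved for all solutions and reused for derivatives; this gives both
    the uniform bounds and the smoothness of [w]. *)

Definition dirD {V : NormedModule R_AbsRing} (v : V) (f : V -> R) (x : V) : R :=
  Derive (fun h : R => f (plus x (scal h v))) 0.

Lemma Derive_shift (f : R -> R) (a : R) :
  Derive f a = Derive (fun h => f (a + h)) 0.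
Proof.
  rewrite /Derive. congr real. apply Lim_ext => h. by rewrite Rplus_0_r Rplus_0_l.
Qed.

Lemma line_add {V : NormedModule R_AbsRing} (x v : V) (h k : R) :
  plus x (scal (h + k) v) = plus (plus x (scal h v)) (scal k v).
Proof.
  rewrite -plus_assoc. congr plus. exact: (@scal_distr_r _ V h k v).
Qed.

Lemma line_0 {V : NormedModule R_AbsRing} (x v : V) : plus x (scal 0 v) = x.
Proof. rewrite (@scal_zero_l _ V v). by rewrite plus_zero_r. Qed.

Lemma dirD_line {V : NormedModule R_AbsRing} (v : V) (f : V -> R) (x : V) (h : R) :
  Derive (fun k : R => f (plus x (scal k v))) h = dirD v f (plus x (scal h v)).
Proof.
  rewrite Derive_shift. apply Derive_ext => k. by rewrite line_add.
Qed.

Lemma continuous_line {V : NormedModule R_AbsRing} (x v : V) (h : R) :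
  continuous (fun k : R => plus x (scal k v)) h.
Proof.
  apply: (continuous_plus (fun _ => x) (fun k : R => scal k v)).
  - exact: continuous_const.
  - apply: (continuous_scal_l (fun k : R => k) v). exact: continuous_id.
Qed.

Lemma locally_line {V : NormedModule R_AbsRing} (U : V -> Prop) (x v : V) (h : R) :
  open U -> U (plus x (scal h v)) -> locally h (fun k : R => U (plus x (scal k v))).
Proof. move=> oU Ux. apply: (continuous_line x v h). exact: oU. Qed.

Lemma dirD_ext_loc {V : NormedModule R_AbsRing} (U : V -> Prop) (v : V) (f g : V -> R) (x : V) :
  open U -> (forall y, U y -> f y = g y) -> U x -> dirD v f x = dirD v g x.
Proof.
  move=> oU fg Ux. apply: Derive_ext_loc.
  have := locally_line U x v 0 oU.
  rewrite line_0 => /(_ Ux). apply: filter_imp => k. exact: fg.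
Qed.

Lemma dirD_ext {V : NormedModule R_AbsRing} (v : V) (f g : V -> R) (x : V) :
  (forall y, f y = g y) -> dirD v f x = dirD v g x.
Proof. move=> fg. by apply Derive_ext. Qed.

Lemma Ck_ext {V : NormedModule R_AbsRing} n (U : V -> Prop) (f g : V -> R) :
  open U -> (forall x, U x -> f x = g x) -> Ck n U f -> Ck n U g.
Proof.
  move=> oU. elim: n f g => [|n IH] f g fg /= [cf df]; split.
  1,3: move=> x Ux; apply: (continuous_ext_loc _ f); [|exact: cf];
       apply: filter_imp (oU x Ux) => y; exact: fg.
  - done.
  - move=> v. case: (df v) => [ef Df]. split.
    + move=> x Ux. apply: (ex_derive_ext_loc (fun h : R => f (plus x (scal h v)))); last exact: ef.
      have := locally_line U x v 0 oU.
      rewrite line_0 => /(_ Ux). apply: filter_imp => k. exact: fg.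
    + apply: IH Df => x Ux. exact: (dirD_ext_loc U).
Qed.

Lemma Ck_pred {V : NormedModule R_AbsRing} n (U : V -> Prop) (f : V -> R) :
  Ck (S n) U f -> Ck n U f.
Proof.
  elim: n f => [|n IH] f; first by case.
  move=> [cf df]. split=> // v. case: (df v) => [ef Df]. split=> //. exact: IH.
Qed.

Lemma Ck_cont {V : NormedModule R_AbsRing} n (U : V -> Prop) (f : V -> R) x :
  Ck n U f -> U x -> continuous f x.
Proof. case: n => [|n] [cf _]; exact: cf. Qed.

Lemma Ck_subset {V : NormedModule R_AbsRing} n (U U' : V -> Prop) (f : V -> R) :
  (forall x, U' x -> U x) -> Ck n U f -> Ck n U' f.
Proof.
  move=> UU. elim: n f => [|n IH] f [cf df]; split; auto.
  move=> v. case: (df v) => [ef Df]. split; auto.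
Qed.

Lemma Ck_const {V : NormedModule R_AbsRing} n (U : V -> Prop) (c : R) :
  open U -> Ck n U (fun _ : V => c).
Proof.
  move=> oU. elim: n c => [|n IH] c; split; try (move=> x _; exact: continuous_const).
  - done.
  - move=> v. split.
    + move=> x _. exact: ex_derive_const.
    + apply: Ck_ext (IH 0) => // x Ux. by rewrite Derive_const.
Qed.

(** [Ck] speaks of derivatives at parameter 0 only. Moving the base point along the line gives the
    derivative at every parameter [h]. *)
Lemma Ck_is_derive {V : NormedModule R_AbsRing} n (U : V -> Prop) (f : V -> R) (x v : V) (h : R) :
  Ck (S n) U f -> U (plus x (scal h v)) ->
  is_derive (fun k : R => f (plus x (scal k v))) h (dirD v f (plus x (scal h v))).
Proof.
  move=> [_ /(_ v) [ef _]] Ux.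
  have H := Derive_correct _ _ (ef _ Ux).
  rewrite -/(dirD v f (plus x (scal h v))) in H.
  have H2 : is_derive (fun k : R => plus k (opp h)) h one.
    rewrite /plus /opp /one /=. auto_derive => //.
  apply: (is_derive_ext (fun k : R => f (plus (plus x (scal h v)) (scal (k - h) v)))).
    move=> k. rewrite -line_add. by rewrite (_ : h + (k - h) = k); last ring.
  rewrite -[X in is_derive _ _ X](@scal_one R_AbsRing R_NormedModule).
  apply: (is_derive_comp (fun k : R => f (plus (plus x (scal h v)) (scal k v))) (fun k => k - h)).
  - by rewrite Rminus_diag.
  - exact: H2.
Qed.

Lemma Ck_plus {V : NormedModule R_AbsRing} n (U : V -> Prop) (f g : V -> R) :
  open U -> Ck n U f -> Ck n U g -> Ck n U (fun x => f x + g x).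
Proof.
  move=> oU. elim: n f g => [|n IH] f g [cf df] [cg dg]; split.
  1,3: move=> x Ux; apply: (continuous_plus f g); auto.
  - done.
  - move=> v. case: (df v) => [ef Df]. case: (dg v) => [eg Dg]. split.
    + move=> x Ux. apply: (@ex_derive_plus _ R_NormedModule); auto.
    + apply: Ck_ext (IH _ _ Df Dg) => // x Ux. rewrite Derive_plus; auto.
Qed.

Lemma Ck_mult {V : NormedModule R_AbsRing} n (U : V -> Prop) (f g : V -> R) :
  open U -> Ck n U f -> Ck n U g -> Ck n U (fun x => f x * g x).
Proof.
  move=> oU. elim: n f g => [|n IH] f g Hf Hg; split.
  1,3: move=> x Ux; apply: (continuous_mult f g); [exact: Ck_cont Hf Ux | exact: Ck_cont Hg Ux].
  - done.
  - move=> v. case: (Hf) => _ /(_ v) [ef Df]. case: (Hg) => _ /(_ v) [eg Dg]. split.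
    + move=> x Ux. apply: (ex_derive_mult (fun h : R => f (plus x (scal h v))) (fun h : R => g (plus x (scal h v)))); auto.
    + apply: Ck_ext (Ck_plus n U _ _ oU (IH _ _ Df (Ck_pred _ _ _ Hg)) (IH _ _ (Ck_pred _ _ _ Hf) Dg)) => // x Ux.
      rewrite Derive_mult; auto. by rewrite !line_0.
Qed.

(** The outer function has one variable: the lemma serves for [lam] and for the inverse, while the
    other substitutions are affine and go through [Ck_affine]. *)
Lemma Ck_comp {V : NormedModule R_AbsRing} n (U : V -> Prop) (W : R -> Prop) (phi : R -> R) (f : V -> R) :
  open U -> (forall x, U x -> W (f x)) -> Ck n W phi -> Ck n U f -> Ck n U (fun x => phi (f x)).
Proof.
  move=> oU UW. elim: n phi => [|n IH] phi Hp Hf; split.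
  1,3: move=> x Ux; apply: (continuous_comp f phi);
    [exact: Ck_cont Hf Ux | exact: Ck_cont Hp (UW _ Ux)].
  - done.
  - have dphi y : W y -> is_derive phi y (dirD (1 : R) phi y).
      move=> Wy. have := Ck_is_derive n W phi (0 : R) (1 : R) y Hp.
      rewrite /plus /scal /= /mult /= Rmult_1_r Rplus_0_l => /(_ Wy).
      apply: is_derive_ext => k /=. by rewrite Rmult_1_r Rplus_0_l.
    move=> v. case: (Hf) => _ /(_ v) [ef Df]. case: (Hp) => _ /(_ (1 : R)) [ep Dp].
    have key x : U x -> is_derive (fun h : R => phi (f (plus x (scal h v)))) 0 (dirD v f x * dirD (1 : R) phi (f x)).
      move=> Ux. apply: (is_derive_comp phi (fun h : R => f (plus x (scal h v)))).
      + rewrite line_0. apply: dphi. exact: UW.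
      + exact: Derive_correct (ef _ Ux).
    split.
    + move=> x Ux. eexists. exact: key.
    + apply: Ck_ext (Ck_mult n U _ _ oU Df (IH _ Dp (Ck_pred _ _ _ Hf))) => // x Ux.
      symmetry. apply: is_derive_unique. exact: key.
Qed.

Lemma dirD_affine {V W : NormedModule R_AbsRing} (L l : W -> V) (f : V -> R) (v x : W) :
  (forall h, L (plus x (scal h v)) = plus (L x) (scal h (l v))) ->
  dirD v (fun y => f (L y)) x = dirD (l v) f (L x).
Proof. move=> HL. apply Derive_ext => h. by rewrite HL. Qed.

(** [l] is the linear part of [L]: differentiating [f o L] along [v] is differentiating [f] along
    [l v], so the induction stays within functions of the same form. Slices, projections and
    rearrangements of products are treated this way. *)
Lemma Ck_affine {V W : NormedModule R_AbsRing} n (U : V -> Prop) (U' : W -> Prop) (L l : W -> V) (f : V -> R) :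
  open U' ->
  (forall x v (h : R), L (plus x (scal h v)) = plus (L x) (scal h (l v))) ->
  (forall x, continuous L x) -> (forall x, U' x -> U (L x)) ->
  Ck n U f -> Ck n U' (fun y => f (L y)).
Proof.
  move=> oU' HL cL UU. elim: n f => [|n IH] f Hf; split.
  1,3: move=> x Ux; apply: continuous_comp => //; exact: Ck_cont Hf (UU _ Ux).
  - done.
  - move=> v. case: (Hf) => _ /(_ (l v)) [ef Df]. split.
    + move=> x Ux. apply: ex_derive_ext (ef _ (UU _ Ux)) => h /=. by rewrite HL.
    + apply: Ck_ext (IH _ Df) => // x Ux. apply Derive_ext => h. by rewrite HL.
Qed.

Lemma Ck_id n (U : R -> Prop) : open U -> Ck n U (fun x : R => x).
Proof.
  move=> oU. case: n => [|n]; split; try (move=> x _; exact: continuous_id).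
  - done.
  - move=> v.
    have key x : is_derive (fun h : R => plus x (scal h v)) 0 v.
      rewrite /plus /scal /= /mult /=. auto_derive => //. ring.
    split.
    + move=> x _. eexists. exact: key.
    + apply: Ck_ext (Ck_const n U v oU) => // x _. symmetry. exact: is_derive_unique.
Qed.

Lemma open_pre {V W : UniformSpace} (L : W -> V) (U : V -> Prop) :
  (forall x, continuous L x) -> open U -> open (fun x => U (L x)).
Proof. move=> cL oU. apply: open_comp oU => x _. exact: cL. Qed.

Lemma Ck_inv n : Ck n (fun x : R => 0 < x) (fun x : R => / x).
Proof.
  have oU := open_gt 0.
  elim: n => [|n IH]; split.
  1,3: move=> x Hx; apply: (ex_derive_continuous (fun x => / x) x); auto_derive; lra.
  - done.
  - move=> v.
    (* The derivative is a constant times the square of the function itself, so the induction closes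
       with [Ck_mult]. *)
    have key (x : R) : 0 < x -> is_derive (fun h : R => / (plus x (scal h v))) 0 (- v * (/ x * / x)).
      move=> Hx. rewrite /plus /scal /= /mult /=. auto_derive; [lra | field; lra].
    split.
    + move=> x Hx. eexists. exact: key.
    + apply: Ck_ext (Ck_mult n _ _ _ oU (Ck_const n _ (- v) oU) (Ck_mult n _ _ _ oU IH IH)) => // x Hx.
      symmetry. apply: is_derive_unique. exact: key.
Qed.

Lemma smooth_dirD {V : NormedModule R_AbsRing} (U : V -> Prop) (v : V) (f : V -> R) :
  smooth_on U f -> smooth_on U (dirD v f).
Proof. move=> Hf n. by case: (Hf (S n)) => _ /(_ v) []. Qed.

Lemma smooth_ext {V : NormedModule R_AbsRing} (U : V -> Prop) (f g : V -> R) :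
  open U -> (forall x, U x -> f x = g x) -> smooth_on U f -> smooth_on U g.
Proof. move=> oU fg Hf n. exact: Ck_ext (Hf n). Qed.

Lemma smooth_cont {V : NormedModule R_AbsRing} (U : V -> Prop) (f : V -> R) x :
  smooth_on U f -> U x -> continuous f x.
Proof. move=> Hf. exact: Ck_cont (Hf 0%nat). Qed.

Lemma smooth_subset {V : NormedModule R_AbsRing} (U U' : V -> Prop) (f : V -> R) :
  (forall x, U' x -> U x) -> smooth_on U f -> smooth_on U' f.
Proof. move=> UU Hf n. exact: Ck_subset (Hf n). Qed.

Lemma smooth_const {V : NormedModule R_AbsRing} (U : V -> Prop) (c : R) :
  open U -> smooth_on U (fun _ : V => c).
Proof. move=> oU n. exact: Ck_const. Qed.

Lemma smooth_plus {V : NormedModule R_AbsRing} (U : V -> Prop) (f g : V -> R) :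
  open U -> smooth_on U f -> smooth_on U g -> smooth_on U (fun x => f x + g x).
Proof. move=> oU Hf Hg n. exact: Ck_plus. Qed.

Lemma smooth_mult {V : NormedModule R_AbsRing} (U : V -> Prop) (f g : V -> R) :
  open U -> smooth_on U f -> smooth_on U g -> smooth_on U (fun x => f x * g x).
Proof. move=> oU Hf Hg n. exact: Ck_mult. Qed.

Lemma smooth_scal {V : NormedModule R_AbsRing} (U : V -> Prop) (c : R) (f : V -> R) :
  open U -> smooth_on U f -> smooth_on U (fun x => c * f x).
Proof. move=> oU Hf. apply: smooth_mult => //. exact: smooth_const. Qed.

Lemma smooth_opp {V : NormedModule R_AbsRing} (U : V -> Prop) (f : V -> R) :
  open U -> smooth_on U f -> smooth_on U (fun x => - f x).
Proof.
  move=> oU Hf. apply: (smooth_ext _ (fun x => (-1) * f x)) => //; last exact: smooth_scal.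
  move=> x _. ring.
Qed.

Lemma smooth_minus {V : NormedModule R_AbsRing} (U : V -> Prop) (f g : V -> R) :
  open U -> smooth_on U f -> smooth_on U g -> smooth_on U (fun x => f x - g x).
Proof. move=> oU Hf Hg. apply: smooth_plus => //. exact: smooth_opp. Qed.

Lemma smooth_comp {V : NormedModule R_AbsRing} (U : V -> Prop) (W : R -> Prop) (phi : R -> R) (f : V -> R) :
  open U -> (forall x, U x -> W (f x)) -> smooth_on W phi -> smooth_on U f ->
  smooth_on U (fun x => phi (f x)).
Proof. move=> oU UW Hp Hf n. exact: (Ck_comp n U W). Qed.

Lemma smooth_inv {V : NormedModule R_AbsRing} (U : V -> Prop) (f : V -> R) :
  open U -> (forall x, U x -> 0 < f x) -> smooth_on U f -> smooth_on U (fun x => / f x).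
Proof. move=> oU Uf. apply: (smooth_comp U (fun x => 0 < x) Rinv) => // n. exact: Ck_inv. Qed.

Lemma smooth_affine {V W : NormedModule R_AbsRing} (U : V -> Prop) (U' : W -> Prop) (L l : W -> V) (f : V -> R) :
  open U' ->
  (forall x v (h : R), L (plus x (scal h v)) = plus (L x) (scal h (l v))) ->
  (forall x, continuous L x) -> (forall x, U' x -> U (L x)) ->
  smooth_on U f -> smooth_on U' (fun y => f (L y)).
Proof. move=> oU HL cL UU Hf n. exact: (Ck_affine n U U' L l). Qed.

Lemma smooth_coord {W : NormedModule R_AbsRing} (U' : W -> Prop) (L l : W -> R) :
  open U' ->
  (forall x v (h : R), L (plus x (scal h v)) = L x + h * l v) ->
  (forall x, continuous L x) -> smooth_on U' L.
Proof.
  move=> oU HL cL. apply: (@smooth_affine R_NormedModule W whole U' L l (fun x => x)) => //.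
  move=> n. apply: Ck_id. exact: open_true.
Qed.

Lemma smooth_is_derive {V : NormedModule R_AbsRing} (U : V -> Prop) (f : V -> R) (x v : V) (h : R) :
  smooth_on U f -> U (plus x (scal h v)) ->
  is_derive (fun k : R => f (plus x (scal k v))) h (dirD v f (plus x (scal h v))).
Proof. move=> Hf. exact: (Ck_is_derive 0 U). Qed.

Lemma smooth_is_derive0 {V : NormedModule R_AbsRing} (U : V -> Prop) (f : V -> R) (x v : V) :
  smooth_on U f -> U x -> is_derive (fun k : R => f (plus x (scal k v))) 0 (dirD v f x).
Proof.
  move=> Hf Ux. have := smooth_is_derive U f x v 0 Hf. rewrite line_0. by apply.
Qed.

(** * Mixed derivatives and linearity in the direction *)

Lemma continuous_plane {V : NormedModule R_AbsRing} (x v w : V) (z0 : R * R) :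
  continuous (fun z : R * R => plus (plus x (scal (fst z) v)) (scal (snd z) w)) z0.
Proof.
  apply: (continuous_plus (fun z : R * R => plus x (scal (fst z) v)) (fun z : R * R => scal (snd z) w)).
  - apply: (continuous_plus (fun _ => x) (fun z : R * R => scal (fst z) v)).
      exact: continuous_const.
    apply: (continuous_scal_l (fun z : R * R => fst z) v). case: z0 => a b. exact: continuous_fst.
  - apply: (continuous_scal_l (fun z : R * R => snd z) w). case: z0 => a b. exact: continuous_snd.
Qed.

Lemma continuity_2d_plane {V : NormedModule R_AbsRing} (f : V -> R) (x v w : V) :
  continuous f x -> continuity_2d_pt (fun a b => f (plus (plus x (scal a v)) (scal b w))) 0 0.
Proof.
  move=> cf. apply/continuity_2d_pt_filterlim.
  have c : continuous (fun z : R * R => f (plus (plus x (scal (fst z) v)) (scal (snd z) w))) (0, 0).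
    apply: continuous_comp; [exact: continuous_plane | by rewrite /= !line_0].
  exact: c.
Qed.

Lemma locally_plane {V : NormedModule R_AbsRing} (U : V -> Prop) (x v w : V) :
  open U -> U x ->
  locally (0, 0) (fun z : R * R => U (plus (plus x (scal (fst z) v)) (scal (snd z) w))).
Proof.
  move=> oU Ux.
  apply: (continuous_plane x v w (0, 0)). rewrite /= !line_0. exact: oU.
Qed.

Lemma plus_swap {V : NormedModule R_AbsRing} (x v w : V) : plus (plus x v) w = plus (plus x w) v.
Proof. by rewrite -!plus_assoc (plus_comm v w). Qed.

(** Schwarz's theorem in the two parameters of [g a b = f (x + a v + b w)]: the partial derivatives
    of [g] are directional derivatives of [f] at the displaced point. *)
Lemma dirD_comm {V : NormedModule R_AbsRing} (U : V -> Prop) (v w : V) (f : V -> R) (x : V) :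
  open U -> smooth_on U f -> U x -> dirD v (dirD w f) x = dirD w (dirD v f) x.
Proof.
  move=> oU Hf Ux.
  pose g a b := f (plus (plus x (scal a v)) (scal b w)).
  have gb a b : Derive (fun t => g a t) b = dirD w f (plus (plus x (scal a v)) (scal b w)).
    exact: dirD_line.
  have ga a b : Derive (fun t => g t b) a = dirD v f (plus (plus x (scal a v)) (scal b w)).
    rewrite [X in dirD v f X]plus_swap -dirD_line. apply Derive_ext => k. by rewrite /g plus_swap.
  have gab a b : Derive (fun z => Derive (fun t => g z t) b) a =
     dirD v (dirD w f) (plus (plus x (scal a v)) (scal b w)).
    rewrite [X in dirD v _ X]plus_swap -dirD_line. apply Derive_ext => k. by rewrite gb plus_swap.
  have gba a b : Derive (fun z => Derive (fun t => g t z) a) b =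
     dirD w (dirD v f) (plus (plus x (scal a v)) (scal b w)).
    rewrite -dirD_line. apply Derive_ext => k. by rewrite ga.
  have := Schwarz g 0 0. rewrite gab gba !line_0. apply.
  - apply/locally_2d_locally. apply: filter_imp (locally_plane U x v w oU Ux) => -[a b] /= Uab.
    have Uba := Uab. rewrite plus_swap in Uba.
    repeat split.
    + eexists. apply: is_derive_ext (smooth_is_derive U f _ v a Hf Uba) => k /=. by rewrite /g plus_swap.
    + eexists. exact: (smooth_is_derive U f _ w b Hf Uab).
    + eexists. apply: is_derive_ext (smooth_is_derive U (dirD w f) _ v a (smooth_dirD _ _ _ Hf) Uba) => k /=.
      by rewrite gb plus_swap.
    + eexists. apply: is_derive_ext (smooth_is_derive U (dirD v f) _ w b (smooth_dirD _ _ _ Hf) Uab) => k /=.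
      by rewrite ga.
  - apply: continuity_2d_pt_ext (continuity_2d_plane (dirD v (dirD w f)) x v w _) => //.
    by apply: (smooth_cont U) => //; do 2 apply: smooth_dirD.
  - apply: continuity_2d_pt_ext (continuity_2d_plane (dirD w (dirD v f)) x v w _) => //.
    by apply: (smooth_cont U) => //; do 2 apply: smooth_dirD.
Qed.

(** Directional derivatives taken one at a time need not depend linearly on the direction. Here the
    continuity of [dirD v f] makes [g] differentiable at the origin, and the chain rule along
    [h -> (h al, h be)] concludes. *)
Lemma dirD_linear {V : NormedModule R_AbsRing} (U : V -> Prop) (v w : V) (al be : R) (f : V -> R) (x : V) :
  open U -> smooth_on U f -> U x ->
  dirD (plus (scal al v) (scal be w)) f x = al * dirD v f x + be * dirD w f x.
Proof.
  move=> oU Hf Ux.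
  pose g a b := f (plus (plus x (scal a v)) (scal b w)).
  have dg : differentiable_pt_lim g 0 0 (dirD v f x) (dirD w f x).
    apply/filterdiff_differentiable_pt_lim.
    have := is_derive_filterdiff g 0 0
      (fun a b => dirD v f (plus (plus x (scal a v)) (scal b w))) (dirD w f x).
    rewrite !line_0. apply.
    - apply: filter_imp (locally_plane U x v w oU Ux) => -[a b] /= Uab.
      rewrite plus_swap in Uab.
      rewrite [X in dirD v f X]plus_swap.
      apply: is_derive_ext (smooth_is_derive U f _ v a Hf Uab) => k /=. by rewrite /g plus_swap.
    - apply: is_derive_ext (smooth_is_derive0 U f x w Hf Ux) => k /=. by rewrite /g line_0.
    - apply/(continuity_2d_pt_filterlim (fun a b => dirD v f (plus (plus x (scal a v)) (scal b w)))).
      apply: continuity_2d_plane. apply: (smooth_cont U) => //. exact: smooth_dirD.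
  apply: is_derive_unique. apply/is_derive_Reals.
  have := derivable_pt_lim_comp_2d g (fun h => h * al) (fun h => h * be) 0 (dirD v f x) (dirD w f x) al be.
  rewrite !Rmult_0_l => /(_ dg) H.
  have d0 (c : R) : derivable_pt_lim (fun h => h * c) 0 c.
    apply/is_derive_Reals. auto_derive => //. ring.
  have {H} := H (d0 al) (d0 be) => /is_derive_Reals H. apply/is_derive_Reals.
  rewrite (Rmult_comm al) (Rmult_comm be).
  apply: is_derive_ext H => h. rewrite /g. congr f.
  rewrite -plus_assoc. congr plus. by rewrite scal_distr_l !scal_assoc.
Qed.

(** * Integrals depending on parameters *)

(** The tube lemma: by compactness of [[a, b]] one neighbourhood of [v0] serves for all [y]. *)
Lemma tube {V : UniformSpace} (P : V * R -> Prop) (v0 : V) (a b : R) :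
  (forall y, a <= y <= b -> locally (v0, y) P) ->
  locally v0 (fun v => forall y, a <= y <= b -> P (v, y)).
Proof.
  move=> H.
  have H' y : exists d : posreal, a <= y <= b -> forall z : V * R, ball (v0, y) d z -> P z.
    case: (classic (a <= y <= b)) => Hy.
    - case: (H y Hy) => d Hd. by exists d.
    (* The radius 1 is a default value outside [[a, b]], where nothing is claimed; it makes the
       gauge a total function. *)
    - exists (mkposreal 1 Rlt_0_1). by move=> /Hy.
  pose delta y := proj1_sig (constructive_indefinite_description _ (H' y)).
  have Hd y := proj2_sig (constructive_indefinite_description _ (H' y)).
  case: (compactness_value_1d a b delta) => d Hdd.
  exists d => v Hv y Hy.
  apply: NNPP => NP. apply: (Hdd y Hy) => -[t [Ht [Hyt dt]]].
  apply: NP. apply: (Hd t Ht). split => /=.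
  - exact: ball_le Hv.
  - exact: Hyt.
Qed.

Lemma open_tube {V : UniformSpace} (W : V * R -> Prop) (a b : R) :
  open W -> open (fun v => forall y, a <= y <= b -> W (v, y)).
Proof. move=> oW v Hv. apply: tube => y Hy. exact: oW (Hv y Hy). Qed.

Lemma continuous_pair_r {V : UniformSpace} (x : V) (y : R) : continuous (fun y : R => (x, y)) y.
Proof.
  move=> P [d Hd]. exists d => z Hz. apply: Hd. split => //=. exact: ball_center.
Qed.

Lemma continuous_RInt_param {V : UniformSpace} (f : V * R -> R) (v0 : V) (a b : R) :
  a <= b -> locally v0 (fun v => forall y, a <= y <= b -> continuous f (v, y)) ->
  continuous (fun v => RInt (fun y => f (v, y)) a b) v0.
Proof.
  move=> ab Hf.
  have exR v : (forall y, a <= y <= b -> continuous f (v, y)) -> ex_RInt (fun y => f (v, y)) a b.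
    move=> Hc. apply: (@ex_RInt_continuous R_CompleteNormedModule) => y Hy. rewrite Rmin_left // Rmax_right // in Hy.
    apply: (continuous_comp (fun y => (v, y)) f); [exact: continuous_pair_r | exact: Hc].
  have Hf0 := locally_singleton _ _ Hf.
  apply/filterlim_locally => eps.
  (* The [+ 1] keeps the divisor positive when [a = b]. *)
  have [e Hee] : exists e : posreal, (b - a + 1) * e = eps / 2.
    have He : 0 < eps / 2 / (b - a + 1).
      apply: Rdiv_lt_0_compat; last lra. have := cond_pos eps. lra.
    exists (mkposreal _ He) => /=. field. lra.
  (* Near [(v0, y)], both [f z] and [f (v0, snd z)] are within [e / 2] of [f (v0, y)]; the tube
     lemma makes the resulting closeness uniform in [y]. *)
  have T : locally v0 (fun v => forall y, a <= y <= b -> Rabs (f (v, y) - f (v0, y)) <= e).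
    apply: (tube (fun z => Rabs (f z - f (v0, snd z)) <= e)) => y Hy.
    have He2 : 0 < e / 2 by have := cond_pos e; lra.
    have /filterlim_locally /(_ (mkposreal _ He2)) := Hf0 y Hy.
    move=> [d Hd]. exists d => -[v' y'] [/= Hv' Hy'].
    have := Hd (v', y') (conj Hv' Hy').
    have := Hd (v0, y') (conj (ball_center v0 d) Hy').
    rewrite /ball /= /AbsRing_ball /= /abs /minus /plus /opp /=.
    move=> H1 H2. rewrite (_ : f (v', y') - f (v0, y') = (f (v', y') + - f (v0, y)) + - (f (v0, y') + - f (v0, y))); last ring.
    apply: Rle_trans (Rabs_triang _ _) _. rewrite Rabs_Ropp (_ : pos e = e / 2 + e / 2); last field.
    apply: Rlt_le. exact: Rplus_lt_compat.
  apply: filter_imp (filter_and _ _ Hf T) => v [Hc HT].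
  rewrite /ball /= /AbsRing_ball /= /abs /minus /plus /opp /=.
  have e1 := exR v Hc. have e0 := exR v0 Hf0.
  have := norm_RInt_le_const (fun y => minus (f (v, y)) (f (v0, y))) a b
    (minus (RInt (fun y => f (v, y)) a b) (RInt (fun y => f (v0, y)) a b)) e ab.
  rewrite /norm /= /abs /minus /plus /opp /= => /(_ HT) L.
  apply: Rle_lt_trans (L _) _.
  - apply: (is_RInt_minus (V:=R_NormedModule)); exact: (RInt_correct (V:=R_CompleteNormedModule)).
  - have := cond_pos eps => Hp. have := cond_pos e. nra.
Qed.

Lemma ex_RInt_slice {V : UniformSpace} (f : V * R -> R) (v : V) (a b : R) :
  a <= b -> (forall y, a <= y <= b -> continuous f (v, y)) -> ex_RInt (fun y => f (v, y)) a b.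
Proof.
  move=> ab Hc. apply: (@ex_RInt_continuous R_CompleteNormedModule) => y Hy.
  rewrite Rmin_left // Rmax_right // in Hy.
  apply: (continuous_comp (fun y => (v, y)) f); [exact: continuous_pair_r | exact: Hc].
Qed.

Lemma prod_line {V W : NormedModule R_AbsRing} (x v : V) (y w : W) (h : R) :
  @plus (prod_NormedModule R_AbsRing V W) (x, y) (scal h ((v, w) : prod_NormedModule R_AbsRing V W))
  = (plus x (scal h v), plus y (scal h w)).
Proof. done. Qed.

(** [open_tube] turns the segment over [x] into a neighbourhood of [x] over which [f] is at least
    C^1, as differentiation under the integral sign requires. *)
Lemma is_derive_RInt_dirD {V : NormedModule R_AbsRing} n (W : V * R -> Prop) (f : V * R -> R) (v x : V) (a b : R) :
  a <= b -> open W -> Ck (S n) W f -> (forall y, a <= y <= b -> W (x, y)) ->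
  is_derive (fun h : R => RInt (fun y => f (plus x (scal h v), y)) a b) 0
    (RInt (fun y => dirD ((v, 0) : prod_NormedModule R_AbsRing V R_NormedModule) f (x, y)) a b).
Proof.
  move=> ab oW Hf Wx.
  pose v' := ((v, 0) : prod_NormedModule R_AbsRing V R_NormedModule).
  have line y h : @plus (prod_NormedModule R_AbsRing V R_NormedModule) (x, y) (scal h v') = (plus x (scal h v), y).
    rewrite prod_line. congr pair. rewrite /plus /scal /= /mult /=. ring.
  have oT := open_tube W a b oW.
  have locx := locally_line _ x v 0 oT.
  rewrite line_0 in locx. have {}locx := locx Wx.
  have isd h y : W (plus x (scal h v), y) -> is_derive (fun h : R => f (plus x (scal h v), y)) h (dirD v' f (plus x (scal h v), y)).
    move=> Wh. have := Ck_is_derive n W f (x, y) v' h Hf. rewrite line => /(_ Wh).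
    apply: is_derive_ext => k. by rewrite line.
  rewrite (RInt_ext _ (fun y => Derive (fun h : R => f (plus x (scal h v), y)) 0)); last first.
    move=> y Hy. rewrite Rmin_left // Rmax_right // in Hy. symmetry. apply: is_derive_unique.
    have := isd 0 y. rewrite line_0. apply. apply: Wx. lra.
  apply: is_derive_RInt_param.
  - apply: filter_imp locx => h Hh y Hy. rewrite Rmin_left // Rmax_right // in Hy.
    eexists. apply: isd. exact: Hh.
  - move=> y Hy. rewrite Rmin_left // Rmax_right // in Hy.
    have c : continuous (fun z : R * R => (plus x (scal (fst z) v), snd z)) (0, y).
      apply: (continuous_comp_2 (fun z : R * R => plus x (scal (fst z) v)) snd (fun a b => (a, b))).
      + apply: (continuous_comp fst (fun h : R => plus x (scal h v))); [exact: continuous_fst | exact: continuous_line].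
      + exact: continuous_snd.
      + apply: (continuous_ext (fun z => z)); [by case | exact: continuous_id].
    apply: (continuity_2d_pt_ext_loc (fun h y => dirD v' f (plus x (scal h v), y))).
    + apply/locally_2d_locally.
      have : locally (0, y) (fun z : R * R => W (plus x (scal (fst z) v), snd z)).
        apply: c => /=. rewrite line_0. apply: oW. exact: Wx.
      apply: filter_imp => -[h y'] /= Wh. symmetry. apply: is_derive_unique. exact: isd.
    + apply/continuity_2d_pt_filterlim.
      have c2 : continuous (fun z : R * R => dirD v' f (plus x (scal (fst z) v), snd z)) (0, y).
        apply: (continuous_comp (fun z : R * R => (plus x (scal (fst z) v), snd z)) (dirD v' f)) => //=.
        rewrite line_0. case: Hf => _ /(_ v') [_ D]. apply: (Ck_cont n W) => //. exact: Wx.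
      exact: c2.
  - apply: filter_imp locx => h Hh. apply: ex_RInt_slice => // y Hy. apply: (Ck_cont (S n) W) => //. exact: Hh.
Qed.

(** The derivative of the integral along [v] is the integral of the derivative along [(v, 0)], which
    has the same form, so the induction closes. *)
Lemma Ck_RInt {V : NormedModule R_AbsRing} n (W : V * R -> Prop) (f : V * R -> R) (a b : R) :
  a <= b -> open W -> @Ck (prod_NormedModule R_AbsRing V R_NormedModule) n W f ->
  Ck n (fun v => forall y, a <= y <= b -> W (v, y)) (fun v => RInt (fun y => f (v, y)) a b).
Proof.
  move=> ab oW. have oT := open_tube W a b oW.
  elim: n f => [|n IH] f Hf; split.
  1,3: move=> x Wx; apply: continuous_RInt_param => //;
       apply: filter_imp (oT x Wx) => v Wv y Hy; apply: (Ck_cont _ W f (v, y) Hf); exact: Wv.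
  - done.
  - move=> v. split.
    + move=> x Wx. eexists. exact: (is_derive_RInt_dirD n W).
    + case: (Hf) => _ /(_ (v, 0)) [_ Df].
      apply: Ck_ext (IH _ Df) => // x Wx. symmetry. apply: is_derive_unique. exact: (is_derive_RInt_dirD n W).
Qed.

Lemma smooth_RInt {V : NormedModule R_AbsRing} (W : V * R -> Prop) (f : V * R -> R) (a b : R) :
  a <= b -> open W -> @smooth_on (prod_NormedModule R_AbsRing V R_NormedModule) W f ->
  smooth_on (fun v => forall y, a <= y <= b -> W (v, y)) (fun v => RInt (fun y => f (v, y)) a b).
Proof. move=> ab oW Hf n. exact: (Ck_RInt n W). Qed.

Lemma dirD_RInt {V : NormedModule R_AbsRing} (W : V * R -> Prop) (f : V * R -> R) (v x : V) (a b : R) :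
  a <= b -> open W -> @smooth_on (prod_NormedModule R_AbsRing V R_NormedModule) W f -> (forall y, a <= y <= b -> W (x, y)) ->
  dirD v (fun v => RInt (fun y => f (v, y)) a b) x =
  RInt (fun y => dirD ((v, 0) : prod_NormedModule R_AbsRing V R_NormedModule) f (x, y)) a b.
Proof. move=> ab oW Hf Wx. apply: is_derive_unique. exact: (is_derive_RInt_dirD 0 W _ _ _ _ _ ab oW (Hf 1%nat)). Qed.

(** * Integration over the torus *)

Local Notation ptN := (prod_NormedModule R_AbsRing R_NormedModule R_NormedModule).
Local Notation unit_x := ((1, 0) : ptN).
Local Notation unit_y := ((0, 1) : ptN).

Lemma d_x_dirD (f : pt -> R) : d_x f = dirD unit_x f.
Proof.
  apply functional_extensionality => -[x y]. rewrite /d_x Derive_shift. apply Derive_ext => h.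
  congr f. rewrite /plus /scal /= /prod_plus /prod_scal /plus /scal /= /mult /=. congr pair; ring.
Qed.

Lemma d_y_dirD (f : pt -> R) : d_y f = dirD unit_y f.
Proof.
  apply functional_extensionality => -[x y]. rewrite /d_y Derive_shift. apply Derive_ext => h.
  congr f. rewrite /plus /scal /= /prod_plus /prod_scal /plus /scal /= /mult /=. congr pair; ring.
Qed.

Definition contin (f : pt -> R) : Prop := forall p, continuous f p.

Lemma contin_inner (f : pt -> R) x : contin f -> ex_RInt (fun y => f (x, y)) 0 1.
Proof. move=> cf. apply: ex_RInt_slice; first lra. move=> y _. exact: cf. Qed.

Lemma contin_outer (f : pt -> R) x : contin f -> continuous (fun x => RInt (fun y => f (x, y)) 0 1) x.
Proof.
  move=> cf. apply: continuous_RInt_param; first lra. apply: filter_forall => v y _. exact: cf.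
Qed.

Lemma ex_RInt_contin (f : R -> R) a b : (forall x, continuous f x) -> ex_RInt f a b.
Proof. move=> cf. apply: (@ex_RInt_continuous R_CompleteNormedModule) => z _. exact: cf. Qed.

Lemma contin_outer_ex (f : pt -> R) : contin f -> ex_RInt (fun x => RInt (fun y => f (x, y)) 0 1) 0 1.
Proof. move=> cf. apply: ex_RInt_contin => x. exact: contin_outer. Qed.

Lemma torus_integral_ext (f g : pt -> R) : (forall p, f p = g p) -> torus_integral f = torus_integral g.
Proof. move=> fg. rewrite /torus_integral. apply: RInt_ext => x _. apply: RInt_ext => y _. exact: fg. Qed.

Lemma RInt_Rplus (f g : R -> R) a b : ex_RInt f a b -> ex_RInt g a b ->
  RInt (fun x => f x + g x) a b = RInt f a b + RInt g a b.
Proof. exact: (RInt_plus (V:=R_CompleteNormedModule)). Qed.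

Lemma RInt_Rmult (k : R) (f : R -> R) a b : ex_RInt f a b ->
  RInt (fun x => k * f x) a b = k * RInt f a b.
Proof. exact: (RInt_scal (V:=R_CompleteNormedModule)). Qed.

Lemma torus_integral_plus (f g : pt -> R) : contin f -> contin g ->
  torus_integral (fun p => f p + g p) = torus_integral f + torus_integral g.
Proof.
  move=> cf cg. rewrite /torus_integral -RInt_Rplus; try exact: contin_outer_ex.
  apply: RInt_ext => x _. rewrite RInt_Rplus //; exact: contin_inner.
Qed.

Lemma torus_integral_scal (k : R) (f : pt -> R) : contin f ->
  torus_integral (fun p => k * f p) = k * torus_integral f.
Proof.
  move=> cf. rewrite /torus_integral -RInt_Rmult; last exact: contin_outer_ex.
  apply: RInt_ext => x _. rewrite RInt_Rmult //. exact: contin_inner.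
Qed.

Lemma contin_const k : contin (fun _ => k).
Proof. move=> p. exact: continuous_const. Qed.
Lemma contin_plus f g : contin f -> contin g -> contin (fun p => f p + g p).
Proof. move=> cf cg p. exact: (continuous_plus f g). Qed.
Lemma contin_mult f g : contin f -> contin g -> contin (fun p => f p * g p).
Proof. move=> cf cg p. exact: (continuous_mult f g). Qed.
Lemma contin_minus f g : contin f -> contin g -> contin (fun p => f p - g p).
Proof. move=> cf cg p. exact: (continuous_minus f g). Qed.
Lemma contin_scal k f : contin f -> contin (fun p => k * f p).
Proof. move=> cf. apply: contin_mult => //. exact: contin_const. Qed.

Lemma torus_integral_minus (f g : pt -> R) : contin f -> contin g ->
  torus_integral (fun p => f p - g p) = torus_integral f - torus_integral g.
Proof.
  move=> cf cg. rewrite (torus_integral_ext _ (fun p => f p + (-1) * g p)); last by move=> p; ring.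
  rewrite torus_integral_plus //; last exact: contin_scal. rewrite torus_integral_scal //. ring.
Qed.

Lemma torus_integral_const k : torus_integral (fun _ => k) = k.
Proof.
  have c1 (c : R) : RInt (fun _ : R => c) 0 1 = c.
    rewrite RInt_const /scal /= /mult /=. ring.
  by rewrite /torus_integral !c1.
Qed.

Lemma torus_integral_le (f g : pt -> R) : contin f -> contin g -> (forall p, f p <= g p) ->
  torus_integral f <= torus_integral g.
Proof.
  move=> cf cg fg. rewrite /torus_integral. apply: RInt_le; try lra; try exact: contin_outer_ex.
  move=> x _. apply: RInt_le => //; try lra; exact: contin_inner.
Qed.

Lemma RInt_pos_zero (g : R -> R) (x0 : R) : (forall x, continuous g x) -> (forall x, 0 <= g x) ->
  RInt g 0 1 = 0 -> 0 <= x0 <= 1 -> g x0 = 0.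
Proof.
  move=> cg g0 I Hx. case: (Req_dec (g x0) 0) => // gn. exfalso.
  have gp : 0 < g x0 by have := g0 x0; lra.
  have /filterlim_locally /(_ (mkposreal _ gp)) [d Hd] := cg x0.
  have Hd' x : Rabs (x - x0) < d -> 0 < g x.
    move=> Hx'. have := Hd x Hx'. rewrite /ball /= /AbsRing_ball /= /abs /minus /plus /opp /=.
    move=> /Rabs_def2. lra.
  have dp := cond_pos d.
  (* Clipping to [[0, 1]] still leaves an interval of positive length when [x0] is an end point. *)
  set c := Rmax 0 (x0 - d / 2). set e := Rmin 1 (x0 + d / 2).
  have [c0 cx] : 0 <= c /\ x0 - d / 2 <= c by split; [exact: Rmax_l | exact: Rmax_r].
  have [e0 el] : e <= 1 /\ e <= x0 + d / 2 by split; [exact: Rmin_l | exact: Rmin_r].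
  have ce : c < e by rewrite /c /e /Rmax /Rmin; case: Rle_dec; case: Rle_dec; lra.
  have P : 0 < RInt g c e.
    apply: RInt_gt_0 => // x Hx'. apply: Hd'. apply: Rabs_def1; lra.
  have ei a b : ex_RInt g a b by exact: ex_RInt_contin.
  have Q a b : a <= b -> 0 <= RInt g a b.
    move=> ab. apply: RInt_ge_0 => //.
  have := RInt_Chasles g 0 c 1 (ei _ _) (ei _ _).
  have := RInt_Chasles g c e 1 (ei _ _) (ei _ _).
  rewrite /plus /= I. have := Q 0 c. have := Q e 1. lra.
Qed.

Lemma exists_unit_translate (x : R) : exists n : Z, 0 <= x + IZR n <= 1.
Proof. exists (1 - up x)%Z. rewrite minus_IZR. have := archimed x. lra. Qed.

Lemma periodic_unit {A : Type} (f : pt -> A) (P : A -> Prop) : periodic f ->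
  (forall x y, 0 <= x <= 1 -> 0 <= y <= 1 -> P (f (x, y))) -> forall p, P (f p).
Proof.
  move=> pf H [x y]. case: (exists_unit_translate x) => m Hm. case: (exists_unit_translate y) => n Hn.
  rewrite -(pf m n (x, y)). exact: H.
Qed.

(** Applied to the outer integral and then to the inner one, [RInt_pos_zero] gives vanishing on the
    closed unit square; periodicity does the rest. *)
Lemma torus_integral_square_eq0 (f : pt -> R) : contin f -> periodic f ->
  torus_integral (fun p => f p * f p) = 0 -> forall p, f p = 0.
Proof.
  move=> cf pf I. apply: (periodic_unit f (fun z => z = 0)) => // x y Hx Hy.
  have cff := contin_mult f f cf cf.
  have ge0 x' : 0 <= RInt (fun y => f (x', y) * f (x', y)) 0 1.
    apply: RInt_ge_0; [lra | exact: (contin_inner (fun p => f p * f p)) | move=> *; nra].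
  have X0 := RInt_pos_zero _ x (fun x => contin_outer _ x cff) ge0 I Hx.
  have := RInt_pos_zero (fun y => f (x, y) * f (x, y)) y _ _ X0 Hy.
  move=> Z. suff : f (x, y) * f (x, y) = 0 by nra.
  apply: Z => y'; last nra.
  apply: (continuous_comp (fun y => (x, y)) (fun p => f p * f p)); [exact: continuous_pair_r | exact: cff].
Qed.

Lemma open_whole {V : UniformSpace} : open (@whole V).
Proof. exact: open_true. Qed.

Lemma torus_function_contin f : torus_function f -> contin f.
Proof. move=> [sf _] p. exact: (smooth_cont whole). Qed.
Lemma torus_function_const k : torus_function (fun _ => k).
Proof. split; last by []. apply: smooth_const. exact: open_whole. Qed.
Lemma torus_function_plus f g : torus_function f -> torus_function g -> torus_function (fun p => f p + g p).
Proof. move=> [sf pf] [sg pg]. split; first (apply: smooth_plus => //; exact: open_whole). move=> m n p. by rewrite pf pg. Qed.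
Lemma torus_function_mult f g : torus_function f -> torus_function g -> torus_function (fun p => f p * g p).
Proof. move=> [sf pf] [sg pg]. split; first (apply: smooth_mult => //; exact: open_whole). move=> m n p. by rewrite pf pg. Qed.
Lemma torus_function_minus f g : torus_function f -> torus_function g -> torus_function (fun p => f p - g p).
Proof. move=> [sf pf] [sg pg]. split; first (apply: smooth_minus => //; exact: open_whole). move=> m n p. by rewrite pf pg. Qed.
Lemma torus_function_scal k f : torus_function f -> torus_function (fun p => k * f p).
Proof. move=> tf. apply: torus_function_mult => //. exact: torus_function_const. Qed.

Lemma translate_line m n (p v : ptN) (h : R) : translate m n (plus p (scal h v)) = plus (translate m n p : ptN) (scal h v).
Proof.
  case: p => a b. case: v => c d. rewrite /translate /plus /scal /= /prod_plus /prod_scal /plus /scal /= /mult /=.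
  congr pair; ring.
Qed.

Lemma torus_function_dirD (v : ptN) f : torus_function f -> torus_function (dirD v f).
Proof.
  move=> [sf pf]. split; first exact: smooth_dirD.
  move=> m n p. apply: Derive_ext => h. by rewrite -translate_line pf.
Qed.

(** * Torus integrals depending on parameters *)

Section TorusParam.
Context {V : NormedModule R_AbsRing}.
Local Notation VR := (prod_NormedModule R_AbsRing V R_NormedModule).
Local Notation VRR := (prod_NormedModule R_AbsRing VR R_NormedModule).
Local Notation VP := (prod_NormedModule R_AbsRing V ptN).

(** The torus integral is iterated, so the parameter of its inner integral is a pair [(v, x)]. This
    map re-brackets the product so that [smooth_RInt] can be applied twice. *)
Let assoc (z : VRR) : VP := (fst (fst z), (snd (fst z), snd z)).

Lemma assoc_continuous z : continuous assoc z.
Proof.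
  case: z => -[v x] y P [d Hd]. exists d => -[[v' x'] y'] [[/= Hv Hx] Hy]. by apply: Hd.
Qed.

Lemma assoc_smooth (W : VP -> Prop) (f : VP -> R) : open W -> smooth_on W f ->
  open (fun z => W (assoc z)) /\ smooth_on (fun z => W (assoc z)) (fun z => f (assoc z)).
Proof.
  move=> oW sf. have o : open (fun z => W (assoc z)) by exact: (open_pre assoc W assoc_continuous).
  split=> //. apply: (smooth_affine W _ assoc assoc) => //. exact: assoc_continuous.
Qed.

Lemma smooth_torus_integral (W : VP -> Prop) (f : VP -> R) : open W -> smooth_on W f ->
  smooth_on (fun v : V => forall x, 0 <= x <= 1 -> forall y, 0 <= y <= 1 -> W (v, (x, y)))
    (fun v => torus_integral (fun p => f (v, p))).
Proof.
  move=> oW sf. case: (assoc_smooth W f oW sf) => o s.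
  have H01 : 0 <= 1 by lra.
  have o1 := open_tube _ 0 1 o.
  have s1 := smooth_RInt (V:=VR) _ _ 0 1 H01 o s.
  exact: (smooth_RInt (V:=V) _ _ 0 1 H01 o1 s1).
Qed.

Lemma open_torus_box (W : VP -> Prop) : open W ->
  open (fun v : V => forall x, 0 <= x <= 1 -> forall y, 0 <= y <= 1 -> W (v, (x, y))).
Proof.
  move=> oW.
  have o : open (fun z => W (assoc z)) by exact: (open_pre assoc W assoc_continuous).
  exact: (open_tube _ 0 1 (open_tube _ 0 1 o)).
Qed.

Lemma dirD_torus_integral (W : VP -> Prop) (f : VP -> R) (v x : V) : open W -> smooth_on W f ->
  (forall a, 0 <= a <= 1 -> forall b, 0 <= b <= 1 -> W (x, (a, b))) ->
  dirD v (fun v => torus_integral (fun p => f (v, p))) x =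
  torus_integral (fun p => dirD ((v, zero) : VP) f (x, p)).
Proof.
  move=> oW sf Wx. case: (assoc_smooth W f oW sf) => o s.
  have H01 : 0 <= 1 by lra.
  have o1 := open_tube _ 0 1 o.
  have s1 := smooth_RInt (V:=VR) _ _ 0 1 H01 o s.
  rewrite /torus_integral.
  rewrite (dirD_RInt (V:=V) _ (fun z : VR => RInt (fun y => f (assoc (z, y))) 0 1) v x 0 1 H01 o1 s1 Wx).
  apply: RInt_ext => a Ha. rewrite Rmin_left // Rmax_right // in Ha.
  have Ha' : 0 <= a <= 1 by lra.
  rewrite (dirD_RInt (V:=VR) _ (fun z : VRR => f (assoc z)) (v, 0) (x, a) 0 1 H01 o s (Wx a Ha')).
  apply: RInt_ext => b Hb. exact: (dirD_affine assoc assoc f).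
Qed.

End TorusParam.

Lemma smooth1_is_derive (U : R -> Prop) (f : R -> R) t :
  @smooth_on R_NormedModule U f -> U t -> is_derive f t (@dirD R_NormedModule 1 f t).
Proof.
  move=> sf Ut. have := smooth_is_derive U f 0 (1 : R_NormedModule) t sf.
  rewrite (_ : plus 0 (scal t 1) = t); last by rewrite /plus /scal /= /mult /=; ring.
  move=> /(_ Ut). apply: is_derive_ext => k. rewrite /plus /scal /= /mult /=. congr f. ring.
Qed.

Lemma dirD_plus {V : NormedModule R_AbsRing} (U : V -> Prop) (v : V) f g x :
  smooth_on U f -> smooth_on U g -> U x ->
  dirD v (fun y => f y + g y) x = dirD v f x + dirD v g x.
Proof.
  move=> sf sg Ux. apply: Derive_plus; eexists; exact: (smooth_is_derive0 U).
Qed.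

Lemma dirD_mult {V : NormedModule R_AbsRing} (U : V -> Prop) (v : V) f g x :
  smooth_on U f -> smooth_on U g -> U x ->
  dirD v (fun y => f y * g y) x = dirD v f x * g x + f x * dirD v g x.
Proof.
  move=> sf sg Ux. rewrite /dirD Derive_mult; try (eexists; exact: (smooth_is_derive0 U)).
  by rewrite !line_0.
Qed.

Lemma dirD_const {V : NormedModule R_AbsRing} (v : V) (k : R) x : dirD v (fun _ => k) x = 0.
Proof. exact: Derive_const. Qed.

Lemma dirD_scal {V : NormedModule R_AbsRing} (v : V) k f x :
  dirD v (fun y => k * f y) x = k * dirD v f x.
Proof. exact: Derive_scal. Qed.

Lemma dirD_minus {V : NormedModule R_AbsRing} (U : V -> Prop) (v : V) f g x :
  smooth_on U f -> smooth_on U g -> U x ->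
  dirD v (fun y => f y - g y) x = dirD v f x - dirD v g x.
Proof.
  move=> sf sg Ux. apply: Derive_minus; eexists; exact: (smooth_is_derive0 U).
Qed.

Lemma dirD_pt (v : R * R) (f : pt -> R) (p : pt) : smooth_on whole f ->
  dirD (v : ptN) f p = fst v * dirD unit_x f p + snd v * dirD unit_y f p.
Proof.
  move=> sf. rewrite -(dirD_linear whole unit_x unit_y _ _ f p open_whole sf) //. congr (dirD _ f p).
  case: v => a b. rewrite /plus /scal /= /prod_plus /prod_scal /plus /scal /= /mult /=. congr pair; ring.
Qed.

Lemma deriv_y (f : pt -> R) x y : smooth_on whole f ->
  is_derive (fun y => f (x, y)) y (dirD unit_y f (x, y)).
Proof.
  move=> sf. have := smooth_is_derive whole f (x, 0) unit_y y sf I.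
  rewrite prod_line. rewrite (_ : (plus x (scal y 0), plus 0 (scal y 1)) = (x, y)).
    apply: is_derive_ext => k. rewrite prod_line.
    rewrite (_ : (plus x (scal k 0), plus 0 (scal k 1)) = (x, k)) //.
  all: rewrite /plus /scal /= /mult /=; congr pair; ring.
Qed.

Lemma deriv_x (f : pt -> R) x y : smooth_on whole f ->
  is_derive (fun x => f (x, y)) x (dirD unit_x f (x, y)).
Proof.
  move=> sf. have := smooth_is_derive whole f (0, y) unit_x x sf I.
  rewrite prod_line. rewrite (_ : (plus 0 (scal x 1), plus y (scal x 0)) = (x, y)).
    apply: is_derive_ext => k. rewrite prod_line.
    rewrite (_ : (plus 0 (scal k 1), plus y (scal k 0)) = (k, y)) //.
  all: rewrite /plus /scal /= /mult /=; congr pair; ring.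
Qed.

Lemma slice_y_continuous (f : pt -> R) x y : contin f -> continuous (fun y => f (x, y)) y.
Proof. move=> cf. apply: (continuous_comp (fun y => (x, y)) f); [exact: continuous_pair_r | exact: cf]. Qed.

Lemma deriv_inner (f : pt -> R) x : smooth_on whole f ->
  is_derive (fun x => RInt (fun y => f (x, y)) 0 1) x (RInt (fun y => dirD unit_x f (x, y)) 0 1).
Proof.
  move=> sf.
  have H01 : 0 <= 1 by lra.
  have s := smooth_RInt (V:=R_NormedModule) whole f 0 1 H01 open_whole sf.
  have := smooth1_is_derive _ _ x s (fun _ _ => I).
  by rewrite (dirD_RInt (V:=R_NormedModule) whole f 1 x 0 1 H01 open_whole sf (fun _ _ => I)).
Qed.

Lemma smooth_contin (f : pt -> R) : smooth_on whole f -> contin f.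
Proof. move=> sf p. exact: (smooth_cont whole). Qed.

Lemma RInt_FTC (f df : R -> R) a b : (forall x, is_derive f x (df x)) -> (forall x, continuous df x) ->
  RInt df a b = f b - f a.
Proof.
  move=> d c. apply: is_RInt_unique. exact: (is_RInt_derive (V:=R_CompleteNormedModule) f df a b).
Qed.

(** * Integration by parts on the torus *)

Lemma torus_integral_dy0 f : torus_function f -> torus_integral (dirD unit_y f) = 0.
Proof.
  move=> [sf pf]. transitivity (torus_integral (fun _ => 0)); last exact: torus_integral_const. rewrite /torus_integral. apply: RInt_ext => x _.
  rewrite (RInt_FTC (fun y => f (x, y))).
  - have := pf 0%Z 1%Z (x, 0). rewrite /translate /= Rplus_0_r Rplus_0_l => ->.
    rewrite RInt_const /scal /= /mult /=. ring.
  - move=> y. exact: deriv_y.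
  - move=> y. apply: slice_y_continuous. apply: smooth_contin. exact: smooth_dirD.
Qed.

Lemma torus_integral_dx0 f : torus_function f -> torus_integral (dirD unit_x f) = 0.
Proof.
  move=> [sf pf]. rewrite /torus_integral.
  rewrite (RInt_FTC (fun x => RInt (fun y => f (x, y)) 0 1)).
  - rewrite (RInt_ext (fun y => f (1, y)) (fun y => f (0, y))); first ring.
    move=> y _. have := pf 1%Z 0%Z (0, y). by rewrite /translate /= Rplus_0_r Rplus_0_l => ->.
  - move=> x. exact: deriv_inner.
  - move=> x. apply: contin_outer. apply: smooth_contin. exact: smooth_dirD.
Qed.

Lemma torus_integral_dirD0 v f : torus_function f -> torus_integral (dirD v f) = 0.
Proof.
  move=> tf. have [sf _] := tf.
  rewrite (torus_integral_ext _ (fun p => fst v * dirD unit_x f p + snd v * dirD unit_y f p)); last by move=> p; exact: dirD_pt.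
  have cx := torus_function_contin _ (torus_function_dirD unit_x _ tf). have cy := torus_function_contin _ (torus_function_dirD unit_y _ tf).
  rewrite torus_integral_plus; try exact: contin_scal.
  rewrite !torus_integral_scal // torus_integral_dx0 // torus_integral_dy0 //. ring.
Qed.

Lemma torus_integral_parts v f g : torus_function f -> torus_function g ->
  torus_integral (fun p => dirD v f p * g p) = - torus_integral (fun p => f p * dirD v g p).
Proof.
  move=> tf tg.
  have := torus_integral_dirD0 v _ (torus_function_mult _ _ tf tg).
  rewrite (torus_integral_ext _ (fun p => dirD v f p * g p + f p * dirD v g p)); last first.
    move=> p. apply: (dirD_mult whole) => //; by [case: tf | case: tg].
  rewrite torus_integral_plus; first lra.
  all: apply: torus_function_contin; apply: torus_function_mult => //; exact: torus_function_dirD.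
Qed.

(** * A Sobolev inequality *)

Lemma RInt_abs_le (f g : R -> R) a b : a <= b -> (forall x, continuous f x) -> (forall x, continuous g x) ->
  (forall x, Rabs (f x) <= g x) -> Rabs (RInt f a b) <= RInt g a b.
Proof.
  move=> ab cf cg fg.
  have ef := ex_RInt_contin f a b cf. have eg := ex_RInt_contin g a b cg.
  have fg' x := proj1 (Rabs_le_between _ _) (fg x).
  apply/Rabs_le_between. split.
  - have e' : ex_RInt (fun x => (-1) * g x) a b.
      apply: ex_RInt_contin => x. apply: (continuous_mult (fun _ => -1) g); [exact: continuous_const | exact: cg].
    have <- : RInt (fun x => (-1) * g x) a b = - RInt g a b by rewrite (RInt_Rmult (-1) g a b eg) -Ropp_mult_distr_l Rmult_1_l.
    apply: RInt_le => // x _. have := fg' x. lra.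
  - apply: RInt_le => // x _. have := fg' x. lra.
Qed.

(** Any two values of [f] on [[0, 1]] differ by at most the integral of [M]; averaging over one of
    the two points compares [f x] with the mean of [f]. *)
Lemma mean_osc (f df M : R -> R) x : (forall x, is_derive f x (df x)) -> (forall x, continuous df x) ->
  (forall x, continuous M x) -> (forall x, Rabs (df x) <= M x) -> 0 <= x <= 1 ->
  Rabs (f x - RInt f 0 1) <= RInt M 0 1.
Proof.
  move=> d cdf cM dM Hx.
  have cf y : continuous f y by apply: ex_derive_continuous; eexists; exact: d.
  have M0 y : 0 <= M y by have := dM y; have := Rabs_pos (df y); lra.
  have ei a b : ex_RInt M a b by exact: ex_RInt_contin.
  have sub a b : 0 <= a -> a <= b -> b <= 1 -> RInt M a b <= RInt M 0 1.
    move=> a0 ab b1.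
    have := RInt_Chasles M 0 a 1 (ei _ _) (ei _ _).
    have := RInt_Chasles M a b 1 (ei _ _) (ei _ _).
    have P c e : c <= e -> 0 <= RInt M c e by move=> ce; apply: RInt_ge_0.
    have := P 0 a a0. have := P b 1 b1. rewrite /plus /=. lra.
  have inc a b : 0 <= a -> a <= b -> b <= 1 -> Rabs (f b - f a) <= RInt M 0 1.
    move=> a0 ab b1. rewrite -(RInt_FTC f df) //.
    apply: Rle_trans (sub a b a0 ab b1). exact: RInt_abs_le.
  have osc y : 0 <= y <= 1 -> Rabs (f x - f y) <= RInt M 0 1.
    move=> Hy. case: (Rle_dec x y) => xy; last by apply: inc; lra.
    rewrite Rabs_minus_sym. apply: inc; lra.
  set K := RInt M 0 1 in osc *.
  have c1 (c : R) : RInt (fun _ : R => c) 0 1 = c.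
    rewrite RInt_const /scal /= /mult /=. ring.
  have ec (c : R) : ex_RInt (fun _ : R => c) 0 1 by apply: ex_RInt_contin => z; exact: continuous_const.
  have ef := ex_RInt_contin f 0 1 cf.
  have L : RInt f 0 1 <= f x + K.
    rewrite -(c1 (f x + K)). apply: RInt_le => //; first lra.
    move=> y Hy. have := osc y. move=> /(_ _) /Rabs_le_between. lra.
  have G : f x - K <= RInt f 0 1.
    rewrite -(c1 (f x - K)). apply: RInt_le => //; first lra.
    move=> y Hy. have := osc y. move=> /(_ _) /Rabs_le_between. lra.
  apply/Rabs_le_between. lra.
Qed.

(** The mean value theorem is used in [y], then in [x]; replacing [Rabs u] by [(1 + u ^ 2) / 2]
    keeps the integrands differentiable, so that it can be applied once more to the bound. *)
Lemma torus_function_sobolev g : torus_function g -> forall p,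
  Rabs (g p - torus_integral g) <=
  1 + torus_integral (fun p => dirD unit_x g p * dirD unit_x g p + dirD unit_y g p * dirD unit_y g p
                          + dirD unit_x (dirD unit_y g) p * dirD unit_x (dirD unit_y g) p).
Proof.
  move=> tg. have [sg pg] := tg.
  set K := 1 + _. apply: (periodic_unit g (fun z => Rabs (z - torus_integral g) <= K)) => // x y Hx Hy.
  rewrite /K {K}.
  have tx := torus_function_dirD unit_x _ tg. have ty := torus_function_dirD unit_y _ tg. have txy := torus_function_dirD unit_x _ ty.
  set gx := dirD unit_x g in tx *. set gy := dirD unit_y g in ty txy *. set gxy := dirD unit_x gy in txy *.
  pose sq f : pt -> R := fun p => (/ 2) * (1 + f p * f p).
  have tsq f : torus_function f -> torus_function (sq f).
    move=> tf. apply: torus_function_scal. apply: torus_function_plus; [exact: torus_function_const | exact: torus_function_mult].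
  have abs_sq f p : Rabs (f p) <= sq f p.
    rewrite /sq. have := pow2_ge_0 (f p - 1). have := pow2_ge_0 (f p + 1). move=> H1 H2. apply/Rabs_le_between. split; lra.
  pose m := fun p => (/ 2) * (gy p * gy p + gxy p * gxy p).
  have tm : torus_function m.
    apply: torus_function_scal. apply: torus_function_plus; exact: torus_function_mult.
  have c f := torus_function_contin f.
  pose G x := RInt (fun y => g (x, y)) 0 1.
  pose N x := RInt (fun y => sq gy (x, y)) 0 1.
  have E1 : Rabs (g (x, y) - G x) <= N x.
    apply: (mean_osc (fun y => g (x, y)) (fun y => gy (x, y)) (fun y => sq gy (x, y))) => //.
    - move=> y'. exact: deriv_y.
    - move=> y'. apply: slice_y_continuous. exact: c.
    - move=> y'. apply: slice_y_continuous. apply: c. exact: tsq.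
  have E2 : Rabs (G x - torus_integral g) <= torus_integral (sq gx).
    apply: (mean_osc G (fun x => RInt (fun y => gx (x, y)) 0 1) (fun x => RInt (fun y => sq gx (x, y)) 0 1)) => //.
    - move=> x'. exact: deriv_inner.
    - move=> x'. apply: contin_outer. exact: c.
    - move=> x'. apply: contin_outer. apply: c. exact: tsq.
    - move=> x'. apply: RInt_abs_le => //; first lra.
      + move=> y'. apply: slice_y_continuous. exact: c.
      + move=> y'. apply: slice_y_continuous. apply: c. exact: tsq.
  have E3 : Rabs (N x - torus_integral (sq gy)) <= torus_integral m.
    have dsq p : dirD unit_x (sq gy) p = gy p * gxy p.
      have [sgy _] := ty.
      rewrite /sq dirD_scal (dirD_plus whole) // ?dirD_const ?(dirD_mult whole) // -/gxy.
      + field.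
      + exact: (smooth_const _ _ open_whole).
      + exact: (smooth_mult _ _ _ open_whole).
    have cgg : contin (fun p => gy p * gxy p) by apply: c; exact: torus_function_mult.
    apply: (mean_osc N (fun x => RInt (fun y => gy (x, y) * gxy (x, y)) 0 1) (fun x => RInt (fun y => m (x, y)) 0 1)) => //.
    - move=> x'.
      rewrite (RInt_ext _ (fun y => dirD unit_x (sq gy) (x', y))); last by move=> y' _; rewrite dsq.
      apply: deriv_inner. by case: (tsq _ ty).
    - move=> x'. exact: (contin_outer (fun p => gy p * gxy p)).
    - move=> x'. apply: contin_outer. exact: c.
    - move=> x'. apply: RInt_abs_le; first lra.
      + move=> y'. exact: (slice_y_continuous (fun p => gy p * gxy p)).
      + move=> y'. apply: slice_y_continuous. exact: c.
      + move=> y'. rewrite /m. have := pow2_ge_0 (gy (x', y') - gxy (x', y')). have := pow2_ge_0 (gy (x', y') + gxy (x', y')).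
        move=> H1 H2. apply/Rabs_le_between. split; lra.
  have S f : torus_function f -> torus_integral (sq f) = / 2 + / 2 * torus_integral (fun p => f p * f p).
    move=> tf. have cff : contin (fun p => f p * f p) by apply: c; exact: torus_function_mult.
    rewrite /sq torus_integral_scal ?torus_integral_plus ?torus_integral_const //; try (exact: contin_const); first ring.
    apply: contin_plus => //. exact: contin_const.
  have Q f : torus_function f -> 0 <= torus_integral (fun p => f p * f p).
    move=> tf. rewrite -(torus_integral_const 0). apply: torus_integral_le; [exact: contin_const | by apply: c; exact: torus_function_mult | move=> p; nra].
  have T : torus_integral m = / 2 * (torus_integral (fun p => gy p * gy p) + torus_integral (fun p => gxy p * gxy p)).
    have cy : contin (fun p => gy p * gy p) by apply: c; exact: torus_function_mult.
    have cxy : contin (fun p => gxy p * gxy p) by apply: c; exact: torus_function_mult.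
    by rewrite /m (torus_integral_scal _ _ (contin_plus _ _ cy cxy)) (torus_integral_plus _ _ cy cxy).
  have cx : contin (fun p => gx p * gx p) by apply: c; exact: torus_function_mult.
  have cy : contin (fun p => gy p * gy p) by apply: c; exact: torus_function_mult.
  have cxy : contin (fun p => gxy p * gxy p) by apply: c; exact: torus_function_mult.
  have cc := contin_plus _ _ cx cy.
  rewrite (torus_integral_plus _ _ cc cxy) (torus_integral_plus _ _ cx cy).
  have := S _ tx. have := S _ ty. have := Q _ tx. have := Q _ ty. have := Q _ txy.
  move: E1 E2 E3 => /Rabs_le_between E1 /Rabs_le_between E2 /Rabs_le_between E3.
  move=> Q1 Q2 Q3 S1 S2. apply/Rabs_le_between. lra.
Qed.

(** * The equation of sound *)

Local Notation TP := (prod_NormedModule R_AbsRing R_NormedModule ptN).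
Local Notation dir_t := ((1, (0, 0)) : TP).
Local Notation dir_x := ((0, (1, 0)) : TP).
Local Notation dir_y := ((0, (0, 1)) : TP).

Definition after (d : R) (z : TP) : Prop := - d < fst z.

Lemma open_after d : open (after d).
Proof.
  apply: (open_pre fst (fun t => - d < t)); last exact: open_gt.
  case=> t p. exact: continuous_fst.
Qed.

Lemma dirD_slice (f : TP -> R) (v : ptN) t p :
  dirD v (fun p => f (t, p)) p = dirD ((0, v) : TP) f (t, p).
Proof.
  apply Derive_ext => h. rewrite prod_line. congr f. congr pair.
  rewrite /plus /scal /= /mult /=. by rewrite Rmult_0_r Rplus_0_r.
Qed.

Definition time_periodic (d : R) (f : TP -> R) : Prop := forall t, - d < t -> periodic (fun p => f (t, p)).

Lemma time_periodic_dirD d v f : time_periodic d f -> time_periodic d (dirD v f).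
Proof.
  move=> pf t Ht m n p.
  transitivity (dirD v (fun z : TP => f (fst z, translate m n (snd z))) (t, p)).
  - apply: Derive_ext => h. case: v => a v. rewrite !prod_line. congr f. congr pair.
    symmetry. exact: translate_line.
  - apply: (dirD_ext_loc (after d)) => //; first exact: open_after.
    move=> [s q] Hs. exact: pf.
Qed.

Opaque dirD torus_integral.

Lemma continuous_pair_l {V W : UniformSpace} (x : V) (y : W) : continuous (fun y : W => (x, y)) y.
Proof.
  move=> P [d Hd]. exists d => z Hz. apply: Hd. split => //=. exact: ball_center.
Qed.

Lemma smooth_slice d (f : TP -> R) t : smooth_on (after d) f -> - d < t -> smooth_on whole (fun p : ptN => f (t, p)).
Proof.
  move=> sf Ht. apply: (smooth_affine (V:=TP) (W:=ptN) (after d) whole (fun p => (t, p)) (fun v => (0, v))) => //.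
  - exact: open_whole.
  - move=> x v h. rewrite prod_line. congr pair.
    rewrite /plus /scal /= /mult /=. by rewrite Rmult_0_r Rplus_0_r.
  - move=> x. exact: continuous_pair_l.
Qed.

Lemma torus_function_slice d (f : TP -> R) t : smooth_on (after d) f -> time_periodic d f -> - d < t ->
  torus_function (fun p => f (t, p)).
Proof. move=> sf pf Ht. split; [exact: (smooth_slice d) | exact: (pf t Ht)]. Qed.

Lemma time_line (t0 t : R) (p : ptN) : plus ((t0, p) : TP) (scal t dir_t) = (t0 + t, p).
Proof.
  rewrite prod_line. congr pair.
  - by rewrite /plus /scal /= /mult /= Rmult_1_r.
  - case: p => x y. rewrite /plus /scal /= /prod_plus /prod_scal /plus /scal /= /mult /=.
    by rewrite !Rmult_0_r !Rplus_0_r.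
Qed.

Lemma deriv_t d (f : TP -> R) t p : smooth_on (after d) f -> - d < t ->
  is_derive (fun t => f (t, p)) t (dirD dir_t f (t, p)).
Proof.
  move=> sf Ht. have := smooth_is_derive (after d) f (0, p) dir_t t sf.
  rewrite time_line Rplus_0_l => /(_ Ht). apply: is_derive_ext => k.
  by rewrite time_line Rplus_0_l.
Qed.

Lemma is_derive_torus_integral d (f : TP -> R) t : smooth_on (after d) f -> - d < t ->
  is_derive (fun t => torus_integral (fun p => f (t, p))) t
    (torus_integral (fun p => dirD dir_t f (t, p))).
Proof.
  move=> sf Ht.
  have H01 : 0 <= 0 <= 1 by lra.
  have s := smooth_torus_integral (V:=R_NormedModule) (after d) f (open_after d) sf.
  have := smooth1_is_derive _ _ t s (fun _ _ _ _ => Ht).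
  by rewrite (dirD_torus_integral (V:=R_NormedModule) (after d) f 1 t (open_after d) sf (fun _ _ _ _ => Ht)).
Qed.

Lemma const_of_derive (f : R -> R) d t : 0 < d -> 0 <= t -> (forall s, - d < s -> is_derive f s 0) -> f t = f 0.
Proof.
  move=> dp Ht H. case: (Req_dec t 0) => [-> //|tn].
  symmetry. apply: (eq_is_derive f); last lra. move=> s Hs. apply: H. lra.
Qed.

Lemma linear_of_derive (f f1 : R -> R) d t : 0 < d -> 0 <= t ->
  (forall s, - d < s -> is_derive f s (f1 s)) -> (forall s, - d < s -> is_derive f1 s 0) ->
  f t = f 0 + t * f1 0.
Proof.
  move=> dp Ht H H1.
  have C s : 0 <= s -> f1 s = f1 0 by move=> Hs; exact: (const_of_derive f1 d).
  case: (Req_dec t 0) => [->|tn]; first ring.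
  have E : (fun s => f s - s * f1 0) 0 = (fun s => f s - s * f1 0) t.
    apply: (eq_is_derive (fun s => f s - s * f1 0)); last lra.
    move=> s Hs. rewrite (_ : zero = f1 s - f1 0); last by rewrite C /zero /=; [ring | lra].
    apply: (is_derive_minus f (fun s => s * f1 0)); first by apply: H; lra.
    auto_derive => //. ring.
  move: E => /=. lra.
Qed.

(** * Curl-free fields are controlled by their divergence *)

(** Two integrations by parts turn the cross term of the squared divergence, the integral of
    [dx e1 * dy e2], into that of [dy e1 * dx e2], which is the square of [dy e1] for a curl-free
    field. *)
Lemma torus_function_curl_div e1 e2 : torus_function e1 -> torus_function e2 ->
  (forall p, dirD unit_y e1 p = dirD unit_x e2 p) ->
  torus_integral (fun p => dirD unit_x e1 p * dirD unit_x e1 p + dirD unit_y e2 p * dirD unit_y e2 p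
                      + 2 * (dirD unit_y e1 p * dirD unit_y e1 p)) =
  torus_integral (fun p => (dirD unit_x e1 p + dirD unit_y e2 p) * (dirD unit_x e1 p + dirD unit_y e2 p)).
Proof.
  move=> t1 t2 cf.
  have t1x := torus_function_dirD unit_x _ t1. have t1y := torus_function_dirD unit_y _ t1.
  have t2x := torus_function_dirD unit_x _ t2. have t2y := torus_function_dirD unit_y _ t2.
  have key : torus_integral (fun p => dirD unit_x e1 p * dirD unit_y e2 p) = torus_integral (fun p => dirD unit_y e1 p * dirD unit_y e1 p).
    rewrite torus_integral_parts // (torus_integral_ext (fun p => e1 p * _) (fun p => e1 p * dirD unit_y (dirD unit_x e2) p)); last first.
      move=> p. congr Rmult. apply: (dirD_comm whole) => //; [exact: open_whole | by case: t2].
    rewrite -torus_integral_parts //. apply: torus_integral_ext => p. by rewrite cf.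
  have c1 := torus_function_contin _ (torus_function_mult _ _ t1x t1x). have c2 := torus_function_contin _ (torus_function_mult _ _ t2y t2y).
  have c3 := torus_function_contin _ (torus_function_mult _ _ t1y t1y). have c4 := torus_function_contin _ (torus_function_mult _ _ t1x t2y).
  rewrite (torus_integral_plus _ _ (contin_plus _ _ c1 c2) (contin_scal 2 _ c3)) (torus_integral_scal _ _ c3) -key.
  rewrite -(torus_integral_scal _ _ c4) -(torus_integral_plus _ _ (contin_plus _ _ c1 c2) (contin_scal 2 _ c4)).
  apply: torus_integral_ext => p. ring.
Qed.

Lemma torus_integral_square_ge0 f : torus_function f -> 0 <= torus_integral (fun p => f p * f p).
Proof.
  move=> tf. rewrite -(torus_integral_const 0). apply: torus_integral_le; [exact: contin_const | | move=> p; nra].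
  apply: torus_function_contin. exact: torus_function_mult.
Qed.

Lemma torus_function_curlfree_grad_le e1 e2 : torus_function e1 -> torus_function e2 ->
  (forall p, dirD unit_y e1 p = dirD unit_x e2 p) ->
  let D := torus_integral (fun p => (dirD unit_x e1 p + dirD unit_y e2 p) * (dirD unit_x e1 p + dirD unit_y e2 p)) in
  torus_integral (fun p => dirD unit_x e1 p * dirD unit_x e1 p + dirD unit_y e1 p * dirD unit_y e1 p) <= D /\
  torus_integral (fun p => dirD unit_x e2 p * dirD unit_x e2 p + dirD unit_y e2 p * dirD unit_y e2 p) <= D.
Proof.
  move=> t1 t2 cf /=. rewrite -torus_function_curl_div //.
  have t1x := torus_function_dirD unit_x _ t1. have t1y := torus_function_dirD unit_y _ t1.
  have t2x := torus_function_dirD unit_x _ t2. have t2y := torus_function_dirD unit_y _ t2.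
  have c f (tf : torus_function f) := torus_function_contin _ (torus_function_mult _ _ tf tf).
  have cR := contin_plus _ _ (contin_plus _ _ (c _ t1x) (c _ t2y)) (contin_scal 2 _ (c _ t1y)).
  split; apply: torus_integral_le => //.
  - exact: (contin_plus _ _ (c _ t1x) (c _ t1y)).
  - move=> p. nra.
  - exact: (contin_plus _ _ (c _ t2x) (c _ t2y)).
  - move=> p. rewrite -cf. nra.
Qed.

(** The bound of [torus_function_sobolev] involves a mixed second derivative. The field
    [(dx e1, dx e2)] is again curl free, with divergence [dx dv], so the second integral in [B]
    controls its gradient, which contains the mixed derivatives of [e1] and [e2]. *)
Lemma torus_function_curlfree_sup e1 e2 : torus_function e1 -> torus_function e2 ->
  (forall p, dirD unit_y e1 p = dirD unit_x e2 p) ->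
  let dv := fun p => dirD unit_x e1 p + dirD unit_y e2 p in
  let B := 1 + torus_integral (fun p => dv p * dv p)
             + torus_integral (fun p => dirD unit_x dv p * dirD unit_x dv p) in
  forall p, Rabs (e1 p - torus_integral e1) <= B /\ Rabs (e2 p - torus_integral e2) <= B.
Proof.
  move=> t1 t2 cf dv B p.
  have t1x := torus_function_dirD unit_x _ t1. have t1y := torus_function_dirD unit_y _ t1.
  have t2x := torus_function_dirD unit_x _ t2. have t2y := torus_function_dirD unit_y _ t2.
  have comm f q : torus_function f -> dirD unit_x (dirD unit_y f) q = dirD unit_y (dirD unit_x f) q.
    move=> [sf _]. exact: (dirD_comm whole unit_x unit_y f q open_whole sf).
  have cfx q : dirD unit_y (dirD unit_x e1) q = dirD unit_x (dirD unit_x e2) q.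
    rewrite -comm //. by apply dirD_ext.
  have dvx q : dirD unit_x (dirD unit_x e1) q + dirD unit_y (dirD unit_x e2) q = dirD unit_x dv q.
    rewrite -(comm e2) // -(dirD_plus whole) //; [by case: t1x | by case: t2y].
  have [H1 H2] := torus_function_curlfree_grad_le _ _ t1 t2 cf.
  have [H3 H4] := torus_function_curlfree_grad_le _ _ t1x t2x cfx.
  have E : torus_integral (fun q => (dirD unit_x (dirD unit_x e1) q + dirD unit_y (dirD unit_x e2) q) * (dirD unit_x (dirD unit_x e1) q + dirD unit_y (dirD unit_x e2) q))
    = torus_integral (fun p => dirD unit_x dv p * dirD unit_x dv p).
    apply: torus_integral_ext => q. by rewrite dvx.
  rewrite E in H3 H4.
  have c f (tf : torus_function f) := torus_function_contin _ (torus_function_mult _ _ tf tf).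
  have fin e K : torus_function e ->
     torus_integral (fun p => dirD unit_x e p * dirD unit_x e p + dirD unit_y e p * dirD unit_y e p) <= torus_integral (fun p => dv p * dv p) ->
     torus_integral (fun p => dirD unit_x (dirD unit_x e) p * dirD unit_x (dirD unit_x e) p + dirD unit_y (dirD unit_x e) p * dirD unit_y (dirD unit_x e) p) <= K ->
     Rabs (e p - torus_integral e) <= 1 + torus_integral (fun p => dv p * dv p) + K.
    move=> te L1 L2. apply: Rle_trans (torus_function_sobolev e te p) _.
    have tx := torus_function_dirD unit_x _ te. have ty := torus_function_dirD unit_y _ te.
    have txx := torus_function_dirD unit_x _ tx. have txy := torus_function_dirD unit_y _ tx. have tyx := torus_function_dirD unit_x _ ty.
    rewrite (torus_integral_plus _ _ (contin_plus _ _ (c _ tx) (c _ ty)) (c _ tyx)).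
    have : torus_integral (fun p => dirD unit_x (dirD unit_y e) p * dirD unit_x (dirD unit_y e) p) <= K.
      apply: Rle_trans L2. apply: torus_integral_le.
      - exact: c.
      - exact: (contin_plus _ _ (c _ txx) (c _ txy)).
      - move=> q. rewrite comm //. nra.
    lra.
  split; exact: fin.
Qed.

(** [Y_tt = c^2 grad div Y] and [Y = 0] at [t = 0], for the displacement [Y = (Y1, Y2)] in the
    coordinates moving with the base flow.  The time interval [(- d, oo)] contains [0] in its
    interior. *)
Record Acoustic (d c : R) (Y1 Y2 : TP -> R) : Prop := {
  acoustic_smooth1 : smooth_on (after d) Y1;
  acoustic_smooth2 : smooth_on (after d) Y2;
  acoustic_periodic1 : time_periodic d Y1;
  acoustic_periodic2 : time_periodic d Y2;
  acoustic_init1 : forall p, Y1 (0, p) = 0;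
  acoustic_init2 : forall p, Y2 (0, p) = 0;
  acoustic_eq1 : forall t p, - d < t -> dirD dir_t (dirD dir_t Y1) (t, p) =
     c ^ 2 * dirD dir_x (fun z => dirD dir_x Y1 z + dirD dir_y Y2 z) (t, p);
  acoustic_eq2 : forall t p, - d < t -> dirD dir_t (dirD dir_t Y2) (t, p) =
     c ^ 2 * dirD dir_y (fun z => dirD dir_x Y1 z + dirD dir_y Y2 z) (t, p) }.

(** * Estimates for solutions of the acoustic equation *)

Section Solutions.
Context (d c : R) (dp : 0 < d) (cp : 0 < c).
Local Notation U := (after d).
Let oU : open U := open_after d.

Lemma dirD_comm_U v w f z : smooth_on U f -> U z -> dirD v (dirD w f) z = dirD w (dirD v f) z.
Proof. move=> sf Uz. exact: (dirD_comm U). Qed.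

(** The equation has constant coefficients, so it commutes with space derivatives, which also
    preserve the zero initial value. This is what upgrades [L^2] bounds to uniform ones. *)
Lemma acoustic_dirD (v : ptN) Y1 Y2 : Acoustic d c Y1 Y2 -> Acoustic d c (dirD ((0, v) : TP) Y1) (dirD ((0, v) : TP) Y2).
Proof.
  move=> [s1 s2 p1 p2 z1 z2 e1 e2].
  set v' := ((0, v) : TP).
  have sd f w : smooth_on U f -> smooth_on U (dirD w f) by exact: smooth_dirD.
  have D z : U z -> dirD v' (fun z => dirD dir_x Y1 z + dirD dir_y Y2 z) z = dirD dir_x (dirD v' Y1) z + dirD dir_y (dirD v' Y2) z.
    move=> Uz. rewrite (dirD_plus U) //; try exact: sd. by rewrite !(dirD_comm_U v').
  have sD : smooth_on U (fun z => dirD dir_x Y1 z + dirD dir_y Y2 z) by apply: smooth_plus => //; exact: sd.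
  have pde f w z : smooth_on U f -> U z -> (forall z, U z -> dirD dir_t (dirD dir_t f) z = c ^ 2 * dirD w (fun z => dirD dir_x Y1 z + dirD dir_y Y2 z) z) ->
     dirD dir_t (dirD dir_t (dirD v' f)) z = c ^ 2 * dirD w (fun z => dirD dir_x (dirD v' Y1) z + dirD dir_y (dirD v' Y2) z) z.
    move=> sf Uz H.
    rewrite (dirD_ext_loc U w _ (dirD v' (fun z => dirD dir_x Y1 z + dirD dir_y Y2 z)) z) //; last by move=> y Uy; rewrite D.
    rewrite (dirD_comm_U w) // -dirD_scal.
    rewrite (dirD_ext_loc U v' _ (dirD dir_t (dirD dir_t f)) z) //; last by move=> y Uy; rewrite H.
    rewrite (dirD_comm_U v') //; last exact: sd.
    apply: (dirD_ext_loc U) => // y Uy. by rewrite dirD_comm_U.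
  split; try exact: sd; try exact: time_periodic_dirD.
  - move=> p. rewrite -dirD_slice -[RHS](dirD_const v 0 p). exact: dirD_ext.
  - move=> p. rewrite -dirD_slice -[RHS](dirD_const v 0 p). exact: dirD_ext.
  - move=> t p Ht. apply: pde => // -[t' p'] Ht'. exact: e1.
  - move=> t p Ht. apply: pde => // -[t' p'] Ht'. exact: e2.
Qed.

Definition divergence (Y1 Y2 : TP -> R) (z : TP) : R := dirD dir_x Y1 z + dirD dir_y Y2 z.

Lemma divergence_smooth Y1 Y2 : Acoustic d c Y1 Y2 -> smooth_on U (divergence Y1 Y2).
Proof. move=> S. apply: smooth_plus => //; apply: smooth_dirD; [exact: acoustic_smooth1 S | exact: acoustic_smooth2 S]. Qed.

Lemma divergence_periodic Y1 Y2 : Acoustic d c Y1 Y2 -> time_periodic d (divergence Y1 Y2).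
Proof.
  move=> S t Ht m n p. rewrite /divergence.
  by rewrite (time_periodic_dirD d dir_x Y1 (acoustic_periodic1 _ _ _ _ S) t Ht) (time_periodic_dirD d dir_y Y2 (acoustic_periodic2 _ _ _ _ S) t Ht).
Qed.

Lemma divergence_dirD v Y1 Y2 z : Acoustic d c Y1 Y2 -> U z ->
  dirD v (divergence Y1 Y2) z = divergence (dirD v Y1) (dirD v Y2) z.
Proof.
  move=> S Uz. have s1 := acoustic_smooth1 _ _ _ _ S. have s2 := acoustic_smooth2 _ _ _ _ S.
  rewrite /divergence (dirD_plus U) //; try exact: smooth_dirD. by rewrite !(dirD_comm_U v).
Qed.

Lemma torus_integral_div0 k f g : torus_function f -> torus_function g ->
  torus_integral (fun p => k * (dirD unit_x f p + dirD unit_y g p)) = 0.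
Proof.
  move=> tf tg. have cf := torus_function_contin _ (torus_function_dirD unit_x _ tf). have cg := torus_function_contin _ (torus_function_dirD unit_y _ tg).
  rewrite (torus_integral_scal _ _ (contin_plus _ _ cf cg)) (torus_integral_plus _ _ cf cg).
  rewrite (torus_integral_dirD0 unit_x _ tf) (torus_integral_dirD0 unit_y _ tg). by rewrite Rplus_0_l Rmult_0_r.
Qed.

(** The time derivative of the energy density [e] is the space divergence of [2 c^2 (div Y) Y_t], so
    the total energy is constant; it dominates [c^2] times the integral of [(div Y)^2]. *)
Lemma energy_bound Y1 Y2 : Acoustic d c Y1 Y2 -> exists M, forall t, 0 <= t ->
  torus_integral (fun p => divergence Y1 Y2 (t, p) * divergence Y1 Y2 (t, p)) <= M.
Proof.
  move=> S. have [s1 s2 p1 p2 _ _ e1 e2] := S.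
  have s := divergence_smooth _ _ S. have pD := divergence_periodic _ _ S.
  set D := divergence Y1 Y2 in s pD *.
  have s1t := smooth_dirD U dir_t _ s1. have s2t := smooth_dirD U dir_t _ s2.
  have sq f : smooth_on U f -> smooth_on U (fun z => f z * f z) by move=> sf; exact: smooth_mult.
  pose e z := dirD dir_t Y1 z * dirD dir_t Y1 z + dirD dir_t Y2 z * dirD dir_t Y2 z + c ^ 2 * (D z * D z).
  have s12 : smooth_on U (fun z => dirD dir_t Y1 z * dirD dir_t Y1 z + dirD dir_t Y2 z * dirD dir_t Y2 z).
    by apply: smooth_plus => //; exact: sq.
  have s3 : smooth_on U (fun z => c ^ 2 * (D z * D z)) by apply: smooth_scal => //; exact: sq.
  have se : smooth_on U e by exact: smooth_plus.
  have dsq f z v : smooth_on U f -> U z -> dirD v (fun z => f z * f z) z = 2 * (f z * dirD v f z).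
    move=> sf Uz. rewrite (dirD_mult U) //. ring.
  have de t p : - d < t -> dirD dir_t e (t, p) =
      2 * c ^ 2 * (dirD unit_x (fun p => dirD dir_t Y1 (t, p) * D (t, p)) p + dirD unit_y (fun p => dirD dir_t Y2 (t, p) * D (t, p)) p).
    move=> Ht. have Uz : U (t, p) by [].
    rewrite (dirD_slice (fun z => dirD dir_t Y1 z * D z)) (dirD_slice (fun z => dirD dir_t Y2 z * D z)).
    rewrite (dirD_mult U dir_x (dirD dir_t Y1) D) // (dirD_mult U dir_y (dirD dir_t Y2) D) //.
    rewrite /e (dirD_plus U) // (dirD_plus U) //; try exact: sq.
    rewrite dirD_scal !dsq //.
    have -> : dirD dir_t (dirD dir_t Y1) (t, p) = c ^ 2 * dirD dir_x D (t, p) by exact: e1.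
    have -> : dirD dir_t (dirD dir_t Y2) (t, p) = c ^ 2 * dirD dir_y D (t, p) by exact: e2.
    have -> : dirD dir_t D (t, p) = dirD dir_x (dirD dir_t Y1) (t, p) + dirD dir_y (dirD dir_t Y2) (t, p) by exact: divergence_dirD.
    have alg (a b u v k l m : R) : 2 * (a * (c ^ 2 * u)) + 2 * (b * (c ^ 2 * v)) + c ^ 2 * (2 * (m * (k + l)))
        = 2 * c ^ 2 * (k * m + a * u + (l * m + b * v)) by ring.
    exact: alg.
  have E0 t : - d < t -> is_derive (fun t => torus_integral (fun p => e (t, p))) t 0.
    move=> Ht.
    have tD := torus_function_slice d _ t s pD Ht.
    have t1 := torus_function_slice d _ t s1t (time_periodic_dirD d dir_t _ p1) Ht.
    have t2 := torus_function_slice d _ t s2t (time_periodic_dirD d dir_t _ p2) Ht.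
    have I0 : torus_integral (fun p => dirD dir_t e (t, p)) = 0.
      rewrite (torus_integral_ext _ _ (fun p => de t p Ht)).
      exact: (torus_integral_div0 (2 * c ^ 2) _ _ (torus_function_mult _ _ t1 tD) (torus_function_mult _ _ t2 tD)).
    have := is_derive_torus_integral d e t se Ht. by rewrite I0.
  exists (/ c ^ 2 * torus_integral (fun p => e (0, p))) => t Ht.
  rewrite -(const_of_derive _ d t dp Ht E0).
  have Ht' : - d < t by lra.
  have ct (f : TP -> R) : smooth_on U f -> contin (fun p => f (t, p)) by move=> sf; apply: smooth_contin; exact: (smooth_slice d).
  rewrite -torus_integral_scal; last exact: ct.
  apply: torus_integral_le.
  - exact: (ct _ (sq _ s)).
  - apply: contin_scal. exact: ct.
  - have c2 : 0 < c ^ 2 by nra.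
    have alg (a b m : R) : m <= / c ^ 2 * (a * a + b * b + c ^ 2 * m).
      have -> : / c ^ 2 * (a * a + b * b + c ^ 2 * m) = m + / c ^ 2 * (a * a + b * b) by field; lra.
      have : 0 <= / c ^ 2 * (a * a + b * b); last lra.
      apply: Rmult_le_pos; [exact: Rlt_le (Rinv_0_lt_compat _ c2) | nra].
    move=> p. rewrite /e. exact: (alg (dirD dir_t Y1 (t, p)) (dirD dir_t Y2 (t, p)) (D (t, p) * D (t, p))).
Qed.

(** A gradient has no curl, so the second time derivative of the curl vanishes. The constant term is
    zero because [Y], and with it every space derivative, vanishes at time 0. *)
Lemma acoustic_linear Y1 Y2 t p : Acoustic d c Y1 Y2 -> 0 <= t ->
  dirD dir_y Y1 (t, p) - dirD dir_x Y2 (t, p) = t * (dirD dir_y (dirD dir_t Y1) (0, p) - dirD dir_x (dirD dir_t Y2) (0, p)).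
Proof.
  move=> S Ht. have [s1 s2 p1 p2 _ _ e1 e2] := S.
  have U0 : U (0, p) by rewrite /after /=; lra.
  pose f z := dirD dir_y Y1 z - dirD dir_x Y2 z.
  have sf : smooth_on U f by apply: smooth_minus => //; exact: smooth_dirD.
  have ft z : U z -> dirD dir_t f z = dirD dir_y (dirD dir_t Y1) z - dirD dir_x (dirD dir_t Y2) z.
    move=> Uz. rewrite -(dirD_comm_U dir_t dir_y Y1) // -(dirD_comm_U dir_t dir_x Y2) //.
    apply: (dirD_minus U) => //; exact: smooth_dirD.
  have sD := divergence_smooth _ _ S.
  have s1t := smooth_dirD U dir_t _ s1. have s2t := smooth_dirD U dir_t _ s2.
  have ftt z : U z -> dirD dir_t (dirD dir_t f) z = 0.
    move=> Uz. rewrite (dirD_ext_loc U dir_t _ _ z oU ft) //.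
    rewrite (dirD_minus U dir_t (dirD dir_y (dirD dir_t Y1)) (dirD dir_x (dirD dir_t Y2))) //; try exact: smooth_dirD.
    rewrite (dirD_comm_U dir_t dir_y (dirD dir_t Y1)) // (dirD_comm_U dir_t dir_x (dirD dir_t Y2)) //.
    rewrite (dirD_ext_loc U dir_y _ (fun z => c ^ 2 * dirD dir_x (divergence Y1 Y2) z) z oU) //; last by case=> *; exact: e1.
    rewrite (dirD_ext_loc U dir_x (dirD dir_t (dirD dir_t Y2)) (fun z => c ^ 2 * dirD dir_y (divergence Y1 Y2) z) z oU) //; last by case=> *; exact: e2.
    rewrite !dirD_scal (dirD_comm_U dir_x dir_y (divergence Y1 Y2)) //. ring.
  have := linear_of_derive (fun t => f (t, p)) (fun t => dirD dir_t f (t, p)) d t dp Ht.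
  rewrite (ft (0, p)) // -/(f (t, p)) => ->.
  - have -> : f (0, p) = 0.
      have [_ _ _ _ z1 _ _ _] := acoustic_dirD (0, 1) _ _ S. have [_ _ _ _ _ z2 _ _] := acoustic_dirD (1, 0) _ _ S.
      rewrite /f z1 z2. exact: Rminus_diag.
    ring.
  - move=> s Hs. exact: (deriv_t d).
  - move=> s Hs. have := deriv_t d (dirD dir_t f) s p (smooth_dirD U dir_t _ sf) Hs. by rewrite ftt.
Qed.

(** The second time derivative of each component is a space derivative, whose mean over the torus is
    zero. *)
Lemma acoustic_mean Y1 Y2 t : Acoustic d c Y1 Y2 -> 0 <= t ->
  torus_integral (fun p => Y1 (t, p)) = t * torus_integral (fun p => dirD dir_t Y1 (0, p)) /\
  torus_integral (fun p => Y2 (t, p)) = t * torus_integral (fun p => dirD dir_t Y2 (0, p)).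
Proof.
  move=> S Ht. have [s1 s2 p1 p2 z1 z2 e1 e2] := S.
  have sD := divergence_smooth _ _ S. have pD := divergence_periodic _ _ S.
  have gen f v : smooth_on U f -> (forall p, f (0, p) = 0) ->
    (forall s p, - d < s -> dirD dir_t (dirD dir_t f) (s, p) = c ^ 2 * dirD ((0, v) : TP) (divergence Y1 Y2) (s, p)) ->
    torus_integral (fun p => f (t, p)) = t * torus_integral (fun p => dirD dir_t f (0, p)).
    move=> sf z e.
    have := linear_of_derive (fun t => torus_integral (fun p => f (t, p)))
      (fun t => torus_integral (fun p => dirD dir_t f (t, p))) d t dp Ht.
    have -> : torus_integral (fun p => f (0, p)) = 0 by rewrite -[RHS](torus_integral_const 0); exact: torus_integral_ext.
    rewrite Rplus_0_l. apply.
    - move=> s Hs. exact: (is_derive_torus_integral d).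
    - move=> s Hs. have := is_derive_torus_integral d _ s (smooth_dirD U dir_t _ sf) Hs.
      have tD := torus_function_slice d _ s sD pD Hs.
      rewrite (torus_integral_ext _ (fun p => c ^ 2 * dirD v (fun p => divergence Y1 Y2 (s, p)) p)); last by move=> p; rewrite e // dirD_slice.
      rewrite torus_integral_scal; last by apply: torus_function_contin; exact: torus_function_dirD.
      by rewrite torus_integral_dirD0 // Rmult_0_r.
  split; [exact: (gen Y1 (1, 0) s1 z1 e1) | exact: (gen Y2 (0, 1) s2 z2 e2)].
Qed.

Lemma comb_sq_le (S T a b : R) : 0 < S -> 0 < T ->
  (/ (S + T) * (S * a - T * b)) * (/ (S + T) * (S * a - T * b)) <= 2 * (a * a) + 2 * (b * b).
Proof.
  move=> Sp Tp.
  have -> : / (S + T) * (S * a - T * b) * (/ (S + T) * (S * a - T * b)) = (S * a - T * b) ^ 2 / (S + T) ^ 2 by field; lra.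
  have P : 0 < (S + T) ^ 2 by nra.
  apply: (Rmult_le_reg_r ((S + T) ^ 2)) => //.
  rewrite /Rdiv Rmult_assoc Rinv_l ?Rmult_1_r; last lra.
  have ST : 0 < S * T by nra.
  (* The square of [S a + T b] is the gap between the square of [S a - T b] and
     [2 S^2 a^2 + 2 T^2 b^2]; the four terms that follow complete the latter to
     [2 (S + T)^2 (a^2 + b^2)]. *)
  have : 0 <= (S * a + T * b) ^ 2 by exact: pow2_ge_0.
  have : 0 <= T ^ 2 * a ^ 2 by nra. have : 0 <= S ^ 2 * b ^ 2 by nra.
  have : 0 <= (S * T) * a ^ 2 by nra. have : 0 <= (S * T) * b ^ 2 by nra.
  nra.
Qed.

(** [a] and [b] are values at time [T], [a'] and [b'] at time [S]: a difference that is proportional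
    to the time is annihilated by the combination. It serves for the curl. *)
Lemma comb_cancel (S T a b a' b' k : R) : a' - b' = S * k -> a - b = T * k ->
  / (S + T) * (S * a - T * a') = / (S + T) * (S * b - T * b').
Proof.
  move=> E' E. congr Rmult. have -> : a = b + T * k by lra. have -> : a' = b' + S * k by lra. ring.
Qed.

(** The weights make the curl and the mean of [(S Y(T) - T Y(S)) / (S + T)] vanish. *)
Lemma acoustic_cauchy Y1 Y2 : Acoustic d c Y1 Y2 -> exists C, forall S T p, 0 < S -> 0 < T ->
  Rabs (Y1 (T, p) / T - Y1 (S, p) / S) <= C * (/ T + / S) /\
  Rabs (Y2 (T, p) / T - Y2 (S, p) / S) <= C * (/ T + / S).
Proof.
  move=> HS. have [s1 s2 p1 p2 _ _ _ _] := HS.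
  have [M HM] := energy_bound _ _ HS.
  have HSx := acoustic_dirD (1, 0) _ _ HS.
  have [Mx HMx] := energy_bound _ _ HSx.
  (* The 1 is the additive constant of [torus_function_curlfree_sup]. Each 4 is [2 + 2], from
     [comb_sq_le] together with the energy bound at the two times [S] and [T]. *)
  exists (1 + 4 * M + 4 * Mx) => S T p Sp Tp.
  have HT : - d < T by lra. have HS' : - d < S by lra.
  pose comb (f : TP -> R) (p : pt) := / (S + T) * (S * f (T, p) - T * f (S, p)).
  have tcomb f : smooth_on U f -> time_periodic d f -> torus_function (comb f).
    move=> sf pf. apply: torus_function_scal. apply: torus_function_minus; apply: torus_function_scal; exact: (torus_function_slice d).
  have ccomb (v : ptN) f q : smooth_on U f -> dirD v (comb f) q = comb (dirD ((0, v) : TP) f) q.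
    move=> sf. have sT := smooth_slice d _ T sf HT. have sS := smooth_slice d _ S sf HS'.
    rewrite /comb dirD_scal (dirD_minus whole v (fun q => S * f (T, q)) (fun q => T * f (S, q))) //.
    - by rewrite !dirD_scal !dirD_slice.
    - exact: (smooth_scal _ _ _ open_whole).
    - exact: (smooth_scal _ _ _ open_whole).
  have t1 := tcomb _ s1 p1. have t2 := tcomb _ s2 p2.
  have cf q : dirD unit_y (comb Y1) q = dirD unit_x (comb Y2) q.
    rewrite !ccomb //.
    have LT := acoustic_linear _ _ T q HS (Rlt_le _ _ Tp). have LS := acoustic_linear _ _ S q HS (Rlt_le _ _ Sp).
    exact: (comb_cancel S T _ _ _ _ _ LS LT).
  have dvE q : dirD unit_x (comb Y1) q + dirD unit_y (comb Y2) q = comb (divergence Y1 Y2) q.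
    rewrite !ccomb // /comb /divergence.
    have alg (k u v u' v' : R) : k * (S * u - T * u') + k * (S * v - T * v') = k * (S * (u + v) - T * (u' + v')) by ring.
    exact: alg.
  have dvxE q : dirD unit_x (fun q => dirD unit_x (comb Y1) q + dirD unit_y (comb Y2) q) q = comb (divergence (dirD dir_x Y1) (dirD dir_x Y2)) q.
    rewrite (dirD_ext unit_x _ _ q dvE) ccomb; last exact: divergence_smooth.
    by rewrite /comb !(divergence_dirD dir_x).
  have sqb f K : smooth_on U f -> (forall t, 0 <= t -> torus_integral (fun p => f (t, p) * f (t, p)) <= K) ->
     torus_integral (fun q => comb f q * comb f q) <= 4 * K.
    move=> sf HK.
    have cT := smooth_contin _ (smooth_slice d _ T sf HT). have cS := smooth_contin _ (smooth_slice d _ S sf HS').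
    have cTT := contin_mult _ _ cT cT. have cSS := contin_mult _ _ cS cS.
    have cc : contin (comb f) by exact: (contin_scal _ _ (contin_minus _ _ (contin_scal S _ cT) (contin_scal T _ cS))).
    apply: (Rle_trans _ (torus_integral (fun q => 2 * (f (T, q) * f (T, q)) + 2 * (f (S, q) * f (S, q))))).
    - apply: torus_integral_le; first exact: contin_mult.
      + apply: contin_plus; exact: contin_scal.
      + move=> q. exact: comb_sq_le.
    - rewrite (torus_integral_plus _ _ (contin_scal 2 _ cTT) (contin_scal 2 _ cSS)) (torus_integral_scal 2 _ cTT) (torus_integral_scal 2 _ cSS).
      have alg (x y : R) : x <= K -> y <= K -> 2 * x + 2 * y <= 4 * K by lra.
      exact: (alg _ _ (HK T (Rlt_le _ _ Tp)) (HK S (Rlt_le _ _ Sp))).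
  have b1 := sqb _ _ (divergence_smooth _ _ HS) HM.
  have b2 := sqb _ _ (divergence_smooth _ _ HSx) HMx.
  have {}b1 : torus_integral (fun q => (dirD unit_x (comb Y1) q + dirD unit_y (comb Y2) q) * (dirD unit_x (comb Y1) q + dirD unit_y (comb Y2) q)) <= 4 * M.
    apply: Rle_trans b1. apply: Req_le. apply: torus_integral_ext => q. by rewrite dvE.
  have {}b2 : torus_integral (fun p => dirD unit_x (fun q => dirD unit_x (comb Y1) q + dirD unit_y (comb Y2) q) p
      * dirD unit_x (fun q => dirD unit_x (comb Y1) q + dirD unit_y (comb Y2) q) p) <= 4 * Mx.
    apply: Rle_trans b2. apply: Req_le. apply: torus_integral_ext => q. by rewrite dvxE.
  have mean f k : smooth_on U f -> torus_integral (fun p => f (T, p)) = T * k -> torus_integral (fun p => f (S, p)) = S * k ->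
     torus_integral (comb f) = 0.
    move=> sf fT fS.
    have cT := smooth_contin _ (smooth_slice d _ T sf HT). have cS := smooth_contin _ (smooth_slice d _ S sf HS').
    have c1 := contin_scal S _ cT. have c2 := contin_scal T _ cS.
    rewrite /comb (torus_integral_scal _ _ (contin_minus _ _ c1 c2)) (torus_integral_minus _ _ c1 c2) (torus_integral_scal S _ cT) (torus_integral_scal T _ cS) fT fS.
    ring.
  have [mT1 mT2] := acoustic_mean _ _ T HS (Rlt_le _ _ Tp). have [mS1 mS2] := acoustic_mean _ _ S HS (Rlt_le _ _ Sp).
  have [B1 B2] := torus_function_curlfree_sup _ _ t1 t2 cf p.
  rewrite (mean Y1 _ s1 mT1 mS1) Rminus_0_r in B1. rewrite (mean Y2 _ s2 mT2 mS2) Rminus_0_r in B2.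
  have conv (a b K1 K2 : R) : Rabs (/ (S + T) * (S * a - T * b)) <= 1 + K1 + K2 -> K1 <= 4 * M -> K2 <= 4 * Mx ->
     Rabs (a / T - b / S) <= (1 + 4 * M + 4 * Mx) * (/ T + / S).
    move=> H L1 L2. have -> : a / T - b / S = / (S + T) * (S * a - T * b) * (/ T + / S) by field; lra.
    have I : 0 < / T + / S by have := Rinv_0_lt_compat _ Sp; have := Rinv_0_lt_compat _ Tp; lra.
    rewrite Rabs_mult (Rabs_pos_eq (/ T + / S)); last lra.
    apply: Rmult_le_compat_r; lra.
  split; [exact: (conv _ _ _ _ B1 b1 b2) | exact: (conv _ _ _ _ B2 b1 b2)].
Qed.

(** The divergence has mean zero, and its derivatives in [x], in [y] and in both are the divergences
    of the corresponding derivative solutions, each with its own energy bound. These are the terms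
    of the Sobolev inequality. *)
Lemma divergence_bounded Y1 Y2 : Acoustic d c Y1 Y2 -> exists C, forall t p, 0 <= t -> Rabs (divergence Y1 Y2 (t, p)) <= C.
Proof.
  move=> S.
  have Sx := acoustic_dirD (1, 0) _ _ S. have Sy := acoustic_dirD (0, 1) _ _ S. have Sxy := acoustic_dirD (1, 0) _ _ Sy.
  have [M1 H1] := energy_bound _ _ Sx. have [M2 H2] := energy_bound _ _ Sy. have [M3 H3] := energy_bound _ _ Sxy.
  exists (1 + M1 + M2 + M3) => t p Ht. have Ht' : - d < t by lra.
  have sD := divergence_smooth _ _ S. have pD := divergence_periodic _ _ S.
  have tD := torus_function_slice d _ t sD pD Ht'.
  have := torus_function_sobolev _ tD p.
  have -> : torus_integral (fun p => divergence Y1 Y2 (t, p)) = 0.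
    have [s1 s2 p1 p2 _ _ _ _] := S.
    have t1 := torus_function_slice d _ t s1 p1 Ht'. have t2 := torus_function_slice d _ t s2 p2 Ht'.
    rewrite -(torus_integral_div0 1 _ _ t1 t2). apply: torus_integral_ext => q. by rewrite !dirD_slice Rmult_1_l.
  rewrite Rminus_0_r.
  rewrite (torus_integral_ext _ (fun p => divergence (dirD dir_x Y1) (dirD dir_x Y2) (t, p) * divergence (dirD dir_x Y1) (dirD dir_x Y2) (t, p)
     + divergence (dirD dir_y Y1) (dirD dir_y Y2) (t, p) * divergence (dirD dir_y Y1) (dirD dir_y Y2) (t, p)
     + divergence (dirD dir_x (dirD dir_y Y1)) (dirD dir_x (dirD dir_y Y2)) (t, p) * divergence (dirD dir_x (dirD dir_y Y1)) (dirD dir_x (dirD dir_y Y2)) (t, p))); last first.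
    move=> q.
    have Ex v r : dirD v (fun p => divergence Y1 Y2 (t, p)) r = divergence (dirD ((0, v) : TP) Y1) (dirD ((0, v) : TP) Y2) (t, r).
      by rewrite dirD_slice divergence_dirD.
    rewrite !Ex (dirD_ext unit_x _ _ q (Ex (0, 1))) dirD_slice divergence_dirD //.
  have cc (Z1 Z2 : TP -> R) : Acoustic d c Z1 Z2 -> contin (fun p => divergence Z1 Z2 (t, p) * divergence Z1 Z2 (t, p)).
    move=> SZ. apply: torus_function_contin. have := torus_function_slice d _ t (divergence_smooth _ _ SZ) (divergence_periodic _ _ SZ) Ht'. move=> T. exact: torus_function_mult.
  rewrite (torus_integral_plus _ _ (contin_plus _ _ (cc _ _ Sx) (cc _ _ Sy)) (cc _ _ Sxy)) (torus_integral_plus _ _ (cc _ _ Sx) (cc _ _ Sy)).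
  have alg (a x y z : R) : x <= M1 -> y <= M2 -> z <= M3 -> a <= 1 + (x + y + z) -> a <= 1 + M1 + M2 + M3 by lra.
  exact: (alg _ _ _ _ (H1 t Ht) (H2 t Ht) (H3 t Ht)).
Qed.

End Solutions.

Transparent dirD torus_integral.

(** * Long-time averages *)

Definition time_average (Y : TP -> R) (T : R) (p : pt) : R := Y (T, p) / T.

(** The divergence-free part of the initial velocity. *)
Definition limit_average (Y : TP -> R) (p : pt) : R :=
  real (Lim_seq (fun n => time_average Y (INR n + 1) p)).

(** The estimate is uniform in [p], and its rate matters: multiplied by [T], an error [C / T] in the
    average becomes a bounded error in [Y]. *)
Definition averages_converge (Y : TP -> R) : Prop :=
  exists C, forall S T p, 0 < S -> 0 < T ->
    Rabs (time_average Y T p - time_average Y S p) <= C * (/ T + / S).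

Lemma INR1_pos n : 0 < INR n + 1.
Proof. have := pos_INR n. lra. Qed.

Lemma is_lim_seq_inv_INR1 : is_lim_seq (fun n => / (INR n + 1)) 0.
Proof.
  apply: (is_lim_seq_ext (fun n => / INR (S n))); first by move=> n; rewrite S_INR.
  apply/(is_lim_seq_incr_1 (fun n => / INR n)).
  apply: (is_lim_seq_inv _ p_infty); [exact: is_lim_seq_INR | done].
Qed.

Lemma averages_constant_pos Y C : (forall S T p, 0 < S -> 0 < T ->
    Rabs (time_average Y T p - time_average Y S p) <= C * (/ T + / S)) -> 0 <= C.
Proof.
  move=> H. have := H 1 1 (0, 0) Rlt_0_1 Rlt_0_1.
  rewrite Rminus_diag Rabs_R0 Rinv_1. lra.
Qed.

(** [real] would hide an infinite limit behind a default value; the Cauchy criterion shows that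
    [limit_average] is a genuine limit. *)
Lemma is_lim_average Y p : averages_converge Y ->
  is_lim_seq (fun n => time_average Y (INR n + 1) p) (limit_average Y p).
Proof.
  move=> [C HC]. have C0 := averages_constant_pos _ _ HC.
  apply: Lim_seq_correct'. apply/ex_lim_seq_cauchy_corr => eps.
  have := is_lim_seq_scal_l _ (2 * C) _ is_lim_seq_inv_INR1.
  rewrite /= Rmult_0_r => /is_lim_seq_spec /(_ eps) [N HN].
  exists N => n m Hn Hm.
  have An := HN _ Hn. have Am := HN _ Hm.
  rewrite Rminus_0_r in An. rewrite Rminus_0_r in Am.
  have := HC _ _ p (INR1_pos m) (INR1_pos n).
  have := Rle_abs (2 * C * / (INR n + 1)). have := Rle_abs (2 * C * / (INR m + 1)).
  lra.
Qed.

(** The Cauchy estimate is passed to the limit with [S = n + 1] tending to infinity, so that only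
    the term in [1 / T] remains. *)
Lemma average_rate Y : averages_converge Y -> exists C, 0 <= C /\ forall T p, 0 < T ->
  Rabs (time_average Y T p - limit_average Y p) <= C * / T.
Proof.
  move=> H. have [C HC] := H. have C0 := averages_constant_pos _ _ HC.
  exists C. split=> // T p Tp.
  apply: (is_lim_seq_le (fun n => Rabs (time_average Y T p - time_average Y (INR n + 1) p))
     (fun n => C * (/ T + / (INR n + 1)))
     (Rabs (time_average Y T p - limit_average Y p)) (C * / T)).
  - move=> n. apply: HC => //. exact: INR1_pos.
  - apply: (is_lim_seq_abs _ (time_average Y T p - limit_average Y p)).
    apply: is_lim_seq_minus'; [exact: is_lim_seq_const | exact: is_lim_average].
  - rewrite -[X in Finite (C * X)]Rplus_0_r.
    apply: (is_lim_seq_scal_l _ C (/ T + 0)).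
    apply: is_lim_seq_plus'; [exact: is_lim_seq_const | exact: is_lim_seq_inv_INR1].
Qed.

Lemma average_uniform Y : averages_converge Y -> forall eps : posreal, exists N, forall n p, (N <= n)%nat ->
  Rabs (time_average Y (INR n + 1) p - limit_average Y p) < eps.
Proof.
  move=> /average_rate [C [C0 HC]] eps.
  have := is_lim_seq_scal_l _ C _ is_lim_seq_inv_INR1.
  rewrite /= Rmult_0_r => /is_lim_seq_spec /(_ eps) [N HN].
  exists N => n p Hn. apply: Rle_lt_trans (HC _ p (INR1_pos n)) _.
  have := HN n Hn. rewrite Rminus_0_r. have := Rle_abs (C * / (INR n + 1)). lra.
Qed.

(** * Continuity and differentiability of the limit *)

Section Limit.
Context (d : R) (dp : 0 < d).
Local Notation U := (after d).

Lemma after_INR1 n (p : pt) : U (INR n + 1, p).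
Proof. rewrite /after /=. have := pos_INR n. lra. Qed.

Lemma average_smooth Y n : smooth_on U Y -> smooth_on whole (time_average Y (INR n + 1) : ptN -> R).
Proof.
  move=> sY. apply: (smooth_ext whole (fun p : ptN => / (INR n + 1) * Y (INR n + 1, p))).
  - exact: open_whole.
  - move=> p _. rewrite /time_average /Rdiv. exact: Rmult_comm.
  - apply: (smooth_scal whole _ (fun p : ptN => Y (INR n + 1, p)) open_whole).
    exact: (smooth_slice d Y _ sY (after_INR1 n (0, 0))).
Qed.

Lemma limit_continuous Y : smooth_on U Y -> averages_converge Y -> contin (limit_average Y).
Proof.
  move=> sY H p. apply/filterlim_locally => eps.
  have He : 0 < eps / 3 by have := cond_pos eps; lra.
  have [N HN] := average_uniform Y H (mkposreal _ He).
  have cN := smooth_contin _ (average_smooth Y N sY) p.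
  have /filterlim_locally /(_ (mkposreal _ He)) := cN.
  apply: filter_imp => q.
  rewrite /ball /= /AbsRing_ball /= /abs /minus /plus /opp /=.
  have := HN N q (le_n N). have := HN N p (le_n N) => /=.
  have alg (a b u v : R) : Rabs (b - a) < eps / 3 -> Rabs (v - u) < eps / 3 -> Rabs (v + - b) < eps / 3 -> Rabs (u + - a) < eps.
    move=> /Rabs_def2 [? ?] /Rabs_def2 [? ?] /Rabs_def2 [? ?]. apply: Rabs_def1; lra.
  exact: alg.
Qed.

Lemma CVU_average Y (x v : ptN) : averages_converge Y ->
  CVU_dom (fun n h => time_average Y (INR n + 1) (plus x (scal h v))) (fun _ => True).
Proof.
  move=> H eps. have [N HN] := average_uniform Y H eps. exists N => n Hn h _. exact: HN.
Qed.

(** Along the line, the averages and their derivatives both converge uniformly, so limit and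
    derivative can be exchanged. *)
Lemma limit_is_derive Y (x v : ptN) : smooth_on U Y -> averages_converge Y ->
  averages_converge (dirD ((0, v) : TP) Y) ->
  is_derive (fun h : R => limit_average Y (plus x (scal h v))) 0 (limit_average (dirD ((0, v) : TP) Y) x).
Proof.
  move=> sY HY HdY.
  have D n h : is_derive (fun h => time_average Y (INR n + 1) (plus x (scal h v))) h
      (time_average (dirD ((0, v) : TP) Y) (INR n + 1) (plus x (scal h v))).
    have := smooth_is_derive whole _ x v h (average_smooth Y n sY) I.
    have -> : dirD v (time_average Y (INR n + 1)) (plus x (scal h v)) = time_average (dirD ((0, v) : TP) Y) (INR n + 1) (plus x (scal h v)).
      rewrite (dirD_ext v _ (fun p : ptN => / (INR n + 1) * Y (INR n + 1, p))).
        rewrite dirD_scal dirD_slice /time_average /Rdiv. exact: Rmult_comm.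
      move=> p. rewrite /time_average /Rdiv. exact: Rmult_comm.
    done.
  have E : (fun n h => Derive (fun h => time_average Y (INR n + 1) (plus x (scal h v))) h) =
     (fun n h => time_average (dirD ((0, v) : TP) Y) (INR n + 1) (plus x (scal h v))).
    apply functional_extensionality => n. apply functional_extensionality => h. exact: is_derive_unique.
  have := CVU_Derive (fun n h => time_average Y (INR n + 1) (plus x (scal h v))) (fun _ => True) open_true
    (fun _ _ _ _ _ _ => I) (CVU_average Y x v HY).
  rewrite E => /(_ _ _ (CVU_average _ x v HdY) 0 I).
  rewrite (Lim_seq_ext (fun n => Derive (fun h => time_average Y (INR n + 1) (plus x (scal h v))) 0)
     (fun n => time_average (dirD ((0, v) : TP) Y) (INR n + 1) x)); last first.
    move=> n. rewrite (is_derive_unique _ _ _ (D n 0)). by rewrite line_0.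
  apply.
  - move=> n h _. eexists. exact: D.
  - move=> n h _.
    apply: (continuity_pt_ext (fun h => time_average (dirD ((0, v) : TP) Y) (INR n + 1) (plus x (scal h v)))).
      move=> k. symmetry. exact: is_derive_unique.
    have cc : continuous (fun h : R => time_average (dirD ((0, v) : TP) Y) (INR n + 1) (plus x (scal h v))) h.
      apply: (continuous_comp (fun h : R => plus x (scal h v)) (time_average (dirD ((0, v) : TP) Y) (INR n + 1))).
      + exact: continuous_line.
      + apply: smooth_contin. apply: average_smooth. exact: smooth_dirD.
    apply/continuity_pt_filterlim. exact: cc.
Qed.

Lemma limit_periodic Y : time_periodic d Y -> periodic (limit_average Y).
Proof.
  move=> pY m n p. rewrite /limit_average. congr real. apply: Lim_seq_ext => k.
  rewrite /time_average. congr Rdiv. exact: (pY _ (after_INR1 k p)).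
Qed.

End Limit.

(** * The limit field of an acoustic solution *)

Section SolLimit.
Context (d c : R) (dp : 0 < d) (cp : 0 < c).

Lemma acoustic_averages Y1 Y2 : Acoustic d c Y1 Y2 -> averages_converge Y1 /\ averages_converge Y2.
Proof.
  move=> S. have [C HC] := acoustic_cauchy d c dp cp _ _ S.
  by split; exists C => s t p sp tp; case: (HC s t p sp tp).
Qed.

(** The induction on the order runs over all solutions at once: a derivative of the limit is the
    limit for a derivative solution, to which the hypothesis of order [n] applies. *)
Lemma limit_smooth Y1 Y2 : Acoustic d c Y1 Y2 ->
  smooth_on whole (limit_average Y1 : ptN -> R) /\ smooth_on whole (limit_average Y2 : ptN -> R).
Proof.
  move=> S.
  suff H n : Ck n whole (limit_average Y1 : ptN -> R) /\ Ck n whole (limit_average Y2 : ptN -> R).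
    by split=> n; case: (H n).
  elim: n Y1 Y2 S => [|n IH] Y1 Y2 S; have [A1 A2] := acoustic_averages _ _ S;
    have c1 := limit_continuous d dp _ (acoustic_smooth1 _ _ _ _ S) A1;
    have c2 := limit_continuous d dp _ (acoustic_smooth2 _ _ _ _ S) A2.
  - by split; split=> // p _; first [exact: c1 | exact: c2].
  - have der v : Ck n whole (limit_average (dirD ((0, v) : TP) Y1) : ptN -> R) /\ Ck n whole (limit_average (dirD ((0, v) : TP) Y2) : ptN -> R)
      by exact: IH (acoustic_dirD d c v _ _ S).
    split; (split; first by move=> p _; first [exact: c1 | exact: c2]) => v;
      have [B1 B2] := acoustic_averages _ _ (acoustic_dirD d c v _ _ S); have [D1 D2] := der v.
    + have E x := limit_is_derive d dp Y1 x v (acoustic_smooth1 _ _ _ _ S) A1 B1.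
      split; first by move=> x _; eexists; exact: E.
      apply: Ck_ext D1; first exact: open_whole. move=> x _. symmetry. apply: is_derive_unique. exact: E.
    + have E x := limit_is_derive d dp Y2 x v (acoustic_smooth2 _ _ _ _ S) A2 B2.
      split; first by move=> x _; eexists; exact: E.
      apply: Ck_ext D2; first exact: open_whole. move=> x _. symmetry. apply: is_derive_unique. exact: E.
Qed.

Lemma limit_dirD Y1 Y2 (v : ptN) x : Acoustic d c Y1 Y2 ->
  dirD v (limit_average Y1) x = limit_average (dirD ((0, v) : TP) Y1) x /\
  dirD v (limit_average Y2) x = limit_average (dirD ((0, v) : TP) Y2) x.
Proof.
  move=> S. have [A1 A2] := acoustic_averages _ _ S.
  have [B1 B2] := acoustic_averages _ _ (acoustic_dirD d c v _ _ S).
  split; apply: is_derive_unique.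
  - exact: (limit_is_derive d dp Y1 x v (acoustic_smooth1 _ _ _ _ S) A1 B1).
  - exact: (limit_is_derive d dp Y2 x v (acoustic_smooth2 _ _ _ _ S) A2 B2).
Qed.

(** The divergence of [Y] stays bounded, so that of [Y(T)/T] is at most [C / T]. *)
Lemma limit_div_free Y1 Y2 p : Acoustic d c Y1 Y2 ->
  dirD unit_x (limit_average Y1) p + dirD unit_y (limit_average Y2) p = 0.
Proof.
  move=> S. have [-> _] := limit_dirD _ _ unit_x p S. have [_ ->] := limit_dirD _ _ unit_y p S.
  have [Ax _] := acoustic_averages _ _ (acoustic_dirD d c unit_x _ _ S).
  have [_ Ay] := acoustic_averages _ _ (acoustic_dirD d c unit_y _ _ S).
  have [C HC] := divergence_bounded d c dp cp _ _ S.
  have L := is_lim_seq_plus' _ _ _ _ (is_lim_average _ p Ax) (is_lim_average _ p Ay).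
  have C0 : 0 <= C by have := HC 0 p (Rle_refl 0); have := Rabs_pos (divergence Y1 Y2 (0, p)); lra.
  have L0 : is_lim_seq (fun n => time_average (dirD dir_x Y1) (INR n + 1) p + time_average (dirD dir_y Y2) (INR n + 1) p) 0.
    have V := is_lim_seq_scal_l _ C _ is_lim_seq_inv_INR1. rewrite /= Rmult_0_r in V.
    have V' := is_lim_seq_scal_l _ (-C) _ is_lim_seq_inv_INR1. rewrite /= Rmult_0_r in V'.
    apply: (is_lim_seq_le_le _ _ _ _ _ V' V) => n.
    have Hn : 0 <= INR n + 1 by have := pos_INR n; lra.
    have Hi := Rinv_0_lt_compat _ (INR1_pos n).
    have := HC (INR n + 1) p Hn. rewrite /divergence /time_average.
    have alg (a b : R) : Rabs (a + b) <= C -> - C * / (INR n + 1) <= a / (INR n + 1) + b / (INR n + 1) <= C * / (INR n + 1).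
      move=> /Rabs_le_between [? ?]. rewrite /Rdiv -Rmult_plus_distr_r. split; apply: Rmult_le_compat_r; lra.
    exact: alg.
  have := is_lim_seq_unique _ _ L. rewrite (is_lim_seq_unique _ _ L0). by case.
Qed.

(** The curl of [Y(T)/T] does not depend on [T], since the curl of [Y] is proportional to the
    time. *)
Lemma limit_curl Y1 Y2 p : Acoustic d c Y1 Y2 ->
  dirD unit_y (limit_average Y1) p - dirD unit_x (limit_average Y2) p =
  dirD dir_y (dirD dir_t Y1) (0, p) - dirD dir_x (dirD dir_t Y2) (0, p).
Proof.
  move=> S. have [-> _] := limit_dirD _ _ unit_y p S. have [_ ->] := limit_dirD _ _ unit_x p S.
  have [Ay _] := acoustic_averages _ _ (acoustic_dirD d c unit_y _ _ S).
  have [_ Ax] := acoustic_averages _ _ (acoustic_dirD d c unit_x _ _ S).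
  have L := is_lim_seq_minus' _ _ _ _ (is_lim_average _ p Ay) (is_lim_average _ p Ax).
  set k := RHS.
  have L0 : is_lim_seq (fun n => time_average (dirD dir_y Y1) (INR n + 1) p - time_average (dirD dir_x Y2) (INR n + 1) p) k.
    apply: (is_lim_seq_ext (fun _ => k)); last exact: is_lim_seq_const.
    move=> n. have Hn : 0 <= INR n + 1 by have := pos_INR n; lra.
    have := acoustic_linear d c dp _ _ (INR n + 1) p S Hn. rewrite /time_average -/k.
    have alg (a b : R) : a - b = (INR n + 1) * k -> k = a / (INR n + 1) - b / (INR n + 1).
      move=> E. rewrite /Rdiv -Rmult_minus_distr_r E. field. have := pos_INR n; lra.
    exact: alg.
  have := is_lim_seq_unique _ _ L. rewrite (is_lim_seq_unique _ _ L0). by case.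
Qed.

Lemma average_bound Y : averages_converge Y -> (forall p, Y (0, p) = 0) ->
  exists C, forall t p, 0 <= t -> Rabs (Y (t, p) - t * limit_average Y p) <= C.
Proof.
  move=> H Y0. have [C [C0 HC]] := average_rate Y H. exists C => t p Ht.
  (* At [t = 0] the average has a zero denominator; the bound holds there because [Y] vanishes. *)
  case: (Req_dec t 0) => [->|tn]; first by rewrite Y0 Rmult_0_l Rminus_0_r Rabs_R0.
  have tp : 0 < t by lra.
  have -> : Y (t, p) - t * limit_average Y p = t * (time_average Y t p - limit_average Y p).
    have alg (a b : R) : a - t * b = t * (a / t - b) by field; lra.
    exact: alg.
  rewrite Rabs_mult (Rabs_pos_eq t) //. have := HC t p tp. move=> /(Rmult_le_compat_l t _ _ Ht).
  by rewrite (_ : t * (C * / t) = C); last by field; lra.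
Qed.

(** The mean of [Y(T)/T] is [k] for every [T > 0], and it differs from the mean of the limit by at
    most [C / T]. *)
Lemma limit_mean Y k : smooth_on (after d) Y -> averages_converge Y -> (forall p, Y (0, p) = 0) ->
  (forall t, 0 <= t -> torus_integral (fun p => Y (t, p)) = t * k) -> torus_integral (limit_average Y) = k.
Proof.
  move=> sY H Y0 HI. have [C [C0 HC]] := average_rate Y H.
  have cw := limit_continuous d dp Y sY H.
  have B T : 0 < T -> Rabs (k - torus_integral (limit_average Y)) <= C * / T.
    move=> Tp. have HT : - d < T by lra.
    have cT := smooth_contin _ (smooth_slice d Y T sY HT).
    have cA : contin (fun p => / T * Y (T, p)) by exact: contin_scal.
    have E : torus_integral (fun p => / T * Y (T, p) - limit_average Y p) = k - torus_integral (limit_average Y).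
      rewrite (torus_integral_minus _ _ cA cw) (torus_integral_scal _ _ cT) HI; last lra.
      by rewrite -Rmult_assoc Rinv_l ?Rmult_1_l; last lra.
    have cm := contin_minus _ _ cA cw.
    have HC' p : - (C * / T) <= / T * Y (T, p) - limit_average Y p <= C * / T.
      have := HC T p Tp. rewrite /time_average /Rdiv (Rmult_comm _ (/ T)). by move=> /Rabs_le_between.
    rewrite -E. apply/Rabs_le_between. split.
    - rewrite -[X in X <= _](torus_integral_const (- (C * / T))). apply: (torus_integral_le _ _ (contin_const _) cm) => p. by case: (HC' p).
    - rewrite -[X in _ <= X](torus_integral_const (C * / T)). apply: (torus_integral_le _ _ cm (contin_const _)) => p. by case: (HC' p).
  have L := is_lim_seq_scal_l _ C _ is_lim_seq_inv_INR1. rewrite /= Rmult_0_r in L.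
  have : Rabs (k - torus_integral (limit_average Y)) <= 0.
    apply: (is_lim_seq_le (fun _ => Rabs (k - torus_integral (limit_average Y))) _ (Rabs (k - torus_integral (limit_average Y))) 0 _ _ L).
    - move=> n. exact: B (INR1_pos n).
    - exact: is_lim_seq_const.
  move=> /Rabs_le_between. lra.
Qed.

End SolLimit.

(** * Helmholtz decomposition *)

Lemma const_line (f : R -> R) x y : (forall x, is_derive f x 0) -> f x = f y.
Proof.
  move=> H. case: (Rtotal_order x y) => [xy|[->//|xy]].
  - exact: (eq_is_derive f x y).
  - symmetry. exact: (eq_is_derive f y x).
Qed.

Lemma step_periodic (h : R -> R) : (forall x, h (x + 1) = h x) -> forall (m : Z) x, h (x + IZR m) = h x.
Proof.
  move=> H. apply: Z.peano_ind => [x|m IH x|m IH x].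
  - by rewrite Rplus_0_r.
  - rewrite succ_IZR -[RHS]IH -[RHS]H. congr h. ring.
  - rewrite -[RHS]IH -[LHS]H /Z.pred plus_IZR. congr h. ring.
Qed.

Section Partials.
Context (f a b : pt -> R).
Context (fx : forall x y, is_derive (fun x => f (x, y)) x (a (x, y))).
Context (fy : forall x y, is_derive (fun y => f (x, y)) y (b (x, y))).

Lemma partials_differentiable : contin a -> forall x y,
  filterdiff (fun u : R * R => f (fst u, snd u)) (locally (x, y))
    (fun u : R * R => fst u * a (x, y) + snd u * b (x, y)).
Proof.
  move=> ca x y.
  apply: (is_derive_filterdiff (fun x y => f (x, y)) x y (fun x y => a (x, y))).
  - apply: filter_forall => -[u v]. exact: fx.
  - exact: fy.
  - apply: (continuous_ext a); [by case | exact: ca].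
Qed.

Lemma partials_is_derive : contin a -> forall (p v : R * R),
  is_derive (fun h : R => f (plus (p : ptN) (scal h (v : ptN)))) 0 (fst v * a p + snd v * b p).
Proof.
  move=> ca [x y] [al be].
  have dg : differentiable_pt_lim (fun x y => f (x, y)) x y (a (x, y)) (b (x, y)).
    apply/filterdiff_differentiable_pt_lim. exact: partials_differentiable.
  have dl (z k : R) : derivable_pt_lim (fun h => z + h * k) 0 k.
    apply/is_derive_Reals. auto_derive => //. ring.
  have := derivable_pt_lim_comp_2d (fun x y => f (x, y)) (fun h => x + h * al) (fun h => y + h * be) 0 (a (x, y)) (b (x, y)) al be.
  rewrite !Rmult_0_l !Rplus_0_r => /(_ dg (dl _ _) (dl _ _)) /is_derive_Reals.
  rewrite (Rmult_comm _ al) (Rmult_comm _ be). done.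
Qed.

(** This serves for a potential, which is known only through its partial derivatives: every
    directional derivative is a combination of [a] and [b], so all orders follow from their
    smoothness. *)
Lemma partials_smooth : smooth_on whole (a : ptN -> R) -> smooth_on whole (b : ptN -> R) ->
  smooth_on whole (f : ptN -> R).
Proof.
  move=> sa sb. have ca := smooth_contin _ sa.
  have cf p : continuous f p.
    case: p => x y.
    have := filterdiff_continuous (K:=R_AbsRing) (U:=ptN) (V:=R_NormedModule) (fun u : R * R => f (fst u, snd u)) (x, y).
    move=> /(_ (ex_intro _ _ (partials_differentiable ca x y))).
    apply: continuous_ext. by case.
  move=> [|n]; split => //.
  move=> v.
  have D x : is_derive (fun h : R => f (plus (x : ptN) (scal h v))) 0 (fst v * a x + snd v * b x) by exact: partials_is_derive.
  split; first by move=> x _; eexists; exact: D.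
  have s : smooth_on whole (fun p : ptN => fst v * a p + snd v * b p).
    apply: smooth_plus; first exact: open_whole.
    - exact: (smooth_scal _ (fst v) _ open_whole).
    - exact: (smooth_scal _ (snd v) _ open_whole).
  apply: Ck_ext (s n); first exact: open_whole.
  move=> x _. symmetry. exact: is_derive_unique.
Qed.

End Partials.

Lemma deriv_x_RInt (b : pt -> R) x y : smooth_on whole (b : ptN -> R) ->
  is_derive (fun x => RInt (fun s => b (x, s)) 0 y) x (RInt (fun s => dirD unit_x b (x, s)) 0 y).
Proof.
  move=> sb. have cb := smooth_contin _ sb. have cbx := smooth_contin _ (smooth_dirD _ unit_x _ sb).
  have D u s : is_derive (fun x => b (x, s)) u (dirD unit_x b (u, s)) by exact: deriv_x.
  rewrite (RInt_ext _ (fun s => Derive (fun x => b (x, s)) x)); last first.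
    move=> s _. symmetry. exact: is_derive_unique.
  apply: (is_derive_RInt_param (fun x s => b (x, s))).
  - apply: filter_forall => u s _. eexists. exact: D.
  - move=> s _. apply: (continuity_2d_pt_ext (fun u v => dirD unit_x b (u, v))).
      move=> u v. symmetry. exact: is_derive_unique.
    have c : continuous (fun z : R * R => dirD unit_x b (fst z, snd z)) (x, s).
      apply: (continuous_ext (dirD unit_x b)); [by case | exact: cbx].
    apply/continuity_2d_pt_filterlim. exact: c.
  - apply: filter_forall => u. apply: ex_RInt_contin => s. exact: slice_y_continuous.
Qed.

Lemma deriv_RInt_bound (g : R -> R) y : (forall y, continuous g y) -> is_derive (fun y => RInt g 0 y) y (g y).
Proof.
  move=> cg. apply: (is_derive_RInt g (fun y => RInt g 0 y) 0 y) => //.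
  apply: filter_forall => z. apply: (RInt_correct (V:=R_CompleteNormedModule)). exact: ex_RInt_contin.
Qed.

(** The potential is the integral of the field from the origin along a horizontal and then a
    vertical segment. Its increments over the two periods are the means of [a] and [b], so it is
    periodic because these vanish. *)
Lemma poincare (a b : pt -> R) : torus_function a -> torus_function b ->
  (forall p, dirD unit_y a p = dirD unit_x b p) -> torus_integral a = 0 -> torus_integral b = 0 ->
  exists f, torus_function f /\ forall p, dirD unit_x f p = a p /\ dirD unit_y f p = b p.
Proof.
  move=> ta tb cf Ia Ib. have [sa pa] := ta. have [sb pb] := tb.
  have ca := torus_function_contin _ ta. have cb := torus_function_contin _ tb.
  pose f (p : pt) := RInt (fun s => a (s, 0)) 0 (fst p) + RInt (fun s => b (fst p, s)) 0 (snd p).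
  have cax s : continuous (fun s => a (s, 0)) s.
    apply: ex_derive_continuous. eexists. exact: deriv_x.
  have fy x y : is_derive (fun y => f (x, y)) y (b (x, y)).
    rewrite -[b (x, y)]Rplus_0_l.
    apply: (is_derive_plus (fun _ => RInt (fun s => a (s, 0)) 0 x) (fun y => RInt (fun s => b (x, s)) 0 y)).
    - exact: is_derive_const.
    - apply: (deriv_RInt_bound (fun s => b (x, s))) => s. exact: slice_y_continuous.
  have fx x y : is_derive (fun x => f (x, y)) x (a (x, y)).
    (* Closedness replaces [dx b] by [dy a] in the vertical integral, which is then
       [a (x, y) - a (x, 0)]. *)
    have -> : a (x, y) = a (x, 0) + RInt (fun s => dirD unit_x b (x, s)) 0 y.
      rewrite (RInt_ext _ (fun s => dirD unit_y a (x, s))); last by move=> s _; rewrite cf.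
      rewrite (RInt_FTC (fun s => a (x, s))); first ring.
      - move=> s. exact: deriv_y.
      - move=> s. apply: slice_y_continuous. apply: torus_function_contin. exact: torus_function_dirD.
    apply: (is_derive_plus (fun x => RInt (fun s => a (s, 0)) 0 x) (fun x => RInt (fun s => b (x, s)) 0 y)).
    - exact: (deriv_RInt_bound (fun s => a (s, 0))).
    - exact: deriv_x_RInt.
  have sf := partials_smooth f a b fx fy sa sb.
  have cfx := smooth_contin _ sf.
  (* For a period [(al, be)] of the field, the increment of [f] has zero gradient; its constancy is
     followed vertically and then horizontally to the origin. *)
  have shift (al be : R) (Pa : forall x y, a (x + al, y + be) = a (x, y)) (Pb : forall x y, b (x + al, y + be) = b (x, y)) :
     forall x y, f (x + al, y + be) - f (x, y) = f (0 + al, 0 + be) - f (0, 0).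
    move=> x y. transitivity (f (x + al, 0 + be) - f (x, 0)).
    - apply: (const_line (fun y => f (x + al, y + be) - f (x, y))) => s.
      have Z : b (x + al, s + be) - b (x, s) = 0 by rewrite Pb; exact: Rminus_diag.
      rewrite -[X in is_derive _ _ X]Z.
      apply: (is_derive_minus (fun y => f (x + al, y + be)) (fun y => f (x, y))) => //.
      rewrite -[b (x + al, s + be)]Rmult_1_l.
      apply: (is_derive_comp (fun y => f (x + al, y)) (fun s => s + be)) => //. auto_derive => //.
    - apply: (const_line (fun x => f (x + al, 0 + be) - f (x, 0))) => s.
      have Z : a (s + al, 0 + be) - a (s, 0) = 0 by rewrite Pa; exact: Rminus_diag.
      rewrite -[X in is_derive _ _ X]Z.
      apply: (is_derive_minus (fun x => f (x + al, 0 + be)) (fun x => f (x, 0))) => //.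
      rewrite -[a (s + al, 0 + be)]Rmult_1_l.
      apply: (is_derive_comp (fun x => f (x, 0 + be)) (fun s => s + al)) => //. auto_derive => //.
  have c1 (c : R) : RInt (fun _ : R => c) 0 1 = c.
    rewrite RInt_const /scal /= /mult /=. ring.
  have stepy x y : f (x, y + 1) = f (x, y).
    have S := shift 0 1 (fun x y => pa 0%Z 1%Z (x, y)) (fun x y => pb 0%Z 1%Z (x, y)).
    have : torus_integral b = f (0 + 0, 0 + 1) - f (0, 0).
      rewrite /torus_integral -[RHS]c1. apply: RInt_ext => u _.
      rewrite (RInt_FTC (fun s => f (u, s))) //; last by move=> s; exact: slice_y_continuous.
      have := S u 0. by rewrite !Rplus_0_l Rplus_0_r.
    have := S x y. rewrite Ib Rplus_0_r. lra.
  have stepx x y : f (x + 1, y) = f (x, y).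
    have S := shift 1 0 (fun x y => pa 1%Z 0%Z (x, y)) (fun x y => pb 1%Z 0%Z (x, y)).
    have : torus_integral a = f (0 + 1, 0 + 0) - f (0, 0).
      have D u : is_derive (fun u => RInt (fun y => f (u, y)) 0 1) u (RInt (fun y => a (u, y)) 0 1).
        have := deriv_inner f u sf. rewrite (RInt_ext _ (fun y => a (u, y))) // => s _.
        rewrite -(is_derive_unique _ _ _ (fx u s)). symmetry. apply: is_derive_unique. exact: deriv_x.
      rewrite /torus_integral (RInt_FTC _ _ _ _ D); last by move=> u; exact: contin_outer.
      have E : RInt (fun y => f (1, y)) 0 1 = RInt (fun y => f (0, y) + (f (0 + 1, 0 + 0) - f (0, 0))) 0 1.
        apply: RInt_ext => s _. have := S 0 s. rewrite !Rplus_0_l Rplus_0_r => L. lra.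
      rewrite E RInt_Rplus; last 1 first.
        by apply: ex_RInt_contin => s; exact: continuous_const.
      - rewrite c1. have alg (u v : R) : u + v - u = v by ring. exact: alg.
      - by apply: ex_RInt_contin => s; exact: slice_y_continuous.
    have := S x y. rewrite Ia Rplus_0_r. lra.
  exists f. split.
  - split=> //. move=> m n [x y]. rewrite /translate /=.
    rewrite (step_periodic (fun x => f (x, y + IZR n)) (fun x => stepx x _)).
    exact: (step_periodic (fun y => f (x, y)) (stepy x)).
  - move=> [x y]. split.
    + rewrite -(is_derive_unique _ _ _ (fx x y)). symmetry. apply: is_derive_unique. exact: deriv_x.
    + rewrite -(is_derive_unique _ _ _ (fy x y)). symmetry. apply: is_derive_unique. exact: deriv_y.
Qed.

(** Gradients and divergence-free fields are orthogonal: the integral of [|w|^2] is minus that of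
    [k div w]. This is the uniqueness in the Helmholtz decomposition. *)
Lemma div_free_gradient_zero (w1 w2 k : pt -> R) :
  torus_function w1 -> torus_function w2 -> torus_function k ->
  (forall p, dirD unit_x w1 p + dirD unit_y w2 p = 0) ->
  (forall p, w1 p = dirD unit_x k p) -> (forall p, w2 p = dirD unit_y k p) ->
  forall p, w1 p = 0 /\ w2 p = 0.
Proof.
  move=> t1 t2 tk dv g1 g2.
  have tx := torus_function_dirD unit_x _ t1. have ty := torus_function_dirD unit_y _ t2.
  have E1 : torus_integral (fun p => w1 p * w1 p) = - torus_integral (fun p => k p * dirD unit_x w1 p).
    rewrite -torus_integral_parts //. apply: torus_integral_ext => p. by rewrite -g1.
  have E2 : torus_integral (fun p => w2 p * w2 p) = - torus_integral (fun p => k p * dirD unit_y w2 p).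
    rewrite -torus_integral_parts //. apply: torus_integral_ext => p. by rewrite -g2.
  have E : torus_integral (fun p => k p * dirD unit_x w1 p) + torus_integral (fun p => k p * dirD unit_y w2 p) = 0.
    rewrite -(torus_integral_plus _ _ (torus_function_contin _ (torus_function_mult _ _ tk tx)) (torus_function_contin _ (torus_function_mult _ _ tk ty))).
    rewrite -[RHS](torus_integral_const 0). apply: torus_integral_ext => p. by rewrite -Rmult_plus_distr_l dv Rmult_0_r.
  have P1 := torus_integral_square_ge0 _ t1. have P2 := torus_integral_square_ge0 _ t2.
  move=> p. split.
  - apply: (torus_integral_square_eq0 w1 (torus_function_contin _ t1)); [by case: t1 | lra].
  - apply: (torus_integral_square_eq0 w2 (torus_function_contin _ t2)); [by case: t2 | lra].
Qed.

Theorem acoustic_growth d c Y1 Y2 : 0 < d -> 0 < c -> Acoustic d c Y1 Y2 ->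
  exists w1 w2 f : pt -> R, torus_function w1 /\ torus_function w2 /\ torus_function f /\
    (forall p, dirD unit_x w1 p + dirD unit_y w2 p = 0) /\
    (forall p, dirD dir_t Y1 (0, p) - w1 p = dirD unit_x f p /\ dirD dir_t Y2 (0, p) - w2 p = dirD unit_y f p) /\
    exists C, forall t p, 0 <= t ->
      Rabs (Y1 (t, p) - t * w1 p) <= C /\ Rabs (Y2 (t, p) - t * w2 p) <= C.
Proof.
  move=> dp cp S. have [s1 s2 p1 p2 z1 z2 _ _] := S.
  have [A1 A2] := acoustic_averages d c dp cp _ _ S.
  have [sw1 sw2] := limit_smooth d c dp cp _ _ S.
  have tw1 : torus_function (limit_average Y1) by split=> //; exact: (limit_periodic d).
  have tw2 : torus_function (limit_average Y2) by split=> //; exact: (limit_periodic d).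
  have H0 : - d < 0 by lra.
  pose a p := dirD dir_t Y1 (0, p). pose b p := dirD dir_t Y2 (0, p).
  have ta : torus_function a by apply: (torus_function_slice d _ 0 _ _ H0); [exact: smooth_dirD | exact: time_periodic_dirD].
  have tb : torus_function b by apply: (torus_function_slice d _ 0 _ _ H0); [exact: smooth_dirD | exact: time_periodic_dirD].
  have [sa _] := ta. have [sb _] := tb.
  have := poincare (fun p => a p - limit_average Y1 p) (fun p => b p - limit_average Y2 p)
     (torus_function_minus _ _ ta tw1) (torus_function_minus _ _ tb tw2).
  move=> [].
  - move=> p. rewrite (dirD_minus whole) // (dirD_minus whole) //.
    have := limit_curl d c dp cp _ _ p S.
    rewrite -(dirD_slice (dirD dir_t Y1) unit_y) -(dirD_slice (dirD dir_t Y2) unit_x).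
    have alg (u v x y : R) : x - y = u - v -> u - x = v - y by lra.
    exact: alg.
  - rewrite (torus_integral_minus _ _ (torus_function_contin _ ta) (torus_function_contin _ tw1)).
    rewrite (limit_mean d dp Y1 (torus_integral a) s1 A1 z1); first exact: Rminus_diag.
    move=> t Ht. by case: (acoustic_mean d c dp _ _ t S Ht).
  - rewrite (torus_integral_minus _ _ (torus_function_contin _ tb) (torus_function_contin _ tw2)).
    rewrite (limit_mean d dp Y2 (torus_integral b) s2 A2 z2); first exact: Rminus_diag.
    move=> t Ht. by case: (acoustic_mean d c dp _ _ t S Ht).
  move=> f [tf gf].
  have [C1 HC1] := average_bound Y1 A1 z1. have [C2 HC2] := average_bound Y2 A2 z2.
  exists (limit_average Y1), (limit_average Y2), f.
  split=> //. split=> //. split=> //. split; first by move=> p; exact: (limit_div_free d c).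
  split; first by move=> p; case: (gf p) => -> ->.
  exists (Rmax C1 C2) => t p Ht. split.
  - apply: Rle_trans (HC1 t p Ht) _. exact: Rmax_l.
  - apply: Rle_trans (HC2 t p Ht) _. exact: Rmax_r.
Qed.

(** * Second variation of the action *)

(** The coefficient of the variation of the Jacobian is [(lam r - r * lam' r) * f ^ 2]; it is
    the pressure by the barotropic condition [f = r / lam r]. *)
Lemma lagrangian_deriv (lam : R -> R) (a b c d a' b' c' d' v1 v2 u1 u2 f : R) :
  let J h := (a + h * a') * (d + h * d') - (b + h * b') * (c + h * c') in
  let r := / (a * d - b * c) in
  0 < a * d - b * c -> ex_derive lam r -> 0 < lam r -> f = r / lam r ->
  is_derive (fun h => (lam (/ J h) * (f * f) +
      / J h * ((v1 + h * u1) * (v1 + h * u1) + (v2 + h * u2) * (v2 + h * u2))) * J h) 0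
    (2 * (pressure lam r * (a * d' + a' * d - b * c' - b' * c)) + 2 * (v1 * u1 + v2 * u2)).
Proof.
  move=> J r J0 el lp Ef. rewrite /J.
  auto_derive; rewrite !Rmult_0_l !Rplus_0_r.
  - repeat split; try lra. exact: el.
  - rewrite -/r Ef /pressure /phi. change (Derive (fun x => lam x)) with (Derive lam).
    have rE : / r = a * d - b * c by rewrite /r Rinv_inv.
    have rp : 0 < r by exact: Rinv_0_lt_compat.
    have -> : a * d + - (b * c) = / r by rewrite rE; ring.
    set l' := Derive lam r. set l := lam r in lp *. clearbody l l' r. field. lra.
Qed.

(** At [s = 0] the Jacobian matrix is the identity. *)
Lemma lagrangian_deriv2 (P a b c d v1 v2 : R -> R) (a' b' c' d' u1 u2 da db dc dd dv1 dv2 : R) :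
  ex_derive P 1 -> is_derive a 0 da -> is_derive b 0 db -> is_derive c 0 dc -> is_derive d 0 dd ->
  is_derive v1 0 dv1 -> is_derive v2 0 dv2 -> a 0 = 1 -> b 0 = 0 -> c 0 = 0 -> d 0 = 1 ->
  is_derive (fun s => 2 * (P (/ (a s * d s - b s * c s)) * (a s * d' + a' * d s - b s * c' - b' * c s))
      + 2 * (v1 s * u1 + v2 s * u2)) 0
    (2 * (P 1 * (da * d' + a' * dd - db * c' - b' * dc) - Derive P 1 * ((da + dd) * (a' + d')))
      + 2 * (dv1 * u1 + dv2 * u2)).
Proof.
  move=> eP Ha Hb Hc Hd Hv1 Hv2 a0 b0 c0 d0.
  have E f l : is_derive f 0 l -> Derive (fun x => f x) 0 = l by exact: is_derive_unique.
  have X (f : R -> R) l : is_derive f 0 l -> ex_derive (fun x => f x) 0 by move=> H; exists l.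
  have D1 : / (a 0 * d 0 + - (b 0 * c 0)) = 1 by rewrite a0 b0 c0 d0; field.
  auto_derive.
  - rewrite D1 a0 b0 c0 d0. repeat split; try lra; try exact: eP; try (by apply: X; eassumption).
  - rewrite D1 (E _ _ Ha) (E _ _ Hb) (E _ _ Hc) (E _ _ Hd) (E _ _ Hv1) (E _ _ Hv2) a0 b0 c0 d0.
    change (Derive (fun x => P x) 1) with (Derive P 1). field.
Qed.

(** The fundamental lemma of the calculus of variations, with parabolas as test functions. They
    vanish at the ends of the interval, as fixed end points demand, and the interval can shrink to
    any point where [r] has a sign. *)
Lemma bump_integral_zero (r : R -> R) (d : R) :
  (forall t, - d < t -> continuous r t) ->
  (forall t0 t1, - d < t0 -> t0 < t1 -> RInt (fun t => (t - t0) * (t1 - t) * r t) t0 t1 = 0) ->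
  forall t, - d < t -> r t = 0.
Proof.
  have pos (g : R -> R) t : (forall t, - d < t -> continuous g t) ->
    (forall t0 t1, - d < t0 -> t0 < t1 -> RInt (fun t => (t - t0) * (t1 - t) * g t) t0 t1 = 0) ->
    - d < t -> g t <= 0.
    move=> cg H Ht. apply: Rnot_lt_le => gp.
    have /filterlim_locally /(_ (mkposreal _ gp)) [e He] := cg t Ht.
    (* Half the minimum keeps [[t - h, t + h]] inside the ball of radius [e] and to the right of
       [- d]. *)
    set h := Rmin e (t + d) / 2.
    have ep := cond_pos e.
    have h0 : 0 < h by rewrite /h /Rmin; case: Rle_dec; lra.
    have h1 : h < e by rewrite /h /Rmin; case: Rle_dec; lra.
    have h2 : h < t + d by rewrite /h /Rmin; case: Rle_dec; lra.
    have gpos x : t - h <= x <= t + h -> 0 < g x.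
      move=> Hx. have Hb : ball t e x by apply: Rabs_def1; rewrite /minus /plus /opp /=; lra.
      have := He x Hb. rewrite /ball /= /AbsRing_ball /= /abs /minus /plus /opp /=.
      move=> /Rabs_def2. lra.
    have := H (t - h) (t + h). move=> /(_ _ _) I.
    have : 0 < RInt (fun x => (x - (t - h)) * (t + h - x) * g x) (t - h) (t + h).
      apply: RInt_gt_0; first lra.
      - move=> x Hx. apply: Rmult_lt_0_compat; first nra. apply: gpos. lra.
      - move=> x Hx. apply: (continuous_mult (fun x => (x - (t - h)) * (t + h - x)) g).
        + apply: ex_derive_continuous. by auto_derive.
        + apply: cg. lra.
    rewrite I; lra.
  move=> cr H t Ht.
  have L := pos r t cr H Ht.
  have := pos (fun x => - r x) t. move=> /(_ _ _ Ht) G.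
  have : - r t <= 0.
    apply: G.
    - move=> x Hx. apply: (continuous_opp r). exact: cr.
    - move=> t0 t1 H0 H1.
      have alg (u v : R) : u * - v = (-1) * (u * v) by ring.
      rewrite (RInt_ext _ (fun x => (-1) * ((x - t0) * (t1 - x) * r x))); last by move=> x _; exact: alg.
      rewrite RInt_Rmult; first by rewrite H // Rmult_0_r.
      apply: (ex_RInt_continuous (V:=R_CompleteNormedModule)) => x Hx. rewrite Rmin_left in Hx; last lra.
      apply: (continuous_mult (fun x => (x - t0) * (t1 - x)) r).
      + apply: ex_derive_continuous. by auto_derive.
      + apply: cr. lra.
  lra.
Qed.

(** * Integrals over time and the torus *)

Section Triple.
Context (V : NormedModule R_AbsRing) (t0 t1 : R) (Ht : t0 <= t1).
Local Notation VR := (prod_NormedModule R_AbsRing V R_NormedModule).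
Local Notation VRP := (prod_NormedModule R_AbsRing VR ptN).

(** The parameters over which the whole domain of integration lies in [W]; for open [W] this is an
    open condition by compactness. *)
Definition box (W : VRP -> Prop) (v : V) : Prop :=
  forall t, t0 <= t <= t1 -> forall x, 0 <= x <= 1 -> forall y, 0 <= y <= 1 -> W ((v, t), (x, y)).

Definition triple (f : VRP -> R) (v : V) : R :=
  RInt (fun t => torus_integral (fun p => f ((v, t), p))) t0 t1.

Lemma open_box W : open W -> open (box W).
Proof. move=> oW. exact: (open_tube _ t0 t1 (open_torus_box (V:=VR) W oW)). Qed.

Lemma dirD_triple W f (v x : V) : open W -> smooth_on W f -> box W x ->
  dirD v (triple f) x = triple (dirD ((((v, 0) : VR), zero) : VRP) f) x.
Proof.
  move=> oW sf Wx.
  rewrite /triple (dirD_RInt (V:=V) _ (fun z : VR => torus_integral (fun p => f (z, p))) v x t0 t1 Ht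
    (open_torus_box (V:=VR) W oW) (smooth_torus_integral (V:=VR) W f oW sf) Wx).
  apply: RInt_ext => t. rewrite Rmin_left // Rmax_right // => Htt.
  have Htt' : t0 <= t <= t1 by lra.
  exact: (dirD_torus_integral (V:=VR) W f (v, 0) (x, t) oW sf (Wx t Htt')).
Qed.

Lemma dirD2_triple W f (v w x : V) : open W -> smooth_on W f -> box W x ->
  dirD v (dirD w (triple f)) x =
  triple (dirD ((((v, 0) : VR), zero) : VRP) (dirD ((((w, 0) : VR), zero) : VRP) f)) x.
Proof.
  move=> oW sf Wx. have oB := open_box W oW.
  rewrite -(dirD_triple W _ v x oW (smooth_dirD _ _ _ sf) Wx).
  apply: (dirD_ext_loc (box W)) => // y Wy. exact: (dirD_triple W).
Qed.

End Triple.

Local Notation ST := (prod_NormedModule R_AbsRing R_NormedModule R_NormedModule).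
Local Notation STP := (prod_NormedModule R_AbsRing ST ptN).
Local Notation SET := (prod_NormedModule R_AbsRing ST R_NormedModule).
Local Notation SETP := (prod_NormedModule R_AbsRing SET ptN).
Local Notation par_s := (((1, 0), (0, 0)) : STP).
Local Notation par_t := (((0, 1), (0, 0)) : STP).
Local Notation par_x := (((0, 0), (1, 0)) : STP).
Local Notation par_y := (((0, 0), (0, 1)) : STP).

Lemma R_line0 (x : R) (h : R) : @plus R_NormedModule x (scal h 0) = x.
Proof. rewrite /plus /scal /= /mult /=. by rewrite Rmult_0_r Rplus_0_r. Qed.

Lemma R_line1 (x : R) (h : R) : @plus R_NormedModule x (scal h 1) = x + h.
Proof. rewrite /plus /scal /= /mult /=. by rewrite Rmult_1_r. Qed.

Lemma pt_line0 (p : ptN) (h : R) : plus p (scal h ((0, 0) : ptN)) = p.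
Proof. case: p => x y. by rewrite prod_line !R_line0. Qed.

Lemma s_line (s t h : R) (p : ptN) : plus (((s, t), p) : STP) (scal h par_s) = ((s + h, t), p).
Proof. by rewrite !prod_line R_line1 R_line0 pt_line0. Qed.

Lemma t_line (s t h : R) (p : ptN) : plus (((s, t), p) : STP) (scal h par_t) = ((s, t + h), p).
Proof. by rewrite !prod_line R_line1 R_line0 pt_line0. Qed.

Lemma dirD_space (f : STP -> R) (v : ptN) s t p :
  dirD v (fun p => f ((s, t), p)) p = dirD (((0, 0), v) : STP) f ((s, t), p).
Proof. apply Derive_ext => h. by rewrite !prod_line !R_line0. Qed.

Definition SE_s (z : SETP) : R := fst (fst (fst z)).
Definition SE_e (z : SETP) : R := snd (fst (fst z)).
Definition SE_t (z : SETP) : R := snd (fst z).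
(** A point of [SETP] is [(((s, eps), t), p)], where [eps] is the parameter of the test
    variation. *)
Definition drop_e (z : SETP) : STP := ((SE_s z, SE_t z), snd z).

Lemma drop_e_continuous z : continuous drop_e z.
Proof. case: z => [[[s e] t] p] P [d Hd]. exists d => -[[[s' e'] t'] p'] [[[/= H1 H2] H3] H4]. by apply: Hd. Qed.

Lemma SE_e_continuous z : continuous SE_e z.
Proof. case: z => [[[s e] t] p] P [d Hd]. exists d => -[[[s' e'] t'] p'] [[[/= H1 H2] H3] H4]. by apply: Hd. Qed.

Lemma SE_t_continuous z : continuous SE_t z.
Proof. case: z => [[[s e] t] p] P [d Hd]. exists d => -[[[s' e'] t'] p'] [[[/= H1 H2] H3] H4]. by apply: Hd. Qed.

Lemma snd_continuous {U V : UniformSpace} (z : U * V) : continuous snd z.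
Proof. case: z => u v. exact: continuous_snd. Qed.

(** * Test perturbations of a family of barotropic geodesics *)

Section Variation.
Context (lam : R -> R) (D : R -> R -> Prop) (eta : R -> R -> pt -> pt) (F : R -> R -> pt -> R).
Context (lam_smooth : smooth_on (fun r : R => 0 < r) lam) (lam_pos : forall r, 0 < r -> 0 < lam r).
Context (variation : barotropic_variation lam D eta F).

Definition dom (z : STP) : Prop := D (fst (fst z)) (snd (fst z)).
Definition eta1 (z : STP) : R := fst (eta (fst (fst z)) (snd (fst z)) (snd z)).
Definition eta2 (z : STP) : R := snd (eta (fst (fst z)) (snd (fst z)) (snd z)).
Definition eta0 (z : STP) : R := F (fst (fst z)) (snd (fst z)) (snd z).

Lemma open_dom : open dom.
Proof.
  have [oD _] := variation.
  apply: (open_pre fst (fun z : R * R => D (fst z) (snd z))) => //. case=> *. exact: continuous_fst.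
Qed.

Lemma eta1_smooth : smooth_on dom eta1.
Proof. by have [_ [_ [[_ [[H _] _]] _]]] := variation. Qed.

Lemma eta2_smooth : smooth_on dom eta2.
Proof. by have [_ [_ [[_ [[_ H] _]] _]]] := variation. Qed.

Lemma eta0_smooth : smooth_on dom eta0.
Proof. by have [_ [_ [[_ [_ H]] _]]] := variation. Qed.

Lemma space_smooth f s t : smooth_on dom f -> D s t -> smooth_on whole (fun p : ptN => f ((s, t), p)).
Proof.
  move=> sf Dst. apply: (smooth_affine (V:=STP) (W:=ptN) dom whole (fun p => ((s, t), p)) (fun v => ((0, 0), v))) => //.
  - exact: open_whole.
  - move=> x v h. by rewrite !prod_line !R_line0.
  - move=> x. exact: continuous_pair_l.
Qed.

Lemma deriv_time f s t p : smooth_on dom f -> D s t ->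
  is_derive (fun r => f ((s, r), p)) t (dirD par_t f ((s, t), p)).
Proof.
  move=> sf Dst. have := smooth_is_derive dom f ((s, 0), p) par_t t sf.
  rewrite t_line Rplus_0_l => /(_ Dst). apply: is_derive_ext => k. by rewrite t_line Rplus_0_l.
Qed.

Lemma deriv_param f t p : smooth_on dom f -> D 0 t ->
  is_derive (fun s => f ((s, t), p)) 0 (dirD par_s f ((0, t), p)).
Proof.
  move=> sf Dst. have := smooth_is_derive0 dom f ((0, t), p) par_s sf Dst.
  apply: is_derive_ext => k. by rewrite s_line Rplus_0_l.
Qed.

Section Test.
Context (t0 t1 : R) (q1 q2 : pt -> R) (Ht : t0 < t1).
Context (tq1 : torus_function q1) (tq2 : torus_function q2).

Definition bump t := (t - t0) * (t1 - t).
Definition dbump t := t0 + t1 - 2 * t.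

(** Every first derivative of the perturbed map has this form: [f] is a derivative of a component of
    [eta], [g] is the bump or its time derivative, and [q] is a test function or one of its space
    derivatives. *)
Definition perturbed (f : STP -> R) (g : R -> R) (q : pt -> R) (z : SETP) : R :=
  f (drop_e z) + SE_e z * (g (SE_t z) * q (snd z)).

Definition perturbed_jacobian : SETP -> R := fun z =>
  perturbed (dirD par_x eta1) bump (dirD unit_x q1) z * perturbed (dirD par_y eta2) bump (dirD unit_y q2) z
  - perturbed (dirD par_y eta1) bump (dirD unit_y q1) z * perturbed (dirD par_x eta2) bump (dirD unit_x q2) z.

(** The integrand of twice the energy as a function of [s], [eps], time and position. Only [eta] is
    perturbed by [eps]; the component [F] keeps its rate. *)
Definition lagrangian (z : SETP) : R :=
  (lam (/ perturbed_jacobian z) * (dirD par_t eta0 (drop_e z) * dirD par_t eta0 (drop_e z))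
   + / perturbed_jacobian z * (perturbed (dirD par_t eta1) dbump q1 z * perturbed (dirD par_t eta1) dbump q1 z
             + perturbed (dirD par_t eta2) dbump q2 z * perturbed (dirD par_t eta2) dbump q2 z)) * perturbed_jacobian z.

Definition domE (z : SETP) : Prop := dom (drop_e z).
(** Where the Jacobian is positive so is the density, and [lam] is smooth there. Being open, the
    condition persists for small [s] and [eps]. *)
Definition regular (z : SETP) : Prop := domE z /\ 0 < perturbed_jacobian z.

Lemma open_domE : open domE.
Proof. exact: (open_pre drop_e dom drop_e_continuous open_dom). Qed.

Lemma drop_smooth f : smooth_on dom f -> smooth_on domE (fun z => f (drop_e z)).
Proof.
  move=> sf. apply: (smooth_affine (V:=STP) (W:=SETP) dom domE drop_e drop_e) => //.
  - exact: open_domE.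
  - exact: drop_e_continuous.
Qed.

Lemma coord_e_smooth (U : SETP -> Prop) : open U -> smooth_on U SE_e.
Proof.
  move=> oU. apply: (smooth_coord U SE_e SE_e) => //.
  exact: SE_e_continuous.
Qed.

Lemma coord_t_smooth (U : SETP -> Prop) : open U -> smooth_on U SE_t.
Proof.
  move=> oU. apply: (smooth_coord U SE_t SE_t) => //.
  exact: SE_t_continuous.
Qed.

Lemma space_lift_smooth {X : NormedModule R_AbsRing} (U : X * ptN -> Prop) (q : pt -> R) : torus_function q -> open U ->
  @smooth_on (prod_NormedModule R_AbsRing X ptN) U (fun z => q (snd z)).
Proof.
  move=> [sq _] oU.
  apply: (smooth_affine (V:=ptN) (W:=prod_NormedModule R_AbsRing X ptN) whole U snd snd) => // z.
  exact: snd_continuous.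
Qed.

Lemma perturbed_smooth f (g : R -> R) q : smooth_on dom f -> smooth_on domE (fun z => g (SE_t z)) -> torus_function q ->
  smooth_on domE (perturbed f g q).
Proof.
  move=> sf sg tq. have o := open_domE.
  apply: smooth_plus => //; first exact: drop_smooth.
  apply: smooth_mult => //; first exact: coord_e_smooth.
  apply: smooth_mult => //. exact: space_lift_smooth.
Qed.

Lemma bump_smooth : smooth_on domE (fun z => bump (SE_t z)).
Proof.
  have o := open_domE. have s := coord_t_smooth _ o. have c k := smooth_const domE k o.
  apply: smooth_mult => //; exact: smooth_minus.
Qed.

Lemma dbump_smooth : smooth_on domE (fun z => dbump (SE_t z)).
Proof.
  have o := open_domE. have s := coord_t_smooth _ o. have c k := smooth_const domE k o.
  apply: smooth_minus => //. exact: smooth_scal.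
Qed.

Lemma perturbed_jacobian_smooth : smooth_on domE perturbed_jacobian.
Proof.
  have o := open_domE. have st := bump_smooth.
  have e1 := eta1_smooth. have e2 := eta2_smooth.
  apply: (smooth_minus domE) => //; apply: (smooth_mult domE) => //; apply: perturbed_smooth => //; first
    [exact: smooth_dirD | exact: torus_function_dirD].
Qed.

Lemma open_regular : open regular.
Proof.
  move=> z [Dz Jp]. apply: filter_and; first exact: (open_domE z Dz).
  apply: (smooth_cont domE perturbed_jacobian z perturbed_jacobian_smooth Dz). exact: (open_gt 0).
Qed.

Lemma lagrangian_smooth : smooth_on regular lagrangian.
Proof.
  have o := open_regular.
  have sub f : smooth_on domE f -> smooth_on regular f by apply: smooth_subset => z [].
  have sJ := sub _ perturbed_jacobian_smooth.
  have sJi : smooth_on regular (fun z => / perturbed_jacobian z) by apply: smooth_inv => // z [].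
  have sl : smooth_on regular (fun z => lam (/ perturbed_jacobian z)).
    apply: (smooth_comp regular (fun r : R => 0 < r) lam) => // z [_ Jp]. exact: Rinv_0_lt_compat.
  have s0 : smooth_on regular (fun z => dirD par_t eta0 (drop_e z)).
    apply: sub. apply: drop_smooth. apply: smooth_dirD. exact: eta0_smooth.
  have s1 : smooth_on regular (perturbed (dirD par_t eta1) dbump q1).
    apply: sub. apply: perturbed_smooth => //; [apply: smooth_dirD; exact: eta1_smooth | exact: dbump_smooth].
  have s2 : smooth_on regular (perturbed (dirD par_t eta2) dbump q2).
    apply: sub. apply: perturbed_smooth => //; [apply: smooth_dirD; exact: eta2_smooth | exact: dbump_smooth].
  apply: smooth_mult => //. apply: smooth_plus => //; apply: smooth_mult => //.
  - exact: smooth_mult.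
  - apply: smooth_plus => //; exact: smooth_mult.
Qed.

Definition pushed s (eps t : R) (p : pt) : pt :=
  (eta1 ((s, t), p) + eps * (bump t * q1 p), eta2 ((s, t), p) + eps * (bump t * q2 p)).

Lemma dirD_pushed f q s eps t (v : ptN) p : smooth_on dom f -> D s t -> torus_function q ->
  dirD v (fun p => f ((s, t), p) + eps * (bump t * q p)) p =
  perturbed (dirD (((0, 0), v) : STP) f) bump (dirD v q) (((s, eps), t), p).
Proof.
  move=> sf Dst tq. have [sq _] := tq.
  rewrite (dirD_plus whole v (fun p : ptN => f ((s, t), p)) (fun p : ptN => eps * (bump t * q p))) //.
  - by rewrite dirD_space !dirD_scal.
  - exact: space_smooth.
  - by do 2 apply: (smooth_scal _ _ _ open_whole).
Qed.

Lemma jac_pushed s eps t p : D s t -> jac (pushed s eps t) p = perturbed_jacobian (((s, eps), t), p).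
Proof.
  move=> Dst. have e1 := eta1_smooth. have e2 := eta2_smooth.
  rewrite /jac !d_x_dirD !d_y_dirD /pushed /=.
  by rewrite !dirD_pushed.
Qed.

Lemma velocity_pushed s eps t p : D s t -> velocity (pushed s eps) t p =
  (perturbed (dirD par_t eta1) dbump q1 (((s, eps), t), p), perturbed (dirD par_t eta2) dbump q2 (((s, eps), t), p)).
Proof.
  move=> Dst.
  have gen f q : smooth_on dom f -> Derive (fun r => f ((s, r), p) + eps * (bump r * q p)) t =
     perturbed (dirD par_t f) dbump q (((s, eps), t), p).
    move=> sf. apply: is_derive_unique.
    apply: (is_derive_plus (fun r => f ((s, r), p)) (fun r => eps * (bump r * q p))).
    - exact: deriv_time.
    - rewrite /bump /dbump /SE_t /SE_e /=. auto_derive => //. ring.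
  by rewrite /velocity /pushed /= !gen //; [exact: eta2_smooth | exact: eta1_smooth].
Qed.

Lemma energy_pushed s eps : (forall t, t0 <= t <= t1 -> D s t) ->
  energy lam (pushed s eps) (fun t p => F s t p) t0 t1 = / 2 * triple ST t0 t1 lagrangian (s, eps).
Proof.
  move=> HD. rewrite /energy /triple. apply: (f_equal (Rmult (/ 2))). apply: RInt_ext => t.
  rewrite Rmin_left ?Rmax_right; try lra. move=> Htt.
  have Dst : D s t by apply: HD; lra.
  rewrite /metric. apply: torus_integral_ext => p.
  rewrite /density_at jac_pushed // velocity_pushed //.
  have -> : velocityF (fun t p => F s t p) t p = dirD par_t eta0 (drop_e (((s, eps), t), p)).
    apply: is_derive_unique. exact: (deriv_time eta0 s t p eta0_smooth Dst).
  by [].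
Qed.

Lemma box_dom s eps : box ST t0 t1 regular (s, eps) -> forall t, t0 <= t <= t1 -> D s t.
Proof.
  move=> B t Htt. have Z : 0 <= 0 <= 1 by lra.
  by case: (B t Htt 0 Z 0 Z).
Qed.

(** Each [eta s] is itself a geodesic, so criticality holds for every [s] whose time domain contains
    [[t0, t1]]. The bump makes the perturbation vanish at both ends. *)
Lemma critical s : (forall t, t0 <= t <= t1 -> D s t) ->
  is_derive (fun eps => energy lam (pushed s eps) (fun t p => F s t p) t0 t1) 0 0.
Proof.
  move=> HD. have [oD [_ [[tor _] [geo _]]]] := variation.
  have [[_ [_ crit]] _] := geo s.
  (* The range 1 of [eps] is arbitrary: [geodesic] admits every smooth family with fixed ends,
     whether or not its maps are diffeomorphisms. *)
  apply: (crit t0 t1 Ht HD 1 (pushed s) (fun _ t p => F s t p)); first lra.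
  (* In this block the first coordinate of [STP] stands for [eps]; the parameter [s] of the family
     is frozen by [L]. *)
  - pose W : STP -> Prop := fun z => - 1 < fst (fst z) < 1 /\ D s (snd (fst z)).
    pose L (z : STP) : STP := ((s, snd (fst z)), snd z).
    have cL z : continuous L z.
      case: z => [[e t] p] P [r Hr]. exists r => -[[e' t'] p'] [[/= H1 H2] H3]. apply: Hr.
      split=> //. split=> //. exact: ball_center.
    have ce (z : STP) : continuous (fun z : STP => fst (fst z)) z.
      case: z => [[e t] p] P [r Hr]. exists r => -[[e' t'] p'] [[/= H1 H2] H3]. by apply: Hr.
    have ct (z : STP) : continuous (fun z : STP => snd (fst z)) z.
      case: z => [[e t] p] P [r Hr]. exists r => -[[e' t'] p'] [[/= H1 H2] H3]. by apply: Hr.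
    have oW : open W.
      apply: open_and.
      + apply: (open_pre (fun z : STP => fst (fst z)) (fun x => - 1 < x < 1)) => //.
        apply: open_and; [exact: open_gt | exact: open_lt].
      + exact: (open_pre L dom cL open_dom).
    have sL f : smooth_on dom f -> smooth_on W (fun z => f (L z)).
      move=> sf. apply: (smooth_affine (V:=STP) (W:=STP) dom W L (fun v => ((0, snd (fst v)), snd v))) => //.
      + move=> x v h. rewrite /L. case: x => [[a b] p]. case: v => [[a' b'] v]. by rewrite !prod_line R_line0.
      + by move=> x [].
    have sE : smooth_on W (fun z => fst (fst z)) by apply: (smooth_coord W _ (fun z => fst (fst z))).
    have sT : smooth_on W (fun z => snd (fst z)) by apply: (smooth_coord W _ (fun z => snd (fst z))).
    have sH f q : smooth_on dom f -> torus_function q ->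
       smooth_on W (fun z => f (L z) + fst (fst z) * (bump (snd (fst z)) * q (snd z))).
      move=> sf tq. apply: smooth_plus => //; first exact: sL. apply: smooth_mult => //.
      apply: smooth_mult => //; last exact: space_lift_smooth.
      have c k := smooth_const W k oW.
      apply: smooth_mult => //; exact: smooth_minus.
    split; [|split].
    + move=> e t [_ Dst]. have [te tF] := tor s t Dst. split=> // m n p.
      rewrite /pushed /eta1 /eta2 /= te. case: tq1 => _ ->. case: tq2 => _ ->.
      rewrite /translate /=. congr pair; ring.
    + split; [exact: (sH _ _ eta1_smooth tq1) | exact: (sH _ _ eta2_smooth tq2)].
    + exact: (sL _ eta0_smooth).
  - move=> t p Dst. split=> //. rewrite /pushed /eta1 /eta2 /= !Rmult_0_l !Rplus_0_r. by case: (eta s t p).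
  - move=> e t p _ Hend. split=> //. rewrite /pushed /eta1 /eta2 /bump /=.
    have -> : (t - t0) * (t1 - t) = 0 by case: Hend => ->; ring.
    rewrite !Rmult_0_l !Rmult_0_r !Rplus_0_r. by case: (eta s t p).
Qed.

Local Notation var_e := ((((((0, 1) : ST), 0) : SET), zero) : SETP).
Local Notation var_s := ((((((1, 0) : ST), 0) : SET), zero) : SETP).

Lemma E_line s e t p h : plus ((((s, e), t), p) : SETP) (scal h var_e) = (((s, e + h), t), p).
Proof. by rewrite !prod_line R_line1 !R_line0 pt_line0. Qed.

Lemma S_line s e t p h : plus ((((s, e), t), p) : SETP) (scal h var_s) = (((s + h, e), t), p).
Proof. by rewrite !prod_line R_line1 !R_line0 pt_line0. Qed.

Lemma perturbed_0 f g q s t p : perturbed f g q (((s, 0), t), p) = f ((s, t), p).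
Proof. by rewrite /perturbed /SE_e /= Rmult_0_l Rplus_0_r. Qed.

Definition jacobian (z : STP) : R := dirD par_x eta1 z * dirD par_y eta2 z - dirD par_y eta1 z * dirD par_x eta2 z.

Lemma perturbed_jacobian_0 s t p : perturbed_jacobian (((s, 0), t), p) = jacobian ((s, t), p).
Proof. by rewrite /perturbed_jacobian !perturbed_0. Qed.

(** The barotropic condition enters here: it expresses [F_t] through the Jacobian, so that the first
    variation becomes an expression in [eta] alone. *)
Lemma barotropic_rate s t p : D s t -> dirD par_t eta0 ((s, t), p) = / jacobian ((s, t), p) / lam (/ jacobian ((s, t), p)).
Proof.
  move=> Dst. have [_ [_ [_ [geo _]]]] := variation. have [_ /(_ t p Dst) H] := geo s.
  have J : density_at (eta s t) p = / jacobian ((s, t), p).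
    rewrite /density_at /jacobian /jac !d_x_dirD !d_y_dirD. by rewrite -!dirD_space.
  rewrite J in H.
  have := deriv_time eta0 s t p eta0_smooth Dst. rewrite -(is_derive_unique _ _ _ H).
  by move/is_derive_unique => <-.
Qed.

(** Twice the pressure times the variation of the Jacobian determinant, plus twice the velocity
    paired with its variation. *)
Definition first_var (z : STP) : R :=
  2 * (pressure lam (/ jacobian z) *
     (dirD par_x eta1 z * (bump (snd (fst z)) * dirD unit_y q2 (snd z)) + bump (snd (fst z)) * dirD unit_x q1 (snd z) * dirD par_y eta2 z
      - dirD par_y eta1 z * (bump (snd (fst z)) * dirD unit_x q2 (snd z)) - bump (snd (fst z)) * dirD unit_y q1 (snd z) * dirD par_x eta2 z))
  + 2 * (dirD par_t eta1 z * (dbump (snd (fst z)) * q1 (snd z)) + dirD par_t eta2 z * (dbump (snd (fst z)) * q2 (snd z))).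

Lemma lam_ex_derive r : 0 < r -> ex_derive lam r.
Proof. move=> rp. eexists. exact: (smooth1_is_derive _ lam r lam_smooth rp). Qed.

Lemma first_variation s t p : regular (((s, 0), t), p) -> dirD var_e lagrangian (((s, 0), t), p) = first_var ((s, t), p).
Proof.
  move=> [Dst Jp]. rewrite perturbed_jacobian_0 in Jp.
  have rp := Rinv_0_lt_compat _ Jp.
  have H := lagrangian_deriv lam _ _ _ _ (bump t * dirD unit_x q1 p) (bump t * dirD unit_y q1 p) (bump t * dirD unit_x q2 p) (bump t * dirD unit_y q2 p)
    (dirD par_t eta1 ((s, t), p)) (dirD par_t eta2 ((s, t), p)) (dbump t * q1 p) (dbump t * q2 p) _ Jp
    (lam_ex_derive _ rp) (lam_pos _ rp) (barotropic_rate s t p Dst).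
  have L := smooth_is_derive0 regular lagrangian (((s, 0), t), p) var_e lagrangian_smooth.
  have R0 : regular (((s, 0), t), p) by split; [exact: Dst | rewrite perturbed_jacobian_0].
  rewrite -(is_derive_unique _ _ _ (L R0)). apply: is_derive_unique.
  apply: is_derive_ext H => h. by rewrite E_line Rplus_0_l.
Qed.

Lemma pressure_ex_derive r : 0 < r -> ex_derive (pressure lam) r.
Proof.
  move=> rp.
  have sD : @smooth_on R_NormedModule (fun r : R => 0 < r) (Derive lam).
    apply: (smooth_ext _ (dirD (1 : R_NormedModule) lam)); first exact: open_gt.
    - move=> x Hx. symmetry. apply: is_derive_unique. exact: (smooth1_is_derive _ lam x lam_smooth Hx).
    - exact: smooth_dirD.
  have e2 : ex_derive (Derive lam) r by eexists; exact: (smooth1_is_derive _ _ r sD rp).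
  have e1 := lam_ex_derive r rp. have lp := lam_pos r rp.
  rewrite /pressure /phi. move: e2. generalize (Derive lam). move=> g e2.
  auto_derive. repeat split => //. have := Rmult_lt_0_compat _ _ lp lp. lra.
Qed.

Section Base.
Context (D0 : forall t, t0 <= t <= t1 -> D 0 t).
Context (base : forall t p, t0 <= t <= t1 -> dirD par_x eta1 ((0, t), p) = 1 /\ dirD par_y eta1 ((0, t), p) = 0
   /\ dirD par_x eta2 ((0, t), p) = 0 /\ dirD par_y eta2 ((0, t), p) = 1).

Lemma regular_base t p : t0 <= t <= t1 -> regular (((0, 0), t), p).
Proof.
  move=> Htt. split; first exact: D0. rewrite perturbed_jacobian_0 /jacobian. have [-> [-> [-> ->]]] := base t p Htt. lra.
Qed.

Lemma box_base : box ST t0 t1 regular (0, 0).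
Proof. move=> t Htt x _ y _. exact: regular_base. Qed.

Definition second_var (t : R) (p : pt) : R :=
  2 * (pressure lam 1 *
     (dirD par_s (dirD par_x eta1) ((0, t), p) * (bump t * dirD unit_y q2 p) + bump t * dirD unit_x q1 p * dirD par_s (dirD par_y eta2) ((0, t), p)
      - dirD par_s (dirD par_y eta1) ((0, t), p) * (bump t * dirD unit_x q2 p) - bump t * dirD unit_y q1 p * dirD par_s (dirD par_x eta2) ((0, t), p))
    - Derive (pressure lam) 1 * ((dirD par_s (dirD par_x eta1) ((0, t), p) + dirD par_s (dirD par_y eta2) ((0, t), p)) *
        (bump t * dirD unit_x q1 p + bump t * dirD unit_y q2 p)))
  + 2 * (dirD par_s (dirD par_t eta1) ((0, t), p) * (dbump t * q1 p) + dirD par_s (dirD par_t eta2) ((0, t), p) * (dbump t * q2 p)).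

Lemma second_variation t p : t0 <= t <= t1 -> dirD var_s (dirD var_e lagrangian) (((0, 0), t), p) = second_var t p.
Proof.
  move=> Htt. have R0 := regular_base t p Htt. have Dt := D0 t Htt.
  have [a0 [b0 [c0 d0]]] := base t p Htt.
  have se f v : smooth_on dom f -> is_derive (fun s => dirD v f ((s, t), p)) 0 (dirD par_s (dirD v f) ((0, t), p)).
    move=> sf. apply: deriv_param => //. exact: smooth_dirD.
  have s1 := eta1_smooth. have s2 := eta2_smooth.
  have H := lagrangian_deriv2 (pressure lam) _ _ _ _ _ _ (bump t * dirD unit_x q1 p) (bump t * dirD unit_y q1 p) (bump t * dirD unit_x q2 p) (bump t * dirD unit_y q2 p)
    (dbump t * q1 p) (dbump t * q2 p) _ _ _ _ _ _ (pressure_ex_derive 1 Rlt_0_1) (se _ par_x s1) (se _ par_y s1) (se _ par_x s2) (se _ par_y s2)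
    (se _ par_t s1) (se _ par_t s2) a0 b0 c0 d0.
  apply: is_derive_unique. apply: is_derive_ext_loc H.
  have loc := locally_line regular (((0, 0), t), p) var_s 0 open_regular.
  rewrite line_0 in loc. apply: filter_imp (loc R0) => h. rewrite S_line Rplus_0_l => Rh.
  by rewrite first_variation.
Qed.

(** Since [box] is open, the [eps]-derivative at [eps = 0] vanishes for all [s] in a neighbourhood
    of 0 that depends on [[t0, t1]]. Hence its [s]-derivative vanishes too, and both derivatives
    pass under the integrals. *)
Lemma second_variation_zero : RInt (fun t => torus_integral (fun p => second_var t p)) t0 t1 = 0.
Proof.
  have Hle : t0 <= t1 by lra.
  have oR := open_regular. have sL := lagrangian_smooth.
  have oB := open_box ST t0 t1 regular oR.
  have Z : dirD ((1, 0) : ST) (dirD ((0, 1) : ST) (triple ST t0 t1 lagrangian)) (0, 0) = 0.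
    transitivity (Derive (fun _ : R => 0) 0); last exact: Derive_const.
    apply: Derive_ext_loc.
    have loc := locally_line (box ST t0 t1 regular) (0, 0) ((1, 0) : ST) 0 oB.
    rewrite line_0 in loc. apply: filter_imp (loc box_base) => h.
    rewrite prod_line R_line1 R_line0 Rplus_0_l => Bh.
    have crit := critical h (box_dom h 0 Bh).
    have crit2 : is_derive (fun e => / 2 * triple ST t0 t1 lagrangian (h, e)) 0 0.
      apply: is_derive_ext crit => e. exact: energy_pushed (box_dom h 0 Bh).
    (* The factor 2 removes the [/ 2] of the energy. *)
    have := is_derive_scal _ _ 2 _ crit2. rewrite Rmult_0_r => crit3.
    apply: is_derive_unique. apply: is_derive_ext crit3 => e.
    rewrite prod_line R_line1 R_line0 Rplus_0_l.
    have alg (u : R) : 2 * (/ 2 * u) = u by field.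
    exact: alg.
  have E := dirD2_triple ST t0 t1 Hle regular lagrangian (1, 0) (0, 1) (0, 0) oR sL box_base.
  rewrite -[RHS](eq_trans (eq_sym E) Z) /triple. apply: RInt_ext => t. rewrite Rmin_left // Rmax_right // => Htt.
  apply: torus_integral_ext => p. symmetry. apply: second_variation. lra.
Qed.

End Base.
End Test.
End Variation.

(** * The linearized geodesic equation *)

Lemma dirD_fst_add (v p : R * R) (k : R) : dirD (v : ptN) (fun q : ptN => fst q + k) p = fst v.
Proof.
  apply: is_derive_unique. case: p => x y. case: v => a b.
  apply: (is_derive_ext (fun h => x + h * a + k)); first by [].
  auto_derive => //=. ring.
Qed.

Lemma dirD_snd_add (v p : R * R) (k : R) : dirD (v : ptN) (fun q : ptN => snd q + k) p = snd v.
Proof.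
  apply: is_derive_unique. case: p => x y. case: v => a b.
  apply: (is_derive_ext (fun h => y + h * b + k)); first by [].
  auto_derive => //=. ring.
Qed.

(** * The displacement field in Lagrangian coordinates *)

Section Linearized.
Context (lam : R -> R) (c omega d : R) (D : R -> R -> Prop) (eta : R -> R -> pt -> pt) (F : R -> R -> pt -> R).
Context (lam_smooth : smooth_on (fun r : R => 0 < r) lam) (lam_pos : forall r, 0 < r -> 0 < lam r).
Context (c_sound : c ^ 2 = Derive (pressure lam) 1).
Context (variation : barotropic_variation lam D eta F).
Context (dp : 0 < d) (D0 : forall t, - d < t -> D 0 t).
Context (flow : forall t p, - d < t -> eta 0 t p = (fst p, snd p + omega * t)).

Local Notation e1 := (eta1 eta).
Local Notation e2 := (eta2 eta).
Local Notation U := (after d).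
Let oU : open U := open_after d.
Let s1 : smooth_on (dom D) e1 := eta1_smooth _ _ _ _ variation.
Let s2 : smooth_on (dom D) e2 := eta2_smooth _ _ _ _ variation.

Definition linearize (f : STP -> R) (z : TP) : R := dirD par_s f ((0, fst z), snd z).
Local Notation Y1 := (linearize e1).
Local Notation Y2 := (linearize e2).

Lemma base_jacobian t p : - d < t -> dirD par_x e1 ((0, t), p) = 1 /\ dirD par_y e1 ((0, t), p) = 0
   /\ dirD par_x e2 ((0, t), p) = 0 /\ dirD par_y e2 ((0, t), p) = 1.
Proof.
  move=> Ht. rewrite -!dirD_space.
  have E1 v : dirD v (fun q : ptN => e1 ((0, t), q)) p = dirD v (fun q : ptN => fst q + 0) p.
    apply: dirD_ext => q. by rewrite /eta1 /= flow // Rplus_0_r.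
  have E2 v : dirD v (fun q : ptN => e2 ((0, t), q)) p = dirD v (fun q : ptN => snd q + omega * t) p.
    apply: dirD_ext => q. by rewrite /eta2 /= flow.
  by rewrite !E1 !E2 !dirD_fst_add !dirD_snd_add.
Qed.

Definition at_zero (z : TP) : STP := ((0, fst z), snd z).

Lemma at_zero_line (z v : TP) (h : R) : at_zero (plus z (scal h v)) = plus (at_zero z) (scal h (at_zero v)).
Proof. case: z => t p. case: v => a v. by rewrite !prod_line R_line0. Qed.

Lemma at_zero_continuous z : continuous at_zero z.
Proof.
  case: z => t p P [r Hr]. exists r => -[t' p'] [/= H1 H2]. apply: Hr. split=> //. split=> //. exact: ball_center.
Qed.

Lemma lift_smooth f : smooth_on (dom D) f -> smooth_on U (fun z => f (at_zero z)).
Proof.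
  move=> sf. apply: (smooth_affine (V:=STP) (W:=TP) (dom D) U at_zero at_zero) => //.
  - exact: at_zero_line.
  - exact: at_zero_continuous.
  - move=> z Uz. exact: D0.
Qed.

Lemma linearize_smooth f : smooth_on (dom D) f -> smooth_on U (linearize f).
Proof. move=> sf. apply: (lift_smooth (dirD par_s f)). exact: smooth_dirD. Qed.

(** The vector [at_zero v] has no component along [s], so the symmetry of mixed derivatives lets a
    space or time derivative pass through the derivative in [s]. *)
Lemma linearize_dirD f (v : TP) t p : smooth_on (dom D) f -> - d < t ->
  dirD par_s (dirD (at_zero v) f) ((0, t), p) = dirD v (linearize f) (t, p).
Proof.
  move=> sf Ht.
  transitivity (dirD (at_zero v) (dirD par_s f) ((0, t), p)).
  - exact: (dirD_comm (dom D) par_s (at_zero v) f ((0, t), p) (open_dom _ _ _ _ variation) sf (D0 t Ht)).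
  - symmetry. apply: (dirD_affine at_zero at_zero (dirD par_s f)) => h. exact: at_zero_line.
Qed.

(** A lift commutes with integer translations, so its components are periodic up to additive
    constants, which the derivative in [s] removes. *)
Lemma linearize_periodic f (k : Z -> Z -> R) : smooth_on (dom D) f ->
  (forall s t m n p, D s t -> f ((s, t), translate m n p) = f ((s, t), p) + k m n) -> time_periodic d (linearize f).
Proof.
  move=> sf H t Ht m n p. rewrite /linearize /=.
  transitivity (dirD par_s (fun z : STP => f (fst z, translate m n (snd z))) ((0, t), p)).
    rewrite -[LHS](is_derive_unique _ _ _ (deriv_param D f t (translate m n p) sf (D0 t Ht))).
    rewrite (Derive_shift _ 0). apply Derive_ext => h. by rewrite s_line.
  have oD := open_dom _ _ _ _ variation.
  rewrite (dirD_ext_loc (dom D) par_s _ (fun z => f z + k m n) _ oD); last exact: D0.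
  - rewrite (dirD_plus (dom D)) //; [by rewrite dirD_const Rplus_0_r | exact: smooth_const | exact: D0].
  - move=> [[s' t'] p'] Ds. exact: H.
Qed.

Lemma displacement_periodic : time_periodic d Y1 /\ time_periodic d Y2.
Proof.
  have [_ [_ [[tor _] _]]] := variation.
  split.
  - apply: (linearize_periodic e1 (fun m _ => IZR m) s1) => s t m n p Ds.
    rewrite /eta1 /=. have [te _] := tor s t Ds. by rewrite te.
  - apply: (linearize_periodic e2 (fun _ n => IZR n) s2) => s t m n p Ds.
    rewrite /eta2 /=. have [te _] := tor s t Ds. by rewrite te.
Qed.

Local Notation dY := (divergence Y1 Y2).

Lemma displacement_smooth1 : smooth_on U Y1. Proof. exact: linearize_smooth. Qed.
Lemma displacement_smooth2 : smooth_on U Y2. Proof. exact: linearize_smooth. Qed.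
Lemma divergence_displacement_smooth : smooth_on U dY.
Proof. apply: smooth_plus => //; apply: smooth_dirD; [exact: displacement_smooth1 | exact: displacement_smooth2]. Qed.
Lemma divergence_displacement_periodic : time_periodic d dY.
Proof.
  have [p1 p2] := displacement_periodic. move=> t Ht m n p. rewrite /divergence.
  by rewrite (time_periodic_dirD d dir_x Y1 p1 t Ht) (time_periodic_dirD d dir_y Y2 p2 t Ht).
Qed.

(** The part of the second variation with the constant factor [pressure lam 1] drops out. *)
Lemma null_lagrangian f g : torus_function f -> torus_function g ->
  torus_integral (fun p => dirD unit_x f p * dirD unit_y g p - dirD unit_y f p * dirD unit_x g p) = 0.
Proof.
  move=> tf tg. have [sg _] := tg.
  have tfx := torus_function_dirD unit_x _ tf. have tfy := torus_function_dirD unit_y _ tf. have tgx := torus_function_dirD unit_x _ tg. have tgy := torus_function_dirD unit_y _ tg.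
  rewrite (torus_integral_minus _ _ (torus_function_contin _ (torus_function_mult _ _ tfx tgy)) (torus_function_contin _ (torus_function_mult _ _ tfy tgx))).
  rewrite (torus_integral_parts unit_x f (dirD unit_y g) tf tgy) (torus_integral_parts unit_y f (dirD unit_x g) tf tgx).
  rewrite (torus_integral_ext (fun p => f p * dirD unit_x (dirD unit_y g) p) (fun p => f p * dirD unit_y (dirD unit_x g) p)); first exact: Rminus_diag.
  move=> p. apply: (f_equal (Rmult (f p))). exact: (dirD_comm whole unit_x unit_y g p open_whole sg I).
Qed.

(** * Weak form of the wave equation *)

Section Weak.
Context (q1 q2 : pt -> R) (tq1 : torus_function q1) (tq2 : torus_function q2).

Definition residual1 (z : TP) : R := c ^ 2 * dirD dir_x dY z - dirD dir_t (dirD dir_t Y1) z.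
Definition residual2 (z : TP) : R := c ^ 2 * dirD dir_y dY z - dirD dir_t (dirD dir_t Y2) z.

Definition moment (f g : TP -> R) (t : R) : R :=
  torus_integral (fun p => f (t, p) * q1 p + g (t, p) * q2 p).

Lemma moment_smooth f g : smooth_on U f -> smooth_on U g ->
  smooth_on U (fun z => f z * q1 (snd z) + g z * q2 (snd z)).
Proof.
  move=> sf sg.
  have l1 := space_lift_smooth (X:=R_NormedModule) U q1 tq1 oU. have l2 := space_lift_smooth (X:=R_NormedModule) U q2 tq2 oU.
  apply: (smooth_plus U) => //; exact: (smooth_mult U).
Qed.

Lemma dirD_time_space (q : pt -> R) t p : dirD dir_t (fun z : TP => q (snd z)) (t, p) = 0.
Proof.
  transitivity (Derive (fun _ : R => q p) 0); last exact: Derive_const.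
  apply: Derive_ext => h. by rewrite time_line.
Qed.

Lemma moment_deriv f g t : smooth_on U f -> smooth_on U g -> - d < t ->
  is_derive (moment f g) t (moment (dirD dir_t f) (dirD dir_t g) t).
Proof.
  move=> sf sg Ht. have := is_derive_torus_integral d _ t (moment_smooth f g sf sg) Ht.
  have l1 := space_lift_smooth (X:=R_NormedModule) U q1 tq1 oU. have l2 := space_lift_smooth (X:=R_NormedModule) U q2 tq2 oU.
  have Uz p : U (t, p) by [].
  rewrite (torus_integral_ext _ (fun p => dirD dir_t f (t, p) * q1 p + dirD dir_t g (t, p) * q2 p)) //.
  move=> p. rewrite (dirD_plus U dir_t (fun z => f z * q1 (snd z)) (fun z => g z * q2 (snd z))) //; try exact: (smooth_mult U).
  rewrite (dirD_mult U dir_t f (fun z => q1 (snd z))) // (dirD_mult U dir_t g (fun z => q2 (snd z))) //.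
  rewrite !dirD_time_space !Rmult_0_r !Rplus_0_r. by [].
Qed.

Lemma moment_continuous f g t : smooth_on U f -> smooth_on U g -> - d < t -> continuous (moment f g) t.
Proof. move=> sf sg Ht. apply: ex_derive_continuous. eexists. exact: moment_deriv. Qed.

(** The determinant terms, with factor [pressure lam 1], integrate to zero. The derivative of the
    pressure at 1 is [c^2], and in its term an integration by parts moves the derivatives from the
    test field to [div Y], which turns the minus sign into a plus. *)
Lemma integrated_second_variation t0 t1 t : - d < t ->
  torus_integral (second_var lam eta t0 t1 q1 q2 t) =
  2 * (bump t0 t1 t * (c ^ 2 * moment (dirD dir_x dY) (dirD dir_y dY) t)
     + dbump t0 t1 t * moment (dirD dir_t Y1) (dirD dir_t Y2) t).
Proof.
  move=> Ht. have [p1 p2] := displacement_periodic.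
  have t1' := torus_function_slice d Y1 t displacement_smooth1 p1 Ht. have t2' := torus_function_slice d Y2 t displacement_smooth2 p2 Ht.
  have tD := torus_function_slice d dY t divergence_displacement_smooth divergence_displacement_periodic Ht.
  set y1 := fun p => Y1 (t, p) in t1'. set y2 := fun p => Y2 (t, p) in t2'. set dv := fun p => dY (t, p) in tD.
  have tt1 := torus_function_slice d _ t (smooth_dirD _ dir_t _ displacement_smooth1) (time_periodic_dirD d dir_t _ p1) Ht.
  have tt2 := torus_function_slice d _ t (smooth_dirD _ dir_t _ displacement_smooth2) (time_periodic_dirD d dir_t _ p2) Ht.
  have q1x := torus_function_dirD unit_x _ tq1. have q1y := torus_function_dirD unit_y _ tq1. have q2x := torus_function_dirD unit_x _ tq2. have q2y := torus_function_dirD unit_y _ tq2.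
  have y1x := torus_function_dirD unit_x _ t1'. have y1y := torus_function_dirD unit_y _ t1'. have y2x := torus_function_dirD unit_x _ t2'. have y2y := torus_function_dirD unit_y _ t2'.
  set th := bump t0 t1 t. set dth := dbump t0 t1 t.
  pose k1 := 2 * pressure lam 1 * th. pose k2 := - (2 * c ^ 2 * th). pose k3 := 2 * dth.
  pose N1 p := dirD unit_x y1 p * dirD unit_y q2 p - dirD unit_y y1 p * dirD unit_x q2 p.
  pose N2 p := dirD unit_x q1 p * dirD unit_y y2 p - dirD unit_y q1 p * dirD unit_x y2 p.
  pose Q p := dv p * dirD unit_x q1 p + dv p * dirD unit_y q2 p.
  pose M p := dirD dir_t Y1 (t, p) * q1 p + dirD dir_t Y2 (t, p) * q2 p.
  have E p : second_var lam eta t0 t1 q1 q2 t p = (k1 * N1 p + k1 * N2 p) + (k2 * Q p + k3 * M p).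
    rewrite /second_var.
    have -> : dirD par_s (dirD par_x e1) ((0, t), p) = dirD unit_x y1 p by rewrite (linearize_dirD e1 dir_x t p s1 Ht) -dirD_slice.
    have -> : dirD par_s (dirD par_y e1) ((0, t), p) = dirD unit_y y1 p by rewrite (linearize_dirD e1 dir_y t p s1 Ht) -dirD_slice.
    have -> : dirD par_s (dirD par_x e2) ((0, t), p) = dirD unit_x y2 p by rewrite (linearize_dirD e2 dir_x t p s2 Ht) -dirD_slice.
    have -> : dirD par_s (dirD par_y e2) ((0, t), p) = dirD unit_y y2 p by rewrite (linearize_dirD e2 dir_y t p s2 Ht) -dirD_slice.
    rewrite (linearize_dirD e1 dir_t t p s1 Ht) (linearize_dirD e2 dir_t t p s2 Ht).
    have dvE : dv p = dirD unit_x y1 p + dirD unit_y y2 p by rewrite /dv /divergence !dirD_slice.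
    rewrite /N1 /N2 /Q /M dvE -c_sound /k1 /k2 /k3 -/th -/dth. ring.
  rewrite (torus_integral_ext _ _ E).
  have tN1 : torus_function N1 := torus_function_minus _ _ (torus_function_mult _ _ y1x q2y) (torus_function_mult _ _ y1y q2x).
  have tN2 : torus_function N2 := torus_function_minus _ _ (torus_function_mult _ _ q1x y2y) (torus_function_mult _ _ q1y y2x).
  have tQ : torus_function Q := torus_function_plus _ _ (torus_function_mult _ _ tD q1x) (torus_function_mult _ _ tD q2y).
  have tM : torus_function M := torus_function_plus _ _ (torus_function_mult _ _ tt1 tq1) (torus_function_mult _ _ tt2 tq2).
  have ck f k : torus_function f -> contin (fun p => k * f p) by move=> tf; apply: contin_scal; exact: torus_function_contin.
  rewrite (torus_integral_plus _ _ (contin_plus _ _ (ck _ k1 tN1) (ck _ k1 tN2)) (contin_plus _ _ (ck _ k2 tQ) (ck _ k3 tM))).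
  rewrite (torus_integral_plus _ _ (ck _ k1 tN1) (ck _ k1 tN2)) (torus_integral_plus _ _ (ck _ k2 tQ) (ck _ k3 tM)).
  rewrite (torus_integral_scal _ _ (torus_function_contin _ tN1)) (torus_integral_scal _ _ (torus_function_contin _ tN2)) (torus_integral_scal _ _ (torus_function_contin _ tQ)) (torus_integral_scal _ _ (torus_function_contin _ tM)).
  have IN1 : torus_integral N1 = 0 := null_lagrangian y1 q2 t1' tq2.
  have IN2 : torus_integral N2 = 0 := null_lagrangian q1 y2 tq1 t2'.
  have IQ : torus_integral Q = - moment (dirD dir_x dY) (dirD dir_y dY) t.
    have tdx := torus_function_dirD unit_x _ tD. have tdy := torus_function_dirD unit_y _ tD.
    have -> : moment (dirD dir_x dY) (dirD dir_y dY) t = torus_integral (fun p => dirD unit_x dv p * q1 p + dirD unit_y dv p * q2 p).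
      apply: torus_integral_ext => p. by rewrite -(dirD_slice dY unit_x) -(dirD_slice dY unit_y).
    rewrite (torus_integral_plus _ _ (torus_function_contin _ (torus_function_mult _ _ tD q1x)) (torus_function_contin _ (torus_function_mult _ _ tD q2y))).
    rewrite (torus_integral_plus _ _ (torus_function_contin _ (torus_function_mult _ _ tdx tq1)) (torus_function_contin _ (torus_function_mult _ _ tdy tq2))).
    rewrite (torus_integral_parts unit_x dv q1 tD tq1) (torus_integral_parts unit_y dv q2 tD tq2).
    have alg (u v : R) : u + v = - (- u + - v) by ring.
    exact: alg.
  rewrite IN1 IN2 IQ.
  rewrite /k1 /k2 /k3 /moment -/M. ring.
Qed.

(** An integration by parts in time trades [dbump] and [Y_t] for [bump] and [Y_tt]; the boundary
    terms vanish with the bump. As the interval is arbitrary, [bump_integral_zero] removes the time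
    integral. *)
Lemma residual_moment_zero : forall t, - d < t -> moment residual1 residual2 t = 0.
Proof.
  have stt f : smooth_on U f -> smooth_on U (dirD dir_t (dirD dir_t f)) by move=> sf; do 2 apply: smooth_dirD.
  have sdx v : smooth_on U (fun z => c ^ 2 * dirD v dY z) by apply: smooth_scal => //; apply: smooth_dirD; exact: divergence_displacement_smooth.
  have sr1 : smooth_on U residual1 by apply: (smooth_minus U) => //; apply: stt; exact: displacement_smooth1.
  have sr2 : smooth_on U residual2 by apply: (smooth_minus U) => //; apply: stt; exact: displacement_smooth2.
  have sY1t := smooth_dirD U dir_t _ displacement_smooth1. have sY2t := smooth_dirD U dir_t _ displacement_smooth2.
  have sdx0 v : smooth_on U (dirD v dY) by apply: smooth_dirD; exact: divergence_displacement_smooth.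
  apply: (bump_integral_zero _ d); first by move=> t; exact: moment_continuous.
  move=> t0 t1 H0 H1.
  have sv : RInt (fun t => torus_integral (second_var lam eta t0 t1 q1 q2 t)) t0 t1 = 0.
    apply: (second_variation_zero lam D eta F lam_smooth lam_pos variation t0 t1 q1 q2 H1 tq1 tq2).
    - move=> t Ht. apply: D0. lra.
    - move=> t p Ht. apply: base_jacobian. lra.
  set m1 := moment (dirD dir_t Y1) (dirD dir_t Y2).
  set m2 := moment (dirD dir_t (dirD dir_t Y1)) (dirD dir_t (dirD dir_t Y2)).
  set K := moment (dirD dir_x dY) (dirD dir_y dY).
  have rE t : - d < t -> moment residual1 residual2 t = c ^ 2 * K t - m2 t.
    move=> Ht.
    have con f : smooth_on U f -> contin (fun p => f (t, p)) by move=> sf; apply: smooth_contin; exact: (smooth_slice d).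
    have cq1 := torus_function_contin _ tq1. have cq2 := torus_function_contin _ tq2.
    have cm f g : smooth_on U f -> smooth_on U g -> contin (fun p => f (t, p) * q1 p + g (t, p) * q2 p).
      move=> sf sg. apply: contin_plus; apply: contin_mult => //; exact: con.
    rewrite /K /m2 /moment -(torus_integral_scal _ _ (cm _ _ (sdx0 dir_x) (sdx0 dir_y))).
    rewrite -(torus_integral_minus _ _ (contin_scal _ _ (cm _ _ (sdx0 dir_x) (sdx0 dir_y))) (cm _ _ (stt _ displacement_smooth1) (stt _ displacement_smooth2))).
    apply: torus_integral_ext => p. rewrite /residual1 /residual2. ring.
  have cK t : - d < t -> continuous K t by exact: moment_continuous.
  have c1 t : - d < t -> continuous m1 t by exact: moment_continuous.
  have c2 t : - d < t -> continuous m2 t by apply: moment_continuous; apply: stt; [exact: displacement_smooth1 | exact: displacement_smooth2].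
  have cpoly (g : R -> R) t : ex_derive g t -> continuous g t by exact: ex_derive_continuous.
  have cth t : continuous (bump t0 t1) t by apply: cpoly; rewrite /bump; auto_derive.
  have cdth t : continuous (dbump t0 t1) t by apply: cpoly; rewrite /dbump; auto_derive.
  pose g1 t := bump t0 t1 t * (c ^ 2 * K t - m2 t).
  pose g2 t := dbump t0 t1 t * m1 t + bump t0 t1 t * m2 t.
  have cg1 t : - d < t -> continuous g1 t.
    move=> Ht. apply: (continuous_mult (bump t0 t1)) => //. apply: (continuous_minus (fun t => c ^ 2 * K t) m2); last exact: c2.
    apply: (continuous_mult (fun _ => c ^ 2) K); [exact: continuous_const | exact: cK].
  have cg2 t : - d < t -> continuous g2 t.
    move=> Ht. apply: (continuous_plus (fun t => dbump t0 t1 t * m1 t) (fun t => bump t0 t1 t * m2 t)).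
    - apply: (continuous_mult (dbump t0 t1) m1) => //. exact: c1.
    - apply: (continuous_mult (bump t0 t1) m2) => //. exact: c2.
  have exg (g : R -> R) : (forall t, - d < t -> continuous g t) -> ex_RInt g t0 t1.
    move=> cg. apply: (ex_RInt_continuous (V:=R_CompleteNormedModule)) => t Ht.
    rewrite Rmin_left in Ht; last lra. apply: cg. lra.
  (* [g2] is the derivative of [bump * m1], which vanishes at both ends. *)
  have I2 : RInt g2 t0 t1 = 0.
    apply: is_RInt_unique.
    have -> : 0 = minus (bump t0 t1 t1 * m1 t1) (bump t0 t1 t0 * m1 t0).
      rewrite /bump /minus /plus /opp /=. ring.
    apply: (is_RInt_derive (V:=R_CompleteNormedModule) (fun t => bump t0 t1 t * m1 t)) => t Ht;
      rewrite Rmin_left in Ht; try lra.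
    - have Ht' : - d < t by lra.
      have dm : is_derive m1 t (m2 t) by exact: moment_deriv.
      have dth : is_derive (bump t0 t1) t (dbump t0 t1 t) by rewrite /bump /dbump; auto_derive => //; ring.
      apply: (is_derive_mult (bump t0 t1) m1 t (dbump t0 t1 t) (m2 t) dth dm). exact: Rmult_comm.
    - apply: cg2. lra.
  have S : RInt (fun t => 2 * (g1 t + g2 t)) t0 t1 = 0.
    rewrite -sv. apply: RInt_ext => t. rewrite Rmin_left; last lra. move=> Ht.
    rewrite (integrated_second_variation t0 t1 t); last lra. rewrite -/K -/m1 /g1 /g2.
    have alg (a b u v w : R) : 2 * (a * (u - v) + (b * w + a * v)) = 2 * (a * u + b * w) by ring.
    exact: alg.
  have e1' := exg g1 cg1. have e2' := exg g2 cg2.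
  have e12 : ex_RInt (fun t => g1 t + g2 t) t0 t1 by exact: (ex_RInt_plus (V:=R_NormedModule)).
  rewrite (RInt_Rmult _ _ _ _ e12) (RInt_Rplus _ _ _ _ e1' e2') I2 in S.
  rewrite (RInt_ext _ g1); first by lra.
  move=> t. rewrite Rmin_left; last lra. move=> Ht. rewrite rE //. lra.
Qed.

End Weak.

(** At the fixed time [t] the residual is itself an admissible test field, so its [L^2] norm is
    zero. *)
Lemma wave_equation t p : - d < t -> residual1 (t, p) = 0 /\ residual2 (t, p) = 0.
Proof.
  move=> Ht. have [p1 p2] := displacement_periodic.
  have stt f : smooth_on U f -> smooth_on U (dirD dir_t (dirD dir_t f)) by move=> sf; do 2 apply: smooth_dirD.
  have sdx v : smooth_on U (fun z => c ^ 2 * dirD v dY z) by apply: smooth_scal => //; apply: smooth_dirD; exact: divergence_displacement_smooth.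
  have tD v : torus_function (fun p => dirD ((0, v) : TP) dY (t, p)).
    exact: (torus_function_slice d _ t (smooth_dirD _ _ _ divergence_displacement_smooth) (time_periodic_dirD d _ _ divergence_displacement_periodic) Ht).
  have tY f : smooth_on U f -> time_periodic d f -> torus_function (fun p => dirD dir_t (dirD dir_t f) (t, p)).
    move=> sf pf. exact: (torus_function_slice d _ t (stt f sf) (time_periodic_dirD d dir_t _ (time_periodic_dirD d dir_t _ pf)) Ht).
  have tr1 : torus_function (fun p => residual1 (t, p)).
    apply: torus_function_minus; [apply: torus_function_scal; exact: (tD unit_x) | exact: (tY Y1 displacement_smooth1 p1)].
  have tr2 : torus_function (fun p => residual2 (t, p)).
    apply: torus_function_minus; [apply: torus_function_scal; exact: (tD unit_y) | exact: (tY Y2 displacement_smooth2 p2)].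
  have Z := residual_moment_zero _ _ tr1 tr2 t Ht.
  rewrite /moment (torus_integral_plus _ _ (torus_function_contin _ (torus_function_mult _ _ tr1 tr1)) (torus_function_contin _ (torus_function_mult _ _ tr2 tr2))) in Z.
  have P1 := torus_integral_square_ge0 _ tr1. have P2 := torus_integral_square_ge0 _ tr2.
  have alg (u v : R) : 0 <= u -> 0 <= v -> u + v = 0 -> u = 0 /\ v = 0 by lra.
  have [Z1 Z2] := alg _ _ P1 P2 Z.
  split.
  - exact: (torus_integral_square_eq0 _ (torus_function_contin _ tr1) (proj2 tr1) Z1).
  - exact: (torus_integral_square_eq0 _ (torus_function_contin _ tr2) (proj2 tr2) Z2).
Qed.

Lemma linearize_acoustic : (forall p, Y1 (0, p) = 0) -> (forall p, Y2 (0, p) = 0) -> Acoustic d c Y1 Y2.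
Proof.
  move=> z1 z2. have [p1 p2] := displacement_periodic.
  split=> //; [exact: displacement_smooth1 | exact: displacement_smooth2 | |].
  - move=> t p Ht. have [H _] := wave_equation t p Ht. symmetry. exact: (Rminus_diag_uniq _ _ H).
  - move=> t p Ht. have [_ H] := wave_equation t p Ht. symmetry. exact: (Rminus_diag_uniq _ _ H).
Qed.

End Linearized.

(** * Growth of the Jacobi field *)

Lemma is_derive_fst (f : R -> pt) t (l : pt) : is_derive f t l -> is_derive (fun r => fst (f r)) t (fst l).
Proof.
  move=> H.
  have L := filterdiff_linear (F:=locally (f t)) _ (is_linear_fst (K:=R_AbsRing) (U:=R_NormedModule) (V:=R_NormedModule)).
  exact: (filterdiff_comp' f _ t _ _ H L).
Qed.

Lemma is_derive_snd (f : R -> pt) t (l : pt) : is_derive f t l -> is_derive (fun r => snd (f r)) t (snd l).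
Proof.
  move=> H.
  have L := filterdiff_linear (F:=locally (f t)) _ (is_linear_snd (K:=R_AbsRing) (U:=R_NormedModule) (V:=R_NormedModule)).
  exact: (filterdiff_comp' f _ t _ _ H L).
Qed.

Lemma affine_of_derive (f : R -> R) k d t : 0 < d -> - d < t -> (forall s, - d < s -> is_derive f s k) -> f t = f 0 + k * t.
Proof.
  move=> dp Ht H.
  have G s : - d < s -> is_derive (fun s => f s - k * s) s 0.
    move=> Hs. rewrite -(Rminus_diag k).
    apply: (is_derive_minus f (fun s => k * s)); first exact: H. auto_derive => //. ring.
  have E : f t - k * t = f 0 - k * 0.
    case: (Rtotal_order t 0) => [t0|[->//|t0]].
    - apply: (eq_is_derive (fun s => f s - k * s)) => // s Hs. apply: G. lra.
    - symmetry. apply: (eq_is_derive (fun s => f s - k * s)) => // s Hs. apply: G. lra.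
  lra.
Qed.

Lemma norm_fst_le (p : R * R) : Rabs (fst p) <= norm (p : ptN).
Proof.
  case: p => x y. change (Rabs x <= sqrt (Rabs x ^ 2 + Rabs y ^ 2)).
  rewrite -[X in X <= _](sqrt_square _ (Rabs_pos x)). apply: sqrt_le_1_alt.
  have := pow2_ge_0 (Rabs y). lra.
Qed.

Lemma norm_snd_le (p : R * R) : Rabs (snd p) <= norm (p : ptN).
Proof.
  case: p => x y. change (Rabs y <= sqrt (Rabs x ^ 2 + Rabs y ^ 2)).
  rewrite -[X in X <= _](sqrt_square _ (Rabs_pos y)). apply: sqrt_le_1_alt.
  have := pow2_ge_0 (Rabs x). lra.
Qed.

Lemma norm_le_sum (p : R * R) : norm (p : ptN) <= Rabs (fst p) + Rabs (snd p).
Proof.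
  case: p => x y. change (sqrt (Rabs x ^ 2 + Rabs y ^ 2) <= Rabs x + Rabs y).
  have Hx := Rabs_pos x. have Hy := Rabs_pos y.
  rewrite -[X in _ <= X]sqrt_square; last lra. apply: sqrt_le_1_alt. nra.
Qed.

Lemma linear_bounded_zero (w C : R) : (forall t, 0 <= t -> Rabs (t * w) <= C) -> w = 0.
Proof.
  move=> H. case: (Req_dec w 0) => // wn.
  have wp := Rabs_pos_lt w wn. have C0 := H 0 (Rle_refl 0). rewrite Rmult_0_l Rabs_R0 in C0.
  (* At this time [t |w| = C + 1], which exceeds the bound. *)
  have T0 : 0 <= (C + 1) / Rabs w by apply: Rlt_le; apply: Rdiv_lt_0_compat; lra.
  have := H _ T0. rewrite Rabs_mult (Rabs_pos_eq _ T0) /Rdiv Rmult_assoc Rinv_l; lra.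
Qed.

(** [norm_scal] gives one inequality; the other is the same one for [/ t] applied to [scal t x]. *)
Lemma norm_scal_R {V : NormedModule R_AbsRing} (t : R) (x : V) : norm (scal t x) = Rabs t * norm x.
Proof.
  apply: Rle_antisym; first exact: norm_scal.
  case: (Req_dec t 0) => [->|tn]; first by rewrite Rabs_R0 Rmult_0_l; exact: norm_ge_0.
  have E : x = scal (/ t) (scal t x).
    rewrite scal_assoc (_ : mult (/ t) t = one) ?scal_one //. exact: Rinv_l.
  have := norm_scal (/ t) (scal t x). rewrite -E /abs /= => H.
  have tp := Rabs_pos_lt t tn. rewrite Rabs_inv in H.
  apply: (Rle_trans _ (Rabs t * (/ Rabs t * norm (scal t x)))).
    apply: Rmult_le_compat_l => //. exact: Rlt_le.
  rewrite -Rmult_assoc Rinv_r ?Rmult_1_l; [exact: Rle_refl | lra].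
Qed.

Lemma grows_linearly_of_rate (J : R -> ptN) (w : ptN) C : w <> (0, 0) ->
  (forall t, 0 <= t -> norm (minus (J t) (scal t w)) <= C) -> grows_linearly (fun t => norm (J t)).
Proof.
  move=> wn H. have N : 0 < norm w.
    case: (Rle_lt_or_eq_dec _ _ (norm_ge_0 w)) => // E. exfalso. apply: wn.
    exact: (norm_eq_zero w (eq_sym E)).
  have C0 : 0 <= C by apply: Rle_trans (norm_ge_0 _) (H 0 (Rle_refl 0)).
  (* From [2 C / |w|] on, the error [C] is at most half of [t |w|], which gives the lower slope;
     from [C] on, it is at most [t], which gives the upper one. *)
  exists (norm w / 2), (norm w + 1), (2 * C / norm w + C). split; first lra.
  move=> t Ht. have P : 0 <= 2 * C / norm w.
    apply: Rmult_le_pos; first lra. exact: Rlt_le (Rinv_0_lt_compat _ N).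
  have t0 : 0 <= t by lra.
  have L : 2 * C <= norm w * t.
    apply: (Rle_trans _ (norm w * (2 * C / norm w))); first by apply: Req_le; field; lra.
    apply: Rmult_le_compat_l; lra.
  have := Rle_trans _ _ _ (norm_triangle_inv (J t) (scal t w)) (H t t0).
  rewrite norm_scal_R (Rabs_pos_eq t t0) => /Rabs_le_between. nra.
Qed.

Theorem theorem4p4
  (lam : R -> R) (omega c : R) (D : R -> R -> Prop)
  (eta : R -> R -> pt -> pt) (F : R -> R -> pt -> R)
  (j : R -> pt -> pt) (G : R -> pt -> R) (v0 : pt -> pt)
  (lam_smooth : smooth_on (fun r : R => 0 < r) lam)
  (lam_pos : forall r, 0 < r -> 0 < lam r)
  (c_pos : 0 < c)
  (c_sound : c ^ 2 = Derive (pressure lam) 1)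
  (variation : barotropic_variation lam D eta F)
  (base_velocity : forall t p, D 0 t ->
     is_derive (fun r => eta 0 r p) t (0, omega))
  (base_density : forall t p, D 0 t -> density_at (eta 0 t) p = 1)
  (jacobi : jacobi_field D eta F j G)
  (v0_field : vector_field v0)
  (j_init : forall p, j 0 p = (0, 0))
  (jt_init : forall p, is_derive (fun t => j t p) 0 (v0 p)) :
  (bounded_in_time j <-> is_gradient v0) /\
  (~ is_gradient v0 ->
   exists w : pt -> pt,
     divergence_free_part v0 w /\
     (exists p, w p <> (0, 0)) /\
     linear_growth_rate (eta 0) j w /\
     (forall p, w p <> (0, 0) ->
        grows_linearly (fun t => norm (j t (eta 0 t p))))).
Proof.
  have [oD [D_pos [fam [_ init]]]] := variation.
  (* A ball around [(0, 0)] inside [D] extends the base flow to times in [(- d, 0]], so that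
     derivatives at time 0 are two-sided. *)
  have [d Hd] := oD (0, 0) (D_pos 0 (Rle_refl 0)).
  have dp := cond_pos d.
  have D0 t : - d < t -> D 0 t.
    move=> Ht. case: (Rle_lt_dec 0 t) => [|tn]; first exact: D_pos.
    apply: (Hd (0, t)). split; first exact: ball_center.
    rewrite /ball /= /AbsRing_ball /= /abs /minus /plus /opp /=. apply: Rabs_def1; lra.
  have H0 : - d < 0 by lra.
  have flow t p : - d < t -> eta 0 t p = (fst p, snd p + omega * t).
    move=> Ht.
    have E1 := affine_of_derive (fun r => fst (eta 0 r p)) 0 d t dp Ht (fun s Hs => is_derive_fst _ _ _ (base_velocity s p (D0 s Hs))).
    have E2 := affine_of_derive (fun r => snd (eta 0 r p)) omega d t dp Ht (fun s Hs => is_derive_snd _ _ _ (base_velocity s p (D0 s Hs))).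
    have [I0 _] := init 0 p (D0 0 H0). rewrite I0 in E1 E2.
    rewrite (surjective_pairing (eta 0 t p)) E1 E2. congr pair. ring.
  pose Y1 := linearize (eta1 eta). pose Y2 := linearize (eta2 eta).
  have s1 := eta1_smooth _ _ _ _ variation. have s2 := eta2_smooth _ _ _ _ variation.
  have jY t p : - d < t -> j t (eta 0 t p) = (Y1 (t, p), Y2 (t, p)).
    move=> Ht. have [Hj _] := jacobi t p (D0 t Ht).
    have F1 := is_derive_unique _ _ _ (is_derive_fst _ _ _ Hj). have F2 := is_derive_unique _ _ _ (is_derive_snd _ _ _ Hj).
    rewrite (surjective_pairing (j t (eta 0 t p))) -F1 -F2.
    congr pair; apply: is_derive_unique.
    - exact: (deriv_param D _ t p s1 (D0 t Ht)).
    - exact: (deriv_param D _ t p s2 (D0 t Ht)).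
  (* The Eulerian form: the base flow is a translation and is inverted explicitly. *)
  have jY' t p : - d < t -> j t p = (Y1 (t, (fst p, snd p - omega * t)), Y2 (t, (fst p, snd p - omega * t))).
    move=> Ht. rewrite -jY // flow //=. congr j. case: p => x y /=. congr pair. ring.
  have z p : Y1 (0, p) = 0 /\ Y2 (0, p) = 0.
    have := jY' 0 p H0. rewrite j_init Rmult_0_r Rminus_0_r. case: p => x y /=. by case=> <- <-.
  have S : Acoustic d c Y1 Y2.
    apply: (linearize_acoustic lam c omega d D eta F) => // p; by case: (z p).
  have displacement_smooth1 := acoustic_smooth1 _ _ _ _ S. have displacement_smooth2 := acoustic_smooth2 _ _ _ _ S.
  (* Along the transported point the time derivative is [f_t - omega f_y], and at time 0 the second
     term vanishes because [f] does. Hence [j_t] and [Y_t] agree at time 0, which identifies [v0]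
     with the initial velocity of the displacement. *)
  have rate f p : smooth_on (after d) f -> (forall p, f (0, p) = 0) ->
      is_derive (fun t => f (t, (fst p, snd p - omega * t))) 0 (dirD dir_t f (0, p)).
    move=> sf f0. have U0 : after d (0, p) by [].
    have := smooth_is_derive0 (after d) f (0, p) ((1, (0, - omega)) : TP) sf U0.
    have -> : dirD ((1, (0, - omega)) : TP) f (0, p) = dirD dir_t f (0, p).
      have E : ((1, (0, - omega)) : TP) = plus (scal 1 dir_t) (scal 1 ((0, (0, - omega)) : TP)).
        rewrite /plus /scal /= /prod_plus /prod_scal /plus /scal /= /prod_plus /prod_scal /plus /scal /= /mult /=.
        congr pair; [ring | congr pair; ring].
      rewrite E (dirD_linear (after d) dir_t _ 1 1 f (0, p) (open_after d) sf U0) !Rmult_1_l.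
      have -> : dirD ((0, (0, - omega)) : TP) f (0, p) = 0.
        rewrite -(dirD_slice f (0, - omega)). rewrite -[RHS](dirD_const ((0, - omega) : ptN) 0 p). exact: dirD_ext.
      exact: Rplus_0_r.
    apply: is_derive_ext => h. case: p {U0} => x y. congr f.
    rewrite /plus /scal /= /prod_plus /prod_scal /plus /scal /= /prod_plus /prod_scal /plus /scal /= /mult /=.
    congr pair; [ring | congr pair; ring].
  have locd : locally 0 (fun t => - d < t) by exact: (open_gt (- d) 0 H0).
  have v0E p : v0 p = (dirD dir_t Y1 (0, p), dirD dir_t Y2 (0, p)).
    rewrite (surjective_pairing (v0 p)).
    rewrite -(is_derive_unique _ _ _ (is_derive_fst _ _ _ (jt_init p))) -(is_derive_unique _ _ _ (is_derive_snd _ _ _ (jt_init p))).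
    congr pair; apply: is_derive_unique.
    - apply: is_derive_ext_loc (rate Y1 p displacement_smooth1 (fun p => proj1 (z p))). apply: filter_imp locd => t Ht. by rewrite jY'.
    - apply: is_derive_ext_loc (rate Y2 p displacement_smooth2 (fun p => proj2 (z p))). apply: filter_imp locd => t Ht. by rewrite jY'.
  have [w1 [w2 [f [tw1 [tw2 [tf [dv [gr [C HC]]]]]]]]] := acoustic_growth d c Y1 Y2 dp c_pos S.
  pose w p := (w1 p, w2 p).
  have v0w p : v0 p = (w1 p + dirD unit_x f p, w2 p + dirD unit_y f p).
    rewrite v0E. have [<- <-] := gr p.
    have alg (a b : R) : a = b + (a - b) by ring.
    congr pair; exact: alg.
  have wrate : linear_growth_rate (eta 0) j w.
    exists (C + C) => t p Ht. rewrite jY; last lra.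
    apply: Rle_trans (norm_le_sum _) _. have [B1 B2] := HC t p Ht. exact: Rplus_le_compat.
  have w0_grad : (forall p, w p = (0, 0)) -> is_gradient v0.
    move=> w0. exists f. split=> // p. rewrite v0w /grad d_x_dirD d_y_dirD.
    have [-> ->] := w0 p. by rewrite !Rplus_0_l.
  split.
  - split.
    + move=> [C' HC']. apply: w0_grad => p.
      (* Both [Y] and [Y - t w] are bounded, so [t w] is bounded too, which forces [w = 0]. *)
      have B t : 0 <= t -> Rabs (t * w1 p) <= C + C' /\ Rabs (t * w2 p) <= C + C'.
        move=> Ht. have Ht' : - d < t by lra. have [B1 B2] := HC t p Ht.
        have N := HC' t (eta 0 t p) Ht. rewrite jY // in N.
        have N1 := Rle_trans _ _ _ (norm_fst_le _) N. have N2 := Rle_trans _ _ _ (norm_snd_le _) N.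
        have alg (a b : R) : Rabs (a - b) <= C -> Rabs a <= C' -> Rabs b <= C + C'.
          move=> /Rabs_le_between ? /Rabs_le_between ?. apply/Rabs_le_between. lra.
        by split; [exact: (alg _ _ B1 N1) | exact: (alg _ _ B2 N2)].
      rewrite /w (linear_bounded_zero (w1 p) (C + C')); last by move=> t Ht; case: (B t Ht).
      rewrite (linear_bounded_zero (w2 p) (C + C')) //. by move=> t Ht; case: (B t Ht).
    + move=> [g [tg Hg]].
      have [sg _] := tg. have [sf _] := tf.
      (* If [v0] is the gradient of [g], then [w] is that of [g - f]; being also divergence free, it
         vanishes. *)
      have W p : w1 p = dirD unit_x (fun p => g p - f p) p /\ w2 p = dirD unit_y (fun p => g p - f p) p.
        rewrite !(dirD_minus whole) //. have := Hg p. rewrite v0w /grad d_x_dirD d_y_dirD.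
        case=> <- <-. have alg (a b : R) : a = a + b - b by ring. split; exact: alg.
      have Z := div_free_gradient_zero w1 w2 _ tw1 tw2 (torus_function_minus _ _ tg tf) dv (fun p => proj1 (W p)) (fun p => proj2 (W p)).
      exists (C + C) => t p Ht. rewrite jY'; last lra.
      apply: Rle_trans (norm_le_sum _) _.
      have := HC t (fst p, snd p - omega * t) Ht. have [-> ->] := Z (fst p, snd p - omega * t).
      rewrite Rmult_0_r !Rminus_0_r => -[B1 B2]. exact: Rplus_le_compat.
  - move=> ng. exists w. split; [|split; [|split]].
    + split; [|split].
      * have [sw1 pw1] := tw1. have [sw2 pw2] := tw2. split; first by split.
        move=> m n p. by rewrite /w pw1 pw2.
      * move=> p. rewrite /div d_x_dirD d_y_dirD. exact: dv.
      * exists f. split=> // p. rewrite v0w /grad d_x_dirD d_y_dirD /w.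
        have alg (a b : R) : a + b - a = b by ring.
        rewrite /minus /plus /opp /= /prod_plus /prod_opp /plus /opp /=.
        congr pair; exact: alg.
    (* If [w] vanished everywhere, [v0] would be the gradient of [f]. *)
    + apply: NNPP => H. apply: ng. apply: w0_grad => p. apply: NNPP => wn. apply: H. by exists p.
    + exact: wrate.
    + move=> p wn. have [K HK] := wrate.
      exact: (grows_linearly_of_rate (fun t => j t (eta 0 t p)) (w p) K wn (fun t Ht => HK t p Ht)).
Qed.
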